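(* Let $n\ge1$, $0<p<\infty$, $0<q\le\infty$, $\max\{0,\frac np-\frac n2\}<\lambda<\frac np$, and define $s$ by $\frac1s=\frac1p-\frac\lambda n$, so that $0<\frac1s<\frac12$. Let $s'=\frac{s}{s-1}$. (1) There is a constant $C>0$, depending only on $n,p,q,\lambda$, such that for every $f\in L_1(\mathbb R^n)$ $$\|\widehat f\|_{M_{p,q}^\lambda}\le C\|f\|_{L_{s',q}}.$$ In particular (case $q=\infty$), $\|\widehat f\|_{M_p^\lambda}\le C\|f\|_{L_{s',\infty}}$, $2<s<\infty$. (2) The estimate $\|\widehat f\|_{M_{p,q}^\lambda}\lesssim D_{p,q}^\lambda(f)$ is sharper than the one in (1): for any $0<q\le\infty$ there exists a measurable function $f$ on $\mathbb R^n$ such that $D_{p,q}^\lambda(f)<\infty$ but $\|f\|_{L_{s',q}}=\infty$.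
   Context: The Fourier transform of $f\in L_1(\mathbb R^n)$ is $\widehat f(y)=\int_{\mathbb R^n}f(x)e^{-2\pi i(x,y)}\,dx$. Morrey-type quasi-norm: with $B_r(x)$ the ball of radius $r$ centered at $x$, $\|g\|_{M^\lambda_{p,q}}=\big(\int_0^\infty(r^{-\lambda}\sup_{x\in\mathbb R^n}\|g\|_{L_p(B_r(x))})^q\frac{dr}r\big)^{1/q}$ for $q<\infty$, and $\|g\|_{M^\lambda_p}=\|g\|_{M^\lambda_{p,\infty}}=\sup_{r>0}r^{-\lambda}\sup_{x}\|g\|_{L_p(B_r(x))}$. Lorentz quasi-norm: with $f^*$ the decreasing rearrangement of $f$, $\|f\|_{L_{s',q}}=\big(\int_0^\infty(t^{1/s'}f^*(t))^q\frac{dt}{t}\big)^{1/q}$ for $q<\infty$, and $\|f\|_{L_{s',\infty}}=\sup_{t>0}t^{1/s'}f^*(t)$. For $k\in\mathbb Z^n$, $m\in\mathbb Z$, let $Q_k^m=[0,2^m)^n+2^mk$, and with $\beta=\lambda-\max\{0,\frac np-\frac n2\}$, $$D_{p,q}^\lambda(f)=\bigg(\sum_{m\in\mathbb Z}\bigg(\sup_{e\subset\mathbb Z^n}\frac{(1+\ln|e|)^{n+1}}{|e|^{\beta/n}}\cdot\frac{1}{\big|\bigcup_{k\in e}Q_k^m\big|^{\frac1p-\frac\lambda n}}\int_{\bigcup_{k\in e}Q_k^m}|f(x)|\,dx\bigg)^q\bigg)^{1/q}$$ (with $\sup_{m\in\mathbb Z}$ replacing the $\ell_q$-sum if $q=\infty$),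 where the supremum is over finite nonempty $e\subset\mathbb Z^n$, $|e|$ is the cardinality of $e$, and $|\bigcup_{k\in e}Q_k^m|$ is Lebesgue measure. *)

(* Defs.v *)
From HB Require Import structures.
From mathcomp Require Import all_boot all_order all_algebra finmap complex.
From mathcomp Require Import all_classical all_reals all_analysis.

Set Implicit Arguments.
Unset Strict Implicit.
Unset Printing Implicit Defensive.

Import Order.TTheory GRing.Theory Num.Theory.

Local Open Scope classical_set_scope.
Local Open Scope ring_scope.

(* R^n is [n.-tuple R] with the library's product sigma-algebra, i.e. the Borel
   sets; Lebesgue measure on it is the iterated product of the one-dimensional
   [lebesgue_measure], transported along (x, t) |-> x :: t. *)

Section cons_measure.
Context {R : realType} {n : nat}.

Definition tuple_cons (z : measurableTypeR R * n.-tuple R) : n.+1.-tuple R :=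
  [tuple of z.1 :: z.2].

Lemma measurable_tuple_cons : measurable_fun [set: _] tuple_cons.
Proof.
exact: (@measurable_cons _ _ (measurableTypeR R * n.-tuple R)%type R).
Qed.

Definition tuple_uncons (x : n.+1.-tuple R) : measurableTypeR R * n.-tuple R :=
  (thead x, [tuple of behead x]).

Lemma measurable_tuple_uncons : measurable_fun [set: _] tuple_uncons.
Proof.
apply/measurable_fun_pairP; split; last exact: measurable_behead.
exact: (@measurable_tnth _ R n.+1 ord0).
Qed.

Lemma tuple_consK : cancel tuple_cons tuple_uncons.
Proof.
by move=> [x t]; rewrite /tuple_uncons/=; congr pair; exact: val_inj.
Qed.

Variable mu : {sigma_finite_measure set (n.-tuple R) -> \bar R}.

Definition cons_measure : set (n.+1.-tuple R) -> \bar R :=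
  pushforward (lebesgue_measure \x mu)%E tuple_cons.

#[local] Hint Resolve measurable_tuple_cons : core.

Let cons_measure0 : cons_measure set0 = 0%E.
Proof. exact: measure0. Qed.

Let cons_measure_ge0 A : (0 <= cons_measure A)%E.
Proof. exact: measure_ge0. Qed.

Let cons_measure_sigma_additive : semi_sigma_additive cons_measure.
Proof. exact: measure_semi_sigma_additive. Qed.

HB.instance Definition _ := isMeasure.Build _ _ _ cons_measure
  cons_measure0 cons_measure_ge0 cons_measure_sigma_additive.

Lemma cons_measure_sigma_finite : sigma_finite [set: _] cons_measure.
Proof.
have /sigma_finiteP[F [FT ndF Foo]] := sigma_finiteT (@lebesgue_measure R).
have /sigma_finiteP[G [GT ndG Goo]] := sigma_finiteT mu.
exists (fun i => tuple_uncons @^-1` (F i `*` G i)).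
  apply/esym; rewrite -subTset => x _.
  have [i _ Fi] : (\bigcup_i F i) (tuple_uncons x).1 by rewrite -FT.
  have [j _ Gj] : (\bigcup_i G i) (tuple_uncons x).2 by rewrite -GT.
  exists (maxn i j) => //; split.
    by move: (Fi); exact/subsetPset/ndF/leq_maxl.
  by move: (Gj); exact/subsetPset/ndG/leq_maxr.
move=> i; have [mF F_oo] := Foo i; have [mG G_oo] := Goo i; split.
  rewrite -[X in measurable X]setTI; apply: measurable_tuple_uncons => //.
  exact: measurableX.
rewrite /cons_measure /pushforward -comp_preimage.
rewrite (_ : _ \o _ = id); last by apply/funext; exact: tuple_consK.
rewrite preimage_id product_measure1E//.
by rewrite lte_mul_pinfty// ge0_fin_numE.
Qed.

HB.instance Definition _ := Measure_isSigmaFinite.Build _ _ _ cons_measure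
  cons_measure_sigma_finite.

End cons_measure.

Fixpoint lebesgue_Rn (R : realType) (n : nat) :
    {sigma_finite_measure set (n.-tuple R) -> \bar R} :=
  match n with
  | 0 => \d_ ([tuple] : 0.-tuple R)
  | m.+1 => cons_measure (lebesgue_Rn R m)
  end.

Lemma lebesgue_Rn_box (R : realType) (n : nat) (a b : n.-tuple R) :
  (forall i, tnth a i <= tnth b i) ->
  let box := [set x : n.-tuple R | forall i, tnth a i <= tnth x i < tnth b i] in
  measurable box /\
  lebesgue_Rn R n box = (\prod_(i < n) (tnth b i - tnth a i))%:E.
Proof.
elim: n a b => [|n IHn] a b ab box.
  have -> : box = setT by apply/seteqP; split=> // x _ [].
  by rewrite big_ord0 /= diracT; split.
have [//|mbox boxE] :=
  IHn [tuple of behead a] [tuple of behead b].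
  by move=> i; rewrite !tnth_behead.
set box' := [set x | _] in mbox boxE.
have boxX : box = tuple_uncons @^-1` (`[thead a, thead b[ `*` box').
  apply/seteqP; split=> [x xbox|x [/= x0 xbox'] i].
    split=> [|i] /=; first by rewrite in_itv/=; exact: xbox.
    by rewrite !tnth_behead; exact: xbox.
  have [->|i0] := eqVneq i ord0; first by rewrite in_itv/= in x0.
  have i1n : (i.-1 < n)%N by rewrite prednK ?lt0n// -ltnS.
  move: (xbox' (Ordinal i1n)); rewrite !tnth_behead.
  rewrite (_ : inord _ = i)//; apply/val_inj => /=.
  by rewrite prednK ?lt0n// inordK.
split.
  rewrite boxX -[X in measurable X]setTI; apply: measurable_tuple_uncons => //.
  exact: measurableX.
rewrite /= /cons_measure /pushforward boxX -comp_preimage.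
rewrite (_ : _ \o _ = id); last by apply/funext; exact: tuple_consK.
rewrite preimage_id product_measure1E// [X in (_ * X)%E]boxE.
have itvE : lebesgue_measure `[thead a, thead b[ =
    (tnth b ord0 - tnth a ord0)%:E.
  rewrite lebesgue_measure_itv/= lte_fin /thead; case: ltP => // ba.
  by have -> : tnth b ord0 = tnth a ord0;
    [apply/eqP; rewrite eq_le ba ab|rewrite subrr].
rewrite [X in (X * _)%E]itvE big_ord_recl EFinM.
have tb i : tnth [tuple of behead b] i - tnth [tuple of behead a] i =
    tnth b (lift ord0 i) - tnth a (lift ord0 i).
  rewrite !tnth_behead (_ : inord _ = lift ord0 i)//.
  by apply/val_inj; rewrite /= inordK// ltnS.
by under eq_bigr do rewrite tb.
Qed.

Section definitions.
Context {R : realType}.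
Implicit Types (n : nat) (p q : \bar R).
Import ComplexField.Normc.

Definition dotp n (x y : n.-tuple R) : R := \sum_(i < n) tnth x i * tnth y i.

Definition eball n (x : n.-tuple R) (r : R) : set (n.-tuple R) :=
  [set y | Num.sqrt (\sum_(i < n) (tnth y i - tnth x i) ^+ 2) < r].

Definition cmeasurable n (f : n.-tuple R -> R[i]) :=
  measurable_fun [set: n.-tuple R] (@complex.Re R \o f) /\
  measurable_fun [set: n.-tuple R] (@complex.Im R \o f).

Definition cintegrable n (f : n.-tuple R -> R[i]) :=
  (lebesgue_Rn R n).-integrable [set: n.-tuple R] (EFin \o (@complex.Re R \o f)) /\
  (lebesgue_Rn R n).-integrable [set: n.-tuple R] (EFin \o (@complex.Im R \o f)).

Definition cintegral n (f : n.-tuple R -> R[i]) : R[i] :=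
  ((\int[lebesgue_Rn R n]_x @complex.Re R (f x)) +i*
   (\int[lebesgue_Rn R n]_x @complex.Im R (f x)))%C.

Definition cis (t : R) : R[i] := (cos t +i* sin t)%C.

Definition fourier n (f : n.-tuple R -> R[i]) (y : n.-tuple R) : R[i] :=
  cintegral (fun x => f x * cis (- (2 * pi * dotp x y))).

(* The L_q(dt/t) quasi-norm on ]0, +oo[; only used with 0 < q, so the last
   branch is q = +oo. *)
Definition Lq_dt_t q (F : R -> \bar R) : \bar R :=
  (match q with
   | q'%:E => (\int[lebesgue_measure]_(t in `]0%R, +oo[)
                 (F t `^ q' * (t^-1)%:E)) `^ q'^-1
   | _ => ereal_sup [set F t | t in `]0%R, +oo[ ]
   end)%E.

(* The l_q(Z) quasi-norm of a nonnegative family, with the same convention. *)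
Definition lqZ q (a : int -> \bar R) : \bar R :=
  (match q with
   | q'%:E => (\esum_(m in [set: int]) (a m `^ q')) `^ q'^-1
   | _ => ereal_sup (range a)
   end)%E.

Definition Lp_on n (p : R) (A : set (n.-tuple R)) (g : n.-tuple R -> R[i]) :
    \bar R :=
  ((\int[lebesgue_Rn R n]_(x in A) ((normc (g x))%:E `^ p)) `^ p^-1)%E.

Definition morrey n (p : R) q (lam : R) (g : n.-tuple R -> R[i]) : \bar R :=
  Lq_dt_t q (fun r =>
    (r `^ (- lam))%:E *
    ereal_sup [set Lp_on p (eball x r) g | x in [set: n.-tuple R]])%E.

(* inf set0 = +oo *)
Definition rearrangement n (f : n.-tuple R -> R[i]) (t : R) : \bar R :=
  ereal_inf [set s%:E | s in
    [set s : R | 0 <= s /\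
      (lebesgue_Rn R n [set x | (s < normc (f x))%R] <= t%:E)%E]].

Definition lorentz n (p : R) q (f : n.-tuple R -> R[i]) : \bar R :=
  Lq_dt_t q (fun t => (t `^ p^-1)%:E * rearrangement f t)%E.

Definition dcube n (m : int) (k : n.-tuple int) : set (n.-tuple R) :=
  [set x | forall i, 0 <= tnth x i - 2 ^ m * (tnth k i)%:~R < 2 ^ m].

Definition dcubes n (m : int) (e : {fset n.-tuple int}) : set (n.-tuple R) :=
  \bigcup_(k in [set` e]) dcube m k.

Definition D_exponent n (p lam : R) : R :=
  lam - Num.max 0 (n%:R / p - n%:R / 2).

Definition D_weight n (p lam : R) (m : int) (e : {fset n.-tuple int}) : R :=
  (1 + ln #|` e|%:R) ^+ n.+1 / #|` e|%:R `^ (D_exponent n p lam / n%:R) /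
  fine (lebesgue_Rn R n (dcubes m e)) `^ (p^-1 - lam / n%:R).

Definition D_norm n (p : R) q (lam : R) (f : n.-tuple R -> R[i]) : \bar R :=
  lqZ q (fun m => ereal_sup
    [set ((D_weight p lam m e)%:E *
          \int[lebesgue_Rn R n]_(x in dcubes m e) (normc (f x))%:E)%E
       | e in [set e : {fset n.-tuple int} | e != fset0%fset]]).

End definitions.

(* Main.v *)
Require Import Defs.
From HB Require Import structures.
From mathcomp Require Import all_boot all_order all_algebra finmap complex.
From mathcomp Require Import all_classical all_reals all_analysis.
From mathcomp Require Import measurable_realfun ring lra zify.

Set Implicit Arguments.
Unset Strict Implicit.
Unset Printing Implicit Defensive.

Import Order.TTheory GRing.Theory Num.Theory.
Import numFieldNormedType.Exports.

Local Open Scope ring_scope.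

(** Why the theorem is true. Put sg = 1/p - lam/n = 1/s, be = D_exponent / n and
    P = max(p, 2); then sg + be = 1/P ([sigma_add_beta]). Let A_m be the supremum that D_norm
    attaches to the scale m ([D_sup]).

    From D_norm to the Morrey norm. On a ball of radius 2^-m the transform of f only sees
    the masses a_k of |f| on the dyadic cubes of side 2^m. When f is supported on finitely
    many of them, the square of its transform integrates over the ball to at most a constant
    times 2^(-mn) times the sum of the a_k^2 ([local_L2_estimate]). This is almost
    orthogonality: dominate the indicator of the ball by a product W of triangle functions,
    whose Fourier transform decays quadratically in each coordinate; the weighted integral is
    the double integral of f(u) f(v) against the transform of W at u - v, and the Schur test
    bounds it. A general f is cut into blocks, the j-th one made of the cubes of mass about
    2^-j M with M = 2^(mn sg) A_m. The definition of A_m bounds the number N of cubes of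
    that block by N^(1-1/P) 2^-j <= C (1+j)^-2; the logarithmic factor in the definition of
    D_norm is what produces this summable decay ([relative_size_bound]). On one block,
    interpolate between the L_2 estimate and the trivial bound N 2^-j M; summing over the blocks gives an L_P
    bound ([local_LP]), hence an L_p bound on the ball ([local_Lp]), which comes out as a
    constant times 2^(-m lam) A_m. Finally the L_q(dt/t) quasi-norm is compared with l_q
    over the dyadic scales ([morrey_fourier_le]).

    From the Lorentz norm to D_norm. On a set of measure 2^l, the integral of |f| is at most twice
    the sum of 2^(l-i) R(2^(l-i)) over i >= 0, where R is the rearrangement of f
    ([integral_le_layers]). For a union of N cubes of side 2^m the weight contains
    N^(-be) (1 + ln N)^(n+1), which decays like a power of N; hence A_m is at most a
    constant times the supremum over j of 2^(-kap |j|) b_(mn+j), where b_l = 2^(l/s') R(2^l).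
    Damped suprema of translates are bounded on l_q for every q > 0
    ([lqZ_sup_translates]), and the l_q norm of b is the Lorentz norm up to constants
    ([D_norm_le_lorentz]). Both inequalities together give part (1).

    Sharpness. Place unit cubes at exponentially growing positions and let f be about
    (k+1)^-gam on the k-th one. Then R(t) is about t^-gam, so that the Lorentz norm is infinite
    as soon as gam < 1/s' ([lorentz_sparse_infty]). The norm D_norm sees the sparsity: a cube
    of side 2^m >= 1 meets the support in measure at most m + 2 instead of 2^(mn), and A_m decays
    geometrically in both directions provided sg < 1 - gam < 1/P ([D_norm_sparse_lty]).
    Since be > 0 these conditions on gam are compatible. *)

(** * Elementary inequalities *)

Section elementary_inequalities.
Context {R : realType}.

Lemma powRXn (x y : R) k : 0 <= x -> (x ^+ k) `^ y = (x `^ y) ^+ k.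
Proof.
move=> x0.
by rewrite -[RHS]powR_mulrn ?powR_ge0// -powRrM mulrC powRrM powR_mulrn.
Qed.

Lemma powR_lt1 (x y : R) : 0 <= x -> x < 1 -> 0 < y -> x `^ y < 1.
Proof.
move=> x0 x1 y0; have := gt0_ltr_powR y0 _ _ x1.
by rewrite !nnegrE powR1; apply.
Qed.

Lemma powR2D (x y : R) : 2 `^ (x + y) = 2 `^ x * 2 `^ y :> R.
Proof. by rewrite powRD// pnatr_eq0 implybT. Qed.

Lemma powR2X (x : R) k : (2 `^ x) ^+ k = 2 `^ (x * k%:R) :> R.
Proof. by rewrite -powR_mulrn ?powR_ge0// powRrM. Qed.

Lemma powR2_lt1 (x : R) : x < 0 -> 2 `^ x < 1.
Proof.
move=> x0; rewrite /powR pnatr_eq0/= -[ltRHS]expR0 ltr_expR.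
by rewrite nmulr_rlt0// ln_gt0// ltr1n.
Qed.

(** The larger of the two summands is at least half of the sum; this covers p < 1, where
    convexity fails. *)
Lemma powR_add_le (x y p : R) : 0 <= x -> 0 <= y -> 0 <= p ->
  (x + y) `^ p <= 2 `^ p * (x `^ p + y `^ p).
Proof.
move=> x0 y0 p0.
have H (u v : R) : 0 <= u -> 0 <= v -> u <= v ->
    (u + v) `^ p <= 2 `^ p * (u `^ p + v `^ p).
  move=> u0 v0 uv; apply: (@le_trans _ _ ((2 * v) `^ p)).
    by apply: ge0_ler_powR; rewrite ?nnegrE ?addr_ge0 ?mulr_ge0//; lra.
  by rewrite powRM// ler_wpM2l ?powR_ge0// lerDr powR_ge0.
have [xy|/ltW yx] := leP x y; first exact: H.
by rewrite addrC (addrC (x `^ p)); exact: H.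
Qed.

(** A power of a logarithm is absorbed by any positive power: ln x is at most x to the
    power a over a, applied with a = eta / k. *)
Lemma one_add_ln_exp_le (k : nat) (eta : R) : 0 < eta ->
  exists2 C : R, 0 < C & forall x, 1 <= x -> (1 + ln x) ^+ k <= C * x `^ eta.
Proof.
move=> e0; case: k => [|k].
  exists 1 => // x x1; rewrite expr0 mul1r -(powRr0 x).
  by apply: ler_powR => //; exact: ltW.
pose a := eta / k.+1%:R; have a0 : 0 < a by rewrite divr_gt0.
exists ((1 + a^-1) ^+ k.+1); first by rewrite exprn_gt0// addr_gt0 ?invr_gt0.
move=> x x1; have x0 : 0 < x by exact: lt_le_trans x1.
have xa1 : 1 <= x `^ a by rewrite -(powRr0 x) ler_powR// ltW.
have lnx : ln x <= a^-1 * x `^ a.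
  rewrite mulrC ler_pdivlMr// mulrC -ln_powR.
  have -> : x `^ a = 1 + (x `^ a - 1) by ring.
  apply: le_trans (le_ln1Dx _) _; first by lra.
  by lra.
have -> : x `^ eta = (x `^ a) ^+ k.+1.
  by rewrite -powR_mulrn ?powR_ge0// -powRrM /a divfK// gt_eqF.
rewrite -exprMn; apply: lerXn2r; rewrite ?nnegrE.
- by rewrite addr_ge0// ln_ge0.
- by rewrite mulr_ge0 ?powR_ge0// addr_ge0 ?invr_ge0 ?(ltW a0).
by rewrite mulrDl mul1r lerD.
Qed.

Lemma bernoulli_le (d : R) k : 0 <= d -> 1 + k%:R * d <= (1 + d) ^+ k.
Proof.
move=> d0; elim: k => [|k IH]; first by rewrite mul0r addr0 expr0.
rewrite exprS; apply: le_trans (ler_wpM2l _ IH); last by rewrite addr_ge0.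
have k0 : 0 <= k%:R * (d * d) by rewrite !mulr_ge0.
by rewrite -natr1; nra.
Qed.

(** By Bernoulli's inequality the inverse of x to the power k grows at least linearly
    in k. *)
Lemma linear_geometric_bounded (x : R) : 0 < x < 1 ->
  exists2 C : R, 0 < C & forall k : nat, (k%:R + 2) * x ^+ k <= C.
Proof.
move=> /andP[x0 x1]; pose d := x^-1 - 1.
have d0 : 0 < d by rewrite subr_gt0 invf_gt1.
exists (2 + d^-1); first by rewrite addr_gt0 ?invr_gt0.
move=> k; have := bernoulli_le k (ltW d0).
have -> : 1 + d = x^-1 by rewrite /d; ring.
rewrite exprVn.
have k0 : 0 <= k%:R :> R by [].
have kd0 : 0 <= k%:R * d by rewrite mulr_ge0 ?(ltW d0).
move=> h.
have xk0 : 0 < x ^+ k by rewrite exprn_gt0.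
have h' : (1 + k%:R * d) * x ^+ k <= 1.
  by rewrite -ler_pdivlMr// mul1r.
apply: (@le_trans _ _ ((2 + d^-1) * ((1 + k%:R * d) * x ^+ k))).
  rewrite mulrA ler_wpM2r ?(ltW xk0)//.
  have -> : (2 + d^-1) * (1 + k%:R * d) = k%:R + 2 + d^-1 + 2 * (k%:R * d).
    by field; rewrite gt_eqF.
  by have := invr_gt0 d; rewrite d0 => di; lra.
by rewrite ler_piMr// addr_ge0// invr_ge0 ltW.
Qed.

End elementary_inequalities.

(** * Sums over countable types and dyadic quasi-norms *)

Section integral_generalities.
Local Open Scope ereal_scope.
Local Open Scope classical_set_scope.

(** The integral of a nonnegative function is a supremum over the simple functions below
    it, so it is monotone even for functions not known to be measurable, such as
    suprema over all balls of a given radius. *)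
Lemma ge0_le_integral_nomeas d (T : measurableType d) (R : realType)
    (mu : {measure set T -> \bar R}) (D : set T) (f g : T -> \bar R) :
  (forall x, D x -> 0 <= f x) -> (forall x, D x -> f x <= g x) ->
  \int[mu]_(x in D) f x <= \int[mu]_(x in D) g x.
Proof.
move=> f0 fg; rewrite ge0_integralE// ge0_integralE; last first.
  by move=> x Dx; exact: le_trans (f0 x Dx) (fg x Dx).
apply: le_ereal_sup => _ [h hf <-]; exists h => // x.
apply: le_trans (hf x) _; rewrite !patchE; case: ifPn => //.
by rewrite inE => /fg.
Qed.

Lemma set_bij_range_inj (T T' : Type) (e : T -> T') :
  injective e -> set_bij setT (range e) e.
Proof.
by move=> ei; split; [move=> i _; exists i|move=> i j _ _ /ei|].
Qed.

(** Enumerating the index type by its codes gives access to monotone convergence for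
    series. *)
Lemma esum_countable (R : realType) (T : countType) (a : T -> \bar R) :
  (forall i, 0 <= a i) ->
  \esum_(i in [set: T]) a i = \sum_(k <oo) oapp a 0 (pickle_inv k).
Proof.
move=> a0; rewrite nneseries_esumT; last by move=> k; case: pickle_inv.
rewrite [RHS](_ : _ =
    \esum_(k in range (@choice.pickle T)) oapp a 0 (pickle_inv k)).
  rewrite (reindex_esum [set: T] (range choice.pickle) choice.pickle).
    by apply: eq_esum => i _; rewrite pickleK_inv.
  apply: (set_bij_range_inj (pcan_inj choice.pickleK)).
rewrite [RHS]esum_mkcond; apply: eq_esum => k _.
case: ifPn => //; rewrite notin_setE => nk.
case E : pickle_inv => [i|//]; exfalso; apply: nk; exists i => //.
by rewrite -[RHS](@pickle_invK T k) E.
Qed.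

Lemma ge0_integral_esum d (X : measurableType d) (R : realType)
    (mu : {measure set X -> \bar R}) (D : set X) (T : countType)
    (f : T -> X -> \bar R) : measurable D ->
  (forall i, measurable_fun D (f i)) -> (forall i x, 0 <= f i x) ->
  \int[mu]_(x in D) (\esum_(i in [set: T]) f i x) =
  \esum_(i in [set: T]) \int[mu]_(x in D) f i x.
Proof.
move=> mD mf f0.
under eq_integral do rewrite esum_countable//.
rewrite integral_nneseries//.
- rewrite esum_countable; last by move=> i; exact: integral_ge0.
  by apply: eq_eseriesr => k _; case: pickle_inv => //=; exact: integral0.
- by move=> k; case: pickle_inv => [i|]; [exact: mf|exact: measurable_cst].
- by move=> k x _; case: pickle_inv => /=.
Qed.

Lemma esum_ge1 (R : realType) (T : choiceType) (a : T -> \bar R) i :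
  (forall i, 0 <= a i) -> a i <= \esum_(i in [set: T]) a i.
Proof.
move=> a0; apply: esum_ge; exists [set i]; first by split.
by rewrite fsbig_set1.
Qed.

Lemma esumZl (R : realType) (T : choiceType) (a : T -> \bar R) (c : R) :
  (0 <= c)%R -> (forall i, 0 <= a i) ->
  \esum_(i in [set: T]) (c%:E * a i) = c%:E * \esum_(i in [set: T]) a i.
Proof.
rewrite le_eqVlt => /predU1P[<- a0|c0 a0].
  by rewrite mul0e esum1// => i _; rewrite mul0e.
rewrite /esum -(ereal_sup_pZl _ c0); congr ereal_sup; apply/seteqP; split.
- move=> _ [A fA <-]; exists (\sum_(i \in A) a i); first by exists A.
  by rewrite ge0_mule_fsumr.
- move=> _ [_ [A fA <-] <-]; exists A => //.
  by rewrite ge0_mule_fsumr.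
Qed.

Lemma esum_comp_inj (R : realType) (T T' : choiceType) (e : T -> T')
    (a : T' -> \bar R) : injective e -> (forall i, 0 <= a i) ->
  \esum_(i in [set: T]) a (e i) <= \esum_(j in [set: T']) a j.
Proof.
move=> ei a0; rewrite -(reindex_esum setT (range e) e).
  rewrite esum_mkcond; apply: le_esum => j _; case: ifPn => //.
exact: set_bij_range_inj.
Qed.

Lemma esum_single (R : realType) (T : choiceType) (a : T -> \bar R) i0 :
  (forall i, 0 <= a i) -> (forall i, i != i0 -> a i = 0) ->
  \esum_(i in [set: T]) a i = a i0.
Proof.
move=> a0 ai; rewrite -(esum_set1 (a0 i0)) esum_mkcond [RHS]esum_mkcond.
apply: eq_esum => i _; rewrite in_setT in_set1.
by case: eqVneq => [->|/ai].
Qed.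

Lemma esum_exchange (R : realType) (S T : choiceType) (a : S -> T -> \bar R) :
  (forall i j, 0 <= a i j) ->
  \esum_(i in [set: S]) \esum_(j in [set: T]) a i j =
  \esum_(j in [set: T]) \esum_(i in [set: S]) a i j.
Proof.
move=> a0; rewrite !esum_esum//.
rewrite [LHS](reindex_esum ([set: T] `*`` fun=> [set: S]) _
  (fun x => (x.2, x.1)))//.
by split=> // [[i j] [j' i'] _ _ /= [-> ->]//|[i j] _]; exists (j, i).
Qed.

Lemma nneseries_le_ub (R : realType) (a : nat -> \bar R) (M : \bar R) :
  (forall i, 0 <= a i) -> (forall n, \sum_(0 <= i < n) a i <= M) ->
  \sum_(i <oo) a i <= M.
Proof.
move=> a0 aM; apply: lime_le; first exact: is_cvg_nneseries.
by apply: nearW => n; exact: aM.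
Qed.

Lemma nneseries_geometric_lty (R : realType) (x : R) : (0 <= x < 1)%R ->
  \sum_(i <oo) (x ^+ i)%:E < +oo.
Proof.
move=> /andP[x0 x1]; apply: (@le_lt_trans _ _ ((1 - x)^-1)%:E); last exact: ltry.
apply: nneseries_le_ub => [i|n]; first by rewrite lee_fin exprn_ge0.
rewrite sumEFin lee_fin -[leRHS]mul1r ler_pdivlMr ?subr_gt0// mulrC.
rewrite big_mkord.
have := subrX1 x n => /(congr1 -%R); rewrite opprB -mulNr opprB => <-.
by rewrite lerBlDr lerDl exprn_ge0.
Qed.

Lemma esum_int (R : realType) (a : int -> \bar R) : (forall i, 0 <= a i) ->
  \esum_(i in [set: int]) a i =
  \esum_(n in [set: nat]) a (Posz n) + \esum_(n in [set: nat]) a (Negz n).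
Proof.
move=> a0; rewrite (esumID (range Posz))//; congr (_ + _).
  by rewrite setTI (reindex_esum setT _ Posz)//; apply: set_bij_range_inj => i j [].
rewrite (_ : _ `&` _ = range Negz).
  by rewrite (reindex_esum setT _ Negz)//; apply: set_bij_range_inj => i j [].
rewrite setTI; apply/seteqP; split=> [[n /= []|n _]|_ [n _ <-] []//].
  by exists n.
by exists n.
Qed.

Lemma esum_int_geometric_lty (R : realType) (x : R) : (0 <= x < 1)%R ->
  \esum_(j in [set: int]) (x ^+ `|j|%N)%:E < +oo.
Proof.
move=> x01; have /andP[x0 x1] := x01.
have e0 n : 0 <= (x ^+ n)%:E by rewrite lee_fin exprn_ge0.
rewrite esum_int// lte_add_pinfty// -nneseries_esumT//.
- exact: nneseries_geometric_lty.
- apply: le_lt_trans (nneseries_geometric_lty x01).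
  apply: lee_nneseries => [//|n _]; rewrite lee_fin /= exprS.
  by rewrite ler_piMl ?exprn_ge0// ltW.
Qed.

Lemma ge0_le_poweR (R : realType) (r : R) (x y : \bar R) :
  (0 <= r)%R -> 0 <= x -> x <= y -> x `^ r <= y `^ r.
Proof.
move=> r0 x0 xy; apply: gt0_ler_poweR; rewrite // in_itv/= leey andbT//.
exact: le_trans xy.
Qed.

End integral_generalities.

Section dyadic_norms.
Context {R : realType}.
Implicit Types (q : \bar R) (a b : int -> \bar R) (F : R -> \bar R).
Local Open Scope classical_set_scope.

Lemma dyadic_index (t : R) : 0 < t -> exists m : int, 2 ^ m <= t < 2 ^ (m + 1).
Proof.
move=> t0; exists (Num.floor (ln t / ln 2)).
have ln2 : 0 < ln 2 :> R by rewrite ln_gt0// ltr1n.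
have e2 m : (2 : R) ^ m = expR (m%:~R * ln 2).
  by rewrite -powR_intmul// /powR pnatr_eq0.
rewrite !e2 -[t in _ <= t]lnK// -[t in t < _]lnK//.
rewrite ler_expR ltr_expR -ler_pdivlMr// -ltr_pdivrMr//.
by rewrite floor_le_tmp floorD1_gt.
Qed.

Lemma dyadic_index_uniq (t : R) (m l : int) : 2 ^ m <= t < 2 ^ (m + 1) ->
  2 ^ l <= t < 2 ^ (l + 1) -> m = l.
Proof.
move=> /andP[a1 a2] /andP[b1 b2].
have := le_lt_trans a1 b2; have := le_lt_trans b1 a2.
rewrite !ltr_eXz2l ?ltr1n//; lia.
Qed.

Lemma lebesgue_dyadic (m : int) :
  lebesgue_measure (`[2 ^ m, 2 ^ (m + 1)[%classic : set R) = (2 ^ m)%:E.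
Proof.
rewrite lebesgue_measure_itv/= lte_fin ltr_eXz2l ?ltr1n//.
rewrite (_ : m < m + 1) ?ltrDl// -EFinB; congr EFin.
by rewrite expfzDr ?pnatr_eq0//; lra.
Qed.

(** Taking for c m an upper or a lower bound of 1/t on the m-th dyadic interval gives the two
    comparisons of L_q(dt/t) with l_q. *)
Lemma integral_dyadic_step a (c : int -> R) :
  (forall m, (0 <= a m)%E) -> (forall m, 0 <= c m) ->
  (\int[lebesgue_measure]_(t in `]0%R, +oo[)
     (\esum_(m in [set: int])
       (a m * (c m)%:E * (\1_(`[2 ^ m, 2 ^ (m + 1)[%classic) t : R)%:E)) =
   \esum_(m in [set: int]) (a m * (c m * 2 ^ m)%:E))%E.
Proof.
move=> a0 c0; rewrite ge0_integral_esum//.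
- apply: eq_esum => m _.
  rewrite ge0_integralZl//; last by rewrite mule_ge0// lee_fin.
    rewrite integral_indic// setIidl.
      by rewrite [X in (_ * X)%E]lebesgue_dyadic EFinM muleA.
    move=> t /=; rewrite !in_itv/= andbT => /andP[+ _].
    by apply: lt_le_trans; rewrite exprz_gt0.
  by apply/measurable_EFinP; exact: measurable_indic.
- move=> m; apply: emeasurable_funM => //.
  by apply/measurable_EFinP; exact: measurable_indic.
- by move=> m t; rewrite !mule_ge0 ?lee_fin.
Qed.

Lemma exponent_cases q : (0 < q)%E ->
  (exists2 r : R, 0 < r & q = r%:E) \/ q = +oo%E.
Proof.
by case: q => [r||]; rewrite ?lte_fin; [left; exists r|right|rewrite ltNge leNye].
Qed.

(** A dyadic interval has dt/t-mass ln 2, which is between 1/2 and 1. The upper bound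
    gives this comparison without a constant, the lower bound gives the next one. *)
Lemma Lq_dt_t_le_lqZ q F a : (0 < q)%E -> (forall t, 0 <= F t)%E ->
  (forall m, 0 <= a m)%E ->
  (forall m t, 2 ^ m <= t < 2 ^ (m + 1) -> (F t <= a m)%E) ->
  (Lq_dt_t q F <= lqZ q a)%E.
Proof.
move=> /exponent_cases[[r r0 ->]|->] F0 a0 Fa /=; last first.
  apply: ge_ereal_sup => _ [t /= t0 <-]; move: t0; rewrite in_itv/= andbT.
  move=> /dyadic_index[m mt]; apply: le_trans (Fa _ _ mt) _.
  by apply: ereal_sup_ubound; exists m.
apply: gt0_ler_poweR; rewrite ?invr_ge0 ?in_itv/= ?leey ?andbT.
- by rewrite ltW.
- by apply: integral_ge0 => t /=; rewrite in_itv/= andbT => t0;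
    rewrite mule_ge0 ?poweR_ge0// lee_fin invr_ge0 ltW.
- by apply: esum_ge0 => m _; rewrite poweR_ge0.
have := @integral_dyadic_step (fun m => a m `^ r)%E (fun m => (2 ^ m)^-1).
move=> /(_ (fun=> poweR_ge0 _ _)).
rewrite (_ : (\esum_(m in [set: int]) _)%E = (\esum_(m in [set: int]) (a m `^ r))%E); last first.
  by apply: eq_esum => m _; rewrite mulVf ?mule1// gt_eqF// exprz_gt0.
move=> <-; last by move=> m; rewrite invr_ge0 exprz_ge0.
apply: ge0_le_integral_nomeas => t /=; rewrite in_itv/= andbT => t0.
  by rewrite mule_ge0 ?poweR_ge0// lee_fin invr_ge0 ltW.
have [m mt] := dyadic_index t0.
apply: (@le_trans _ _ (a m `^ r * (2 ^ m)^-1%:E *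
   (\1_(`[2 ^ m, 2 ^ (m + 1)[%classic) t : R)%:E)%E).
  rewrite indicE mem_set//= mule1 lee_pmul ?poweR_ge0//.
  - by rewrite lee_fin invr_ge0 ltW.
  - by apply: ge0_le_poweR => //; [exact: ltW|exact: Fa].
  - rewrite lee_fin lef_pV2 ?posrE ?exprz_gt0//.
    by have /andP[] := mt.
apply: (@esum_ge1 _ _ (fun m => _ m `^ r * (2 ^ m)^-1%:E *
   (\1_(`[2 ^ m, 2 ^ (m + 1)[%classic) t : R)%:E)%E) => l.
by rewrite !mule_ge0 ?poweR_ge0// lee_fin// invr_ge0 exprz_ge0.
Qed.

Lemma lqZ_le_Lq_dt_t q : (0 < q)%E -> exists2 C : R, 0 < C &
  forall F a, (forall t, 0 <= F t)%E -> (forall m, 0 <= a m)%E ->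
  (forall m t, 2 ^ m <= t < 2 ^ (m + 1) -> (a m <= F t)%E) ->
  (lqZ q a <= C%:E * Lq_dt_t q F)%E.
Proof.
move=> /exponent_cases[[r r0 ->]|->]; last first.
  exists 1 => // F a F0 a0 aF; rewrite mul1e /=.
  apply: ge_ereal_sup => _ [m _ <-]; apply: le_trans (aF m (2 ^ m) _) _.
    by rewrite lexx/= ltr_eXz2l ?ltr1n// ltrDl.
  by apply: ereal_sup_ubound; exists (2 ^ m); rewrite //= in_itv/= exprz_gt0.
exists (2 `^ r^-1); first by rewrite powR_gt0.
move=> F a F0 a0 aF /=.
have I0 : (0 <= \int[lebesgue_measure]_(t in `]0%R, +oo[) (F t `^ r * (t^-1)%:E))%E.
  by apply: integral_ge0 => t /=; rewrite in_itv/= andbT => t0;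
    rewrite mule_ge0 ?poweR_ge0// lee_fin invr_ge0 ltW.
rewrite -poweR_EFin -poweRM//.
apply: ge0_le_poweR; first by rewrite invr_ge0 ltW.
  by apply: esum_ge0 => m _; rewrite poweR_ge0.
have := @integral_dyadic_step (fun m => a m `^ r)%E (fun m => (2 ^ (m + 1))^-1).
move=> /(_ (fun=> poweR_ge0 _ _)).
rewrite (_ : (\esum_(m in [set: int]) (_ * (_ * _)%:E))%E =
   ((2^-1)%:E * \esum_(m in [set: int]) (a m `^ r))%E); last first.
  rewrite -(@esumZl _ _ (fun m => a m `^ r)%E)//; last first.
    by move=> m; rewrite poweR_ge0.
  apply: eq_esum => m _; rewrite muleC; congr (_%:E * _)%E.
  by rewrite expfzDr ?pnatr_eq0// invfM mulrAC mulVf ?mul1r// gt_eqF// exprz_gt0.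
move=> H; rewrite -lee_pdivrMl// -H; last by move=> m; rewrite invr_ge0 exprz_ge0.
apply: ge0_le_integral_nomeas => t /=; rewrite in_itv/= andbT => t0.
  apply: esum_ge0 => m _.
  by rewrite !mule_ge0 ?poweR_ge0 ?lee_fin// invr_ge0 exprz_ge0.
have [m mt] := dyadic_index t0.
rewrite (@esum_single _ _ _ m).
- rewrite indicE mem_set//= mule1 lee_pmul ?poweR_ge0//.
  + by rewrite lee_fin invr_ge0 exprz_ge0.
  + by apply: ge0_le_poweR => //; [exact: ltW|exact: aF].
  + rewrite lee_fin lef_pV2 ?posrE ?exprz_gt0//.
    by have /andP[_ /ltW] := mt.
- by move=> l; rewrite !mule_ge0 ?poweR_ge0 ?lee_fin// invr_ge0 exprz_ge0.
- move=> l lm; rewrite indicE memNset ?mule0//= in_itv/= => tl.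
  by move: lm; rewrite (dyadic_index_uniq tl mt) eqxx.
Qed.

Lemma le_lqZ q a b : (0 < q)%E -> (forall m, 0 <= a m)%E ->
  (forall m, a m <= b m)%E -> (lqZ q a <= lqZ q b)%E.
Proof.
move=> /exponent_cases[[r r0 ->]|->] a0 ab /=; last first.
  apply: ge_ereal_sup => _ [m _ <-]; apply: le_trans (ab m) _.
  by apply: ereal_sup_ubound; exists m.
have b0 m : (0 <= b m)%E by exact: le_trans (a0 m) (ab m).
apply: gt0_ler_poweR; rewrite ?invr_ge0 ?in_itv/= ?leey ?andbT ?(ltW r0)//.
- by apply: esum_ge0 => m _; rewrite poweR_ge0.
- by apply: esum_ge0 => m _; rewrite poweR_ge0.
- apply: le_esum => m _; apply: gt0_ler_poweR => //.
  + exact: ltW.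
  + by rewrite in_itv/= leey a0.
  + by rewrite in_itv/= leey b0.
Qed.

Lemma lqZ_scale q a (c : R) : (0 < q)%E -> 0 < c -> (forall m, 0 <= a m)%E ->
  lqZ q (fun m => c%:E * a m)%E = (c%:E * lqZ q a)%E.
Proof.
move=> /exponent_cases[[r r0 ->]|->] c0 a0 /=; last first.
  rewrite -ereal_sup_pZl//; congr ereal_sup; apply/seteqP; split.
    by move=> _ [m _ <-]; exists (a m) => //; exists m.
  by move=> _ [_ [m _ <-] <-]; exists m.
under eq_esum do rewrite poweRM ?lee_fin ?(ltW c0)// poweR_EFin.
rewrite esumZl ?powR_ge0//; last by move=> m; rewrite poweR_ge0.
rewrite poweRM ?lee_fin ?powR_ge0//.
  by rewrite poweR_EFin -powRrM mulfV ?gt_eqF// powRr1// ltW.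
by apply: esum_ge0 => m _; rewrite poweR_ge0.
Qed.

Lemma lqZ_comp_inj q a (e : int -> int) : (0 < q)%E -> injective e ->
  (forall m, 0 <= a m)%E -> (lqZ q (a \o e) <= lqZ q a)%E.
Proof.
move=> /exponent_cases[[r r0 ->]|->] ei a0 /=; last first.
  by apply: le_ereal_sup => _ [m _ <-]; exists (e m).
apply: gt0_ler_poweR; rewrite ?invr_ge0 ?in_itv/= ?leey ?andbT ?(ltW r0)//.
- by apply: esum_ge0 => m _; rewrite poweR_ge0.
- by apply: esum_ge0 => m _; rewrite poweR_ge0.
- by apply: (esum_comp_inj (a := fun m => a m `^ r)%E ei) => m; rewrite poweR_ge0.
Qed.

Lemma lqZ_ge q a m : (0 < q)%E -> (forall m, 0 <= a m)%E -> (a m <= lqZ q a)%E.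
Proof.
move=> /exponent_cases[[r r0 ->]|->] a0 /=; last first.
  by apply: ereal_sup_ubound; exists m.
rewrite -[leLHS]poweRe1// -(mulfV (lt0r_neq0 r0)) poweRrM.
apply: gt0_ler_poweR; rewrite ?invr_ge0 ?in_itv/= ?leey ?andbT ?(ltW r0) ?poweR_ge0//.
- by apply: esum_ge0 => k _; rewrite poweR_ge0.
- by apply: (@esum_ge1 _ _ (fun k => a k `^ r)%E) => k; rewrite poweR_ge0.
Qed.

(** The q-th power of a supremum is at most the sum of the q-th powers, after which the
    sums over j and m are exchanged; unlike the triangle inequality, this works for
    every q > 0. *)
Lemma lqZ_sup_translates q (x : R) : (0 < q)%E -> 0 < x < 1 ->
  exists2 C : R, 0 < C & forall a, (forall m, 0 <= a m)%E ->
  (lqZ q (fun m => ereal_sup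
     (range (fun j : int => (x ^+ `|j|%N)%:E * a (m + j)%R))) <= C%:E * lqZ q a)%E.
Proof.
move=> /exponent_cases[[r r0 ->]|->] /andP[x0 x1]; last first.
  exists 1 => // a a0; rewrite mul1e /=.
  apply: ge_ereal_sup => _ [m _ <-]; apply: ge_ereal_sup => _ [j _ <-].
  apply: (@le_trans _ _ (a (m + j)%R)); last by apply: ereal_sup_ubound; exists (m + j).
  by rewrite gee_pMl// lee_fin exprn_ile1// ltW.
have xr1 : x `^ r < 1.
  by have := @gt0_ltr_powR _ r r0 x 1; rewrite powR1; apply; rewrite ?nnegrE ?ltW.
have S := @esum_int_geometric_lty R (x `^ r).
have {S}/S Soo : 0 <= x `^ r < 1 by rewrite powR_ge0.
set S : \bar R := (\esum_(j in _) _)%E in Soo.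
have S1 : (1 <= S)%E.
  apply: le_trans (@esum_ge1 _ _ (fun j : int => (x `^ r ^+ `|j|%N)%:E) 0 _).
    by rewrite expr0.
  by move=> j; rewrite lee_fin exprn_ge0// powR_ge0.
have [s sE] : exists s, S = s%:E.
  by case: (S) Soo S1 => // s _ _; exists s.
have s1 : 1 <= s by rewrite -lee_fin -sE.
exists (s `^ r^-1); first by rewrite powR_gt0// (lt_le_trans ltr01).
move=> a a0.
pose b m := ereal_sup (range (fun j : int => (x ^+ `|j|%N)%:E * a (m + j)%R)%E).
change (lqZ r%:E b <= (s `^ r^-1)%:E * lqZ r%:E a)%E; rewrite /lqZ.
have b0 m : (0 <= b m)%E.
  apply: (le_trans (a0 m)); apply: ereal_sup_ubound.
  by exists 0 => //; rewrite addr0 expr0 mul1e.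
have T0 m j : (0 <= ((x `^ r) ^+ `|j : int|%N)%:E * a (m + j)%R `^ r)%E.
  by rewrite mule_ge0 ?poweR_ge0// lee_fin exprn_ge0 ?powR_ge0.
rewrite -poweR_EFin -poweRM//; last 2 first.
- by rewrite lee_fin (le_trans _ s1).
- by apply: esum_ge0 => m _; rewrite poweR_ge0.
apply: gt0_ler_poweR; rewrite ?invr_ge0 ?in_itv/= ?leey ?andbT ?(ltW r0)//.
- by apply: esum_ge0 => k _; rewrite poweR_ge0.
- rewrite mule_ge0 ?lee_fin ?(le_trans _ s1)//.
  by apply: esum_ge0 => k _; rewrite poweR_ge0.
apply: (@le_trans _ _ (\esum_(m in [set: int]) \esum_(j in [set: int])
    (((x `^ r) ^+ `|j|%N)%:E * a (m + j)%R `^ r)))%E.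
  apply: le_esum => m _.
  set e : \bar R := (\esum_(j in _) _)%E.
  have e0 : (0 <= e)%E by exact: esum_ge0.
  suff : (b m <= e `^ r^-1)%E.
    move=> /(@gt0_ler_poweR _ r (ltW r0)).
    rewrite !in_itv/= !leey !andbT => /(_ (b0 m) (poweR_ge0 _ _)).
    by rewrite -poweRrM mulVf ?gt_eqF// poweRe1.
  apply: ge_ereal_sup => _ [j _ <-].
  rewrite -[leLHS]poweRe1 ?mule_ge0 ?lee_fin ?exprn_ge0 ?(ltW x0)//.
  rewrite -(mulfV (lt0r_neq0 r0)) poweRrM.
  apply: gt0_ler_poweR; rewrite ?invr_ge0 ?in_itv/= ?leey ?andbT ?(ltW r0) ?poweR_ge0//.
  rewrite poweRM ?lee_fin ?exprn_ge0 ?(ltW x0)// poweR_EFin.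
  rewrite -powR_mulrn ?(ltW x0)// powRAC powR_mulrn ?powR_ge0//.
  exact: (@esum_ge1 _ _ (fun j : int => ((x `^ r) ^+ `|j|%N)%:E * a (m + j)%R `^ r)%E).
rewrite esum_exchange// -sE.
under eq_esum.
  move=> j _; rewrite esumZl ?exprn_ge0 ?powR_ge0//; last first.
    by move=> m; rewrite poweR_ge0.
  over.
pose A := (\esum_(m in [set: int]) a m `^ r)%E.
have shift j : (\esum_(m in [set: int]) a (m + j)%R `^ r = A)%E.
  apply/esym/(@reindex_esum _ _ _ setT setT (fun m => m + j)%R); split => //.
    by move=> m k _ _ /addIr.
  by move=> m _; exists (m - j)%R => //; rewrite subrK.
under eq_esum do rewrite shift muleC.
rewrite -/A; have A0 : (0 <= A)%E by apply: esum_ge0 => m _; rewrite poweR_ge0.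
case: A A0 {shift} => [A||//] A0; last first.
  by rewrite gt0_muley ?leey// sE lte_fin (lt_le_trans ltr01).
rewrite esumZl//; first by rewrite muleC.
by move=> j; rewrite lee_fin exprn_ge0 ?powR_ge0.
Qed.

Lemma lqZ_geometric_lty q (x C : R) (a : int -> \bar R) :
  (0 < q)%E -> 0 < x < 1 -> 0 < C ->
  (forall m, 0 <= a m <= (C * x ^+ `|m|%N)%:E)%E -> (lqZ q a < +oo)%E.
Proof.
move=> q0 /andP[x0 x1] C0 Ha.
have a0 m : (0 <= a m)%E by have /andP[] := Ha m.
have aC m : (a m <= (C * x ^+ `|m|%N)%:E)%E by have /andP[] := Ha m.
have sup_le : (ereal_sup (range a) <= C%:E)%E.
  apply: ge_ereal_sup => _ [m _ <-]; apply: le_trans (aC m) _.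
  by rewrite lee_fin ler_piMr ?(ltW C0)// exprn_ile1// ltW.
case: q q0 => [q| |] //= q0; last by apply: le_lt_trans sup_le _; rewrite ltry.
rewrite lte_fin in q0; apply: poweR_lty.
apply: (@le_lt_trans _ _ (\esum_(m in [set: int]) ((C `^ q)%:E * ((x `^ q) ^+ `|m|%N)%:E))%E).
  apply: le_esum => m _; rewrite -EFinM -powRXn ?(ltW x0)// -powRM ?exprn_ge0 ?(ltW C0) ?(ltW x0)// -poweR_EFin.
  by apply: ge0_le_poweR => //; exact: ltW.
rewrite esumZl; last by move=> m; rewrite lee_fin exprn_ge0// powR_ge0.
  rewrite lte_mul_pinfty ?lee_fin ?powR_ge0//.
  apply: esum_int_geometric_lty; rewrite powR_ge0/=.
  by apply: powR_lt1 => //; exact: ltW.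
exact: powR_ge0.
Qed.

End dyadic_norms.

(** * Dyadic cubes *)

Section dyadic_cubes.
Context {R : realType} {n : nat}.
Local Open Scope classical_set_scope.
Local Notation mu := (lebesgue_Rn R n).
Implicit Types (m : int) (k : n.-tuple int) (e : {fset n.-tuple int}).

Definition cube_index m (x : n.-tuple R) : n.-tuple int :=
  [tuple Num.floor (tnth x i / 2 ^ m) | i < n].

(** The cubes of a given scale are the fibers of [cube_index], hence partition the space. *)
Lemma dcubeP m k (x : n.-tuple R) : dcube m k x <-> cube_index m x = k.
Proof.
have m0 : 0 < (2 : R) ^ m by rewrite exprz_gt0.
have E i : (0 <= tnth x i - 2 ^ m * (tnth k i)%:~R < 2 ^ m) =
    (Num.floor (tnth x i / 2 ^ m) == tnth k i).
  rewrite subr_ge0 ltrBlDl -[X in _ < _ + X]mulr1 -mulrDr mulrC.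
  rewrite -ler_pdivlMr// [X in _ < X]mulrC -ltr_pdivrMr//.
  by rewrite -[X in _ < _ + X]/(1%:~R) -intrD -floor_eq ?num_real.
split=> [xk|kE i]; last by move: (E i); rewrite -kE tnth_mktuple eqxx => ->.
by apply: eq_from_tnth => i; rewrite tnth_mktuple; apply/eqP; rewrite -E.
Qed.

Lemma lebesgue_dcube m k :
  measurable (dcube m k : set (n.-tuple R)) /\
  mu (dcube m k) = (((2 : R) ^ m) ^+ n)%:E.
Proof.
pose a : n.-tuple R := [tuple 2 ^ m * (tnth k i)%:~R | i < n].
pose b : n.-tuple R := [tuple 2 ^ m * (tnth k i)%:~R + 2 ^ m | i < n].
have ab i : tnth a i <= tnth b i by rewrite !tnth_mktuple lerDl exprz_ge0.
have [] := lebesgue_Rn_box ab; set box := [set x | _].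
have -> : box = dcube m k.
  by apply/seteqP; split=> x /= H i; have := H i;
    rewrite !tnth_mktuple subr_ge0 ltrBlDl.
move=> mbox ->; split => //; congr EFin.
under eq_bigr do rewrite !tnth_mktuple addrAC subrr add0r.
by rewrite prodr_const card_ord.
Qed.

Lemma measurable_dcube m k : measurable (dcube m k : set (n.-tuple R)).
Proof. by have [] := lebesgue_dcube m k. Qed.

Lemma trivIset_dcube m (D : set (n.-tuple int)) :
  trivIset D (@dcube R n m).
Proof. by move=> k l _ _ [x [/dcubeP <- /dcubeP <-]]. Qed.

Lemma dcubes_bigsetU m e : @dcubes R n m e = \big[setU/set0]_(k <- e) dcube m k.
Proof. by rewrite /dcubes bigcup_fset. Qed.

Lemma dcubesP m e (x : n.-tuple R) : dcubes m e x <-> cube_index m x \in e.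
Proof.
split=> [[k ke /dcubeP->]//|xe]; exists (cube_index m x) => //.
exact/dcubeP.
Qed.

Lemma measurable_dcubes m e : measurable (dcubes m e : set (n.-tuple R)).
Proof.
by rewrite dcubes_bigsetU; apply: bigsetU_measurable => k _; exact: measurable_dcube.
Qed.

Lemma ge0_integral_dcubes m e (f : n.-tuple R -> \bar R) :
  measurable_fun (dcubes m e) f -> (forall x, 0 <= f x)%E ->
  (\int[mu]_(x in dcubes m e) f x =
   \sum_(k <- e) \int[mu]_(x in dcube m k) f x)%E.
Proof.
move=> mf f0; rewrite dcubes_bigsetU ge0_integral_bigsetU//.
- by move=> k; exact: measurable_dcube.
- exact: trivIset_dcube.
- by rewrite -dcubes_bigsetU.
Qed.

Lemma lebesgue_dcubes m e :
  mu (dcubes m e) = (#|` e|%:R * ((2 : R) ^ m) ^+ n)%:E.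
Proof.
rewrite -[LHS]mul1e -integral_cst; last exact: measurable_dcubes.
rewrite ge0_integral_dcubes//.
rewrite (eq_bigr (fun=> (((2 : R) ^ m) ^+ n)%:E)); last first.
  move=> k _; rewrite integral_cst; last exact: measurable_dcube.
  by rewrite mul1e; exact: (lebesgue_dcube m k).2.
rewrite sumEFin; congr EFin.
by rewrite big_const_seq count_predT iter_addr_0 mulr_natl.
Qed.

End dyadic_cubes.

(** * The triangle function on the line and its Fourier transform *)

Section triangle_weight.
Local Open Scope classical_set_scope.
Context {R : realType}.
Implicit Types (rho c t th y : R).
Local Notation leb := (@lebesgue_measure R).

Definition triangle rho c y : R := Num.max 0 (1 - `|y - c| / rho).

(** The transform of the even triangle function of half-width rho: the Fejer kernel, with
    its limit at t = 0. *)
Definition triangle_hat rho t : R :=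
  if t == 0 then rho else 2 * (1 - cos (t * rho)) / (rho * t ^+ 2).

Lemma triangle_ge0 rho c y : 0 <= triangle rho c y.
Proof. by rewrite le_max lexx. Qed.

Lemma continuous_of_is_derive (F f : R -> R) :
  (forall y, is_derive y 1 F (f y)) -> continuous F.
Proof.
move=> dF y; apply: differentiable_continuous.
by apply/derivable1_diffP; have [] := dF y.
Qed.

Lemma integral_of_is_derive (F f f' : R -> R) (a b : R) : a < b ->
  (forall y, is_derive y 1 F (f y)) -> (forall y, is_derive y 1 f (f' y)) ->
  (\int[leb]_(y in `[a, b]) (f y)%:E = (F b - F a)%:E)%E.
Proof.
move=> ab dF df; rewrite (@continuous_FTC2 _ f F).
- by rewrite EFinB.
- by [].
- exact/continuous_subspaceT/(continuous_of_is_derive df).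
- have cF := continuous_of_is_derive dF.
  split; first by move=> y _; have [] := dF y.
  + exact: cvg_at_right_filter (cF a).
  + exact: cvg_at_left_filter (cF b).
- by move=> y _; rewrite derive1E; have [] := dF y.
Qed.

Lemma is_derive_affine th t y : is_derive y 1 (fun y => th + t * y) t.
Proof.
have -> : (fun y : R => th + t * y) = cst th + t \*: id by [].
apply: is_derive_eq; rewrite add0r; exact: mulr1.
Qed.

Lemma is_derive_sin_affine th t y :
  is_derive y 1 (fun y => sin (th + t * y)) (t * cos (th + t * y)).
Proof.
have := @is_derive1_comp _ sin (fun y => th + t * y) y.
move=> /(_ _ _ (is_derive_sin _) (is_derive_affine th t y)).
by rewrite mulrC.
Qed.

Lemma is_derive_cos_affine th t y :
  is_derive y 1 (fun y => cos (th + t * y)) (- t * sin (th + t * y)).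
Proof.
have := @is_derive1_comp _ cos (fun y => th + t * y) y.
move=> /(_ _ _ (is_derive_cos _) (is_derive_affine th t y)).
by rewrite mulrC mulrN mulNr.
Qed.

(** The case t = 0 is separate because the integration by parts divides by t. *)
Definition affine_cos_primitive al be th t y : R :=
  if t == 0 then cos th * (al * y + be / 2 * y ^+ 2)
  else (al + be * y) * (sin (th + t * y) / t) + be * cos (th + t * y) / t ^+ 2.

Lemma integral_affine_cos al be th t a b : a < b ->
  (\int[leb]_(y in `[a, b]) ((al + be * y) * cos (th + t * y))%:E =
   (affine_cos_primitive al be th t b - affine_cos_primitive al be th t a)%:E)%E.
Proof.
move=> ab; apply: (@integral_of_is_derive _ _ (fun y =>
   (al + be * y) * (- t * sin (th + t * y)) + cos (th + t * y) * be)) => //; last first.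
  move=> y; exact: (is_deriveM (is_derive_affine al be y) (is_derive_cos_affine th t y)).
move=> y; rewrite /affine_cos_primitive; case: eqVneq => [->|t0].
  rewrite mul0r addr0.
  have -> : (fun y => cos th * (al * y + be / 2 * y ^+ 2)) =
    cos th \*: ((al \*: id) + (be / 2) \*: (id ^+ 2 : R -> R)) by [].
  by apply: is_derive_eq; rewrite /= /GRing.scale /=; field.
have -> : (fun y => (al + be * y) * (sin (th + t * y) / t) + be * cos (th + t * y) / t ^+ 2) =
  (fun y => (al + be * y)) * (t^-1 \*: (fun y => sin (th + t * y)))
   + (be / t ^+ 2) \*: (fun y => cos (th + t * y)).
  by apply/funext => z; rewrite /GRing.scale /= !fctE /= /GRing.scale /=; field.
have d1 := is_derive_affine al be y.
have d2 := is_derive_cos_affine th t y.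
have d3 := is_derive_sin_affine th t y.
apply: is_derive_eq; rewrite /= /GRing.scale /=; field.
exact: t0.
Qed.

Lemma measurable_cos_affine th t : measurable_fun setT (fun y => cos (th + t * y)).
Proof.
apply: continuous_measurable_fun.
exact: (continuous_of_is_derive (is_derive_cos_affine th t)).
Qed.

(** The triangle is affine on each half of its support, which reduces its integrals to
    [integral_affine_cos]. *)
Lemma triangle_halves rho c y : 0 < rho ->
  triangle rho c y = if c - rho <= y <= c then 1 - c / rho + rho^-1 * y
    else if c <= y <= c + rho then 1 + c / rho + - rho^-1 * y else 0.
Proof.
move=> rho0; have rhoN0 : rho != 0 by rewrite gt_eqF.
rewrite /triangle.
have E z : 1 - z / rho = (rho - z) / rho by rewrite mulrBl mulfV.
have Emax z : Num.max 0 (1 - z / rho) = if z <= rho then 1 - z / rho else 0.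
  rewrite E; case: ifPn => [zr|]; last rewrite -ltNge => zr.
    by rewrite max_r// divr_ge0 ?subr_ge0// ltW.
  by rewrite max_l// mulr_le0_ge0// ?subr_le0 ?invr_ge0 ltW.
rewrite Emax; case: (lerP y c) => yc.
  have -> : (c - y <= rho) = (c - rho <= y) by apply/idP/idP; lra.
  rewrite andbT.
  case: ifPn => // [yr|yr]; first by field.
  case: ifPn => // /andP[cy _]; exfalso; move: yr; apply/negP; rewrite negbK.
  have -> : y = c by apply/eqP; rewrite eq_le yc cy.
  by rewrite lerBlDr lerDl ltW.
have -> : (y - c <= rho) = (y <= c + rho) by apply/idP/idP; lra.
rewrite andbF (ltW yc)/=.
by case: ifPn => // _; field.
Qed.

Lemma measurable_triangle rho c : measurable_fun setT (triangle rho c).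
Proof.
apply: measurable_maxr => //; apply: measurable_funB => //.
apply: measurable_funM => //; apply: measurableT_comp => //.
exact: measurable_funB.
Qed.

Lemma integral_triangle_split rho c (h : R -> R) : 0 < rho ->
  measurable_fun setT h ->
  (\int[leb]_y (triangle rho c y * h y)%:E =
   \int[leb]_(y in `[(c - rho)%R, c]) ((1 - c / rho + rho^-1 * y) * h y)%:E +
   \int[leb]_(y in `[c, (c + rho)%R]) ((1 + c / rho + - rho^-1 * y) * h y)%:E)%E.
Proof.
move=> rho0 mh.
have mt : measurable_fun setT (fun y => (triangle rho c y * h y)%:E).
  by apply/measurable_EFinP; apply: measurable_funM => //; exact: measurable_triangle.
have E : [set: R] = (`[c - rho, c]%classic `|` `]c, c + rho] `|`
    ~` (`[c - rho, c] `|` `]c, c + rho])) by rewrite setUv.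
rewrite [in LHS]E integral_setU//; last 4 first.
- exact: measurableU.
- by apply: measurableC; exact: measurableU.
- by rewrite -E.
- by apply/disj_setPCl.
rewrite [X in (_ + X)%E]integral0_eq ?adde0; last first.
  move=> y /= /not_orP[]; rewrite !in_itv/= => /negP y1 /negP y2.
  rewrite triangle_halves//.
  rewrite (negbTE y1); case: ifPn; rewrite ?mul0r// => /andP[y3 y4].
  move: y2; rewrite y4 andbT -leNgt => y5; move: y1.
  have -> : y = c by apply/eqP; rewrite eq_le y5 y3.
  by rewrite lexx lerBlDr lerDl ltW.
rewrite integral_setU//; last 2 first.
- by apply: measurable_funTS.
- apply/eqP/seteqP; split => // y /=; rewrite !in_itv/= => -[/andP[_ y1] /andP[]].
  by rewrite ltNge y1.
congr (_ + _)%E.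
  apply: eq_integral => y; rewrite inE/= in_itv/= => yc.
  by rewrite triangle_halves// yc.
rewrite integral_itv_obnd_cbnd; last first.
  by apply: measurable_funTS.
apply: eq_integral => y; rewrite inE/= in_itv/= => yc.
rewrite triangle_halves// yc; case: ifPn => // yc'.
have -> : y = c.
  apply/eqP; move: yc yc' => /andP[y1 _] /andP[_ y2].
  by rewrite eq_le y1 y2.
by congr (_ * _)%:E; field; rewrite gt_eqF.
Qed.

Lemma cos_addrN (x y : R) : cos (x + y) + cos (x - y) = 2 * cos x * cos y.
Proof. by rewrite cosD cosB; ring. Qed.

(** The triangle is even about c, so its transform there is real and only the phase at the
    center survives. *)
Lemma integral_triangle_cos rho c th t : 0 < rho ->
  (\int[leb]_y (triangle rho c y * cos (th + t * y))%:E =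
   (cos (th + t * c) * triangle_hat rho t)%:E)%E.
Proof.
move=> rho0; have rhoN0 : rho != 0 by rewrite gt_eqF.
rewrite integral_triangle_split//; last exact: measurable_cos_affine.
rewrite !integral_affine_cos ?ltrDl// ?gtrBl// -EFinD; congr EFin.
rewrite /affine_cos_primitive /triangle_hat; case: eqVneq => [->|t0].
  rewrite mul0r addr0; field; exact: rhoN0.
have := cos_addrN (th + t * c) (t * rho).
have -> : th + t * (c - rho) = th + t * c - t * rho by ring.
have -> : th + t * (c + rho) = th + t * c + t * rho by ring.
set C1 := cos (_ - _); set C2 := cos (_ + t * rho).
move=> /(canRL (addrK _)) ->.
by field; rewrite t0 rhoN0.
Qed.

Lemma integral_triangle rho c : 0 < rho ->
  (\int[leb]_y (triangle rho c y)%:E = rho%:E)%E.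
Proof.
move=> rho0; have := @integral_triangle_cos rho c 0 0 rho0.
rewrite mul0r addr0 cos0 mul1r /triangle_hat eqxx => <-.
by apply: eq_integral => y _; rewrite mul0r addr0 cos0 mulr1.
Qed.

Lemma triangle_hat_ge0 rho t : 0 < rho -> 0 <= triangle_hat rho t.
Proof.
move=> rho0; rewrite /triangle_hat; case: ifPn => _; first exact: ltW.
apply: divr_ge0; first by rewrite mulr_ge0// subr_ge0 cos_le1.
by rewrite mulr_ge0 ?sqr_ge0// ltW.
Qed.

Lemma triangle_hat_le rho t : 0 < rho -> triangle_hat rho t <= rho.
Proof.
move=> rho0; have := @integral_triangle_cos rho 0 0 t rho0.
rewrite mulr0 addr0 cos0 mul1r -lee_fin => <-.
rewrite -[leRHS](integral_triangle 0 rho0).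
have mh : measurable_fun setT (fun y => (triangle rho 0 y * cos (0 + t * y))%:E).
  apply/measurable_EFinP; apply: measurable_funM; first exact: measurable_triangle.
  exact: measurable_cos_affine.
apply: le_trans (lee_abs _) _; apply: le_trans (le_abse_integral _ _ _) _ => //.
apply: ge0_le_integral_nomeas => y _ //=.
rewrite lee_fin normrM ger0_norm ?triangle_ge0// ler_piMr ?triangle_ge0//.
by rewrite ler_norml cos_geN1 cos_le1.
Qed.

Lemma triangle_hat_le_decay rho t : 0 < rho -> t != 0 ->
  triangle_hat rho t <= 4 / (rho * t ^+ 2).
Proof.
move=> rho0 t0; rewrite /triangle_hat (negbTE t0) ler_pM2r; last first.
  by rewrite invr_gt0 mulr_gt0// exprn_even_gt0.
have := cos_geN1 (t * rho); lra.
Qed.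

(** The constant 9 makes kappa at least 1 on indices of modulus at most 2, where the decay
    of the transform is not used. *)
Definition kappa (d : int) : R := 9 / (1 + `|d|%:R) ^+ 2.

Lemma kappa_ge0 d : 0 <= kappa d.
Proof. by rewrite divr_ge0// sqr_ge0. Qed.

(** Points of the cells k and l are at distance at least h (|k - l| - 1). When |k - l| is at
    least 2 the quadratic decay of the transform applies; otherwise the trivial bound rho
    is enough. *)
Lemma triangle_hat_le_kappa (h u v : R) (k l : int) : 0 < h ->
  0 <= u - h * k%:~R < h -> 0 <= v - h * l%:~R < h ->
  triangle_hat (2 / h) (2 * pi * (u - v)) <= 2 / h * kappa (k - l).
Proof.
move=> h0 /andP[u1 u2] /andP[v1 v2].
have rho0 : 0 < 2 / h by rewrite divr_gt0.
rewrite /kappa; set d := (`|k - l|%N)%:R : R.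
have [d2|d2] := lerP 2 d; last first.
  apply: le_trans (triangle_hat_le _ rho0) _.
  rewrite ler_peMr ?(ltW rho0)// ler_pdivlMr ?mul1r; last first.
    by rewrite exprn_gt0// ltr_wpDr.
  have d0 : 0 <= d by rewrite ler0n.
  have : d < 2 by [].
  nra.
have dE : d = `|k%:~R - l%:~R|.
  by rewrite /d -intrB -intr_norm natr_absz.
set D : R := k%:~R - l%:~R in dE.
have uvE : `|u - v| >= h * (d - 1).
  have -> : u - v = h * D + ((u - h * k%:~R) - (v - h * l%:~R)) by rewrite /D; ring.
  have H1 : `|(u - h * k%:~R) - (v - h * l%:~R)| <= h.
    by rewrite ler_norml; apply/andP; split; lra.
  have := lerB_normD (h * D) ((u - h * k%:~R) - (v - h * l%:~R)).
  rewrite normrM (gtr0_norm h0) -dE; lra.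
have uv0 : 0 < `|u - v|.
  by apply: lt_le_trans uvE; rewrite mulr_gt0// subr_gt0; lra.
have pi2 := @pi_ge2 R.
have t0 : 2 * pi * (u - v) != 0.
  rewrite -normr_gt0 normrM mulr_gt0// normr_gt0; apply: lt0r_neq0; lra.
apply: le_trans (triangle_hat_le_decay rho0 t0) _.
rewrite -[(_ * (u - v)) ^+ 2]real_normK ?num_real//.
rewrite normrM (@ger0_norm _ (2 * pi)); last lra.
apply: (@le_trans _ _ (4 / (2 / h * (2 * (h * (d - 1))) ^+ 2))).
  rewrite ler_pM2l// lef_pV2 ?posrE; last 2 first.
  - by rewrite mulr_gt0// exprn_gt0// mulr_gt0//; lra.
  - by rewrite mulr_gt0// exprn_gt0// mulr_gt0// mulr_gt0//; lra.
  have hd : 0 <= h * (d - 1) by rewrite mulr_ge0//; lra.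
  rewrite ler_pM2l//; apply: lerXn2r; rewrite ?nnegrE.
  - by rewrite mulr_ge0.
  - by rewrite mulr_ge0//; lra.
  - by apply: ler_pM => //; lra.
have -> : 4 / (2 / h * (2 * (h * (d - 1))) ^+ 2) = 2 / h * (4^-1 / (d - 1) ^+ 2).
  by field; apply/andP; split; apply: lt0r_neq0; lra.
rewrite ler_pM2l// ler_pdivrMr ?exprn_gt0//; last lra.
rewrite mulrAC ler_pdivlMr ?exprn_gt0//; last lra.
nra.
Qed.

End triangle_weight.

(** * Swapping integrals against a bounded kernel *)

Section fubini_swap.
Context d1 d2 (X : measurableType d1) (Y : measurableType d2) (R : realType).
Variables (m1 : {sigma_finite_measure set X -> \bar R})
          (m2 : {sigma_finite_measure set Y -> \bar R}).
Local Open Scope classical_set_scope.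

Lemma integrable_mul_bounded d (Z : measurableType d) (m : {measure set Z -> \bar R})
    (A b : Z -> R) (M : R) : m.-integrable setT (EFin \o A) ->
  measurable_fun setT b -> (forall z, `|b z| <= M) ->
  m.-integrable setT (fun z => (A z * b z)%:E).
Proof.
move=> iA mb bM.
have mA : measurable_fun setT A by apply/measurable_EFinP; exact: measurable_int iA.
apply: (@le_integrable _ _ _ _ _ measurableT _ (fun z => M%:E * (A z)%:E)%E).
- by apply/measurable_EFinP; exact: measurable_funM.
- move=> z _; rewrite lee_fin normrM mulrC normrM ler_wpM2r//.
  by rewrite (le_trans (bM z))// ler_norm.
- exact: integrableZl.
Qed.

Variables (A : X -> R) (B : Y -> R) (b : X * Y -> R) (M : R).
Hypotheses (iA : m1.-integrable setT (EFin \o A))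
  (iB : m2.-integrable setT (EFin \o B))
  (mb : measurable_fun setT b) (bM : forall z, `|b z| <= M).

Let mA : measurable_fun setT A.
Proof. by apply/measurable_EFinP; exact: measurable_int iA. Qed.

Let mB : measurable_fun setT B.
Proof. by apply/measurable_EFinP; exact: measurable_int iB. Qed.

Lemma integrable_prod_kernel :
  (m1 \x m2)%E.-integrable setT (fun z => (A z.1 * (B z.2 * b z))%:E).
Proof.
apply/integrable12ltyP.
  apply/measurable_EFinP; apply: measurable_funM; first exact: measurableT_comp.
  by apply: measurable_funM => //; exact: measurableT_comp.
have /integrableP[_ ioo] := iA; have /integrableP[_ joo] := iB.
set J := (\int[m2]_y _)%E in joo.
have J0 : (0 <= J)%E by exact: integral_ge0.
apply: (@le_lt_trans _ _ (\int[m1]_x (`|(A x)%:E| * (`|M|%:E * J))))%E.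
  apply: ge0_le_integral_nomeas => x _; first exact: integral_ge0.
  rewrite -ge0_integralZl//; last exact/measurable_EFinP/measurableT_comp.
  rewrite -ge0_integralZl//; last first.
    by apply: emeasurable_funM => //; apply/measurable_EFinP; exact: measurableT_comp.
  apply: ge0_le_integral_nomeas => y _ //=.
  rewrite lee_fin !normrM ler_wpM2l// mulrC ler_wpM2r//.
  by rewrite (le_trans (bM _))// ler_norm.
rewrite ge0_integralZr//; last 2 first.
- exact/measurable_EFinP/measurableT_comp.
- by rewrite mule_ge0.
by rewrite lte_mul_pinfty//; [exact: integral_ge0|rewrite ge0_fin_numE// integral_ge0|
  rewrite lte_mul_pinfty].
Qed.

Lemma measurable_kernel_integral :
  measurable_fun setT (fun x => \int[m2]_y (B y * b (x, y))).
Proof.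
have mf : measurable_fun setT (fun z : X * Y => (B z.2 * b z)%:E).
  apply/measurable_EFinP; apply: measurable_funM => //.
  exact: measurableT_comp.
rewrite /Rintegral; apply: measurableT_comp => //.
under eq_fun do rewrite integralE.
pose g z := (B z.2 * b z)%:E.
have mgp : measurable_fun setT g^\+%E by exact: measurable_funepos.
have mgn : measurable_fun setT g^\-%E by exact: measurable_funeneg.
apply: emeasurable_funB.
  rewrite (_ : (fun x => _) = fubini_F m2 g^\+%E).
    exact: (measurable_fun_fubini_tonelli_F (m2 := m2) g^\+%E mgp (funepos_ge0 g)).
  by apply/funext => x; apply: eq_integral => y _; rewrite !unlock.
rewrite (_ : (fun x => _) = fubini_F m2 g^\-%E).
  exact: (measurable_fun_fubini_tonelli_F (m2 := m2) g^\-%E mgn (funeneg_ge0 g)).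
by apply/funext => x; apply: eq_integral => y _; rewrite !unlock.
Qed.

(** Boundedness of b makes the product integrable, so Fubini's theorem applies. The factors
    A and B stay outside so that the lemma can be iterated. *)
Lemma Rintegral_kernel_swap :
  \int[m1]_x (A x * \int[m2]_y (B y * b (x, y))) =
  \int[m2]_y (B y * \int[m1]_x (A x * b (x, y))).
Proof.
have := Fubini integrable_prod_kernel => /= H.
rewrite /Rintegral; congr fine.
transitivity (\int[m1]_x \int[m2]_y (A x * (B y * b (x, y)))%:E)%E.
  apply: eq_integral => x _.
  have iBx : m2.-integrable setT (fun y => (B y * b (x, y))%:E).
    apply: integrable_mul_bounded iB _ _ => //.
    exact: measurableT_comp.
  rewrite EFinM fineK ?integrable_fin_num// -integralZl//.
rewrite H; apply: eq_integral => y _.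
have iAy : m1.-integrable setT (fun x => (A x * b (x, y))%:E).
  apply: integrable_mul_bounded iA _ _ => //.
  exact: measurableT_comp.
rewrite EFinM fineK ?integrable_fin_num// -integralZl//.
by apply: eq_integral => x _; congr EFin; ring.
Qed.

End fubini_swap.

(** * The triangle function on R^n *)

Section triangle_weight_Rn.
Context {R : realType}.
Local Open Scope classical_set_scope.
Local Notation leb := (@lebesgue_measure R).

(** Lebesgue measure in dimension n + 1 is the image of a product measure, so Tonelli's
    theorem peels off the first coordinate. *)
Lemma ge0_integral_Rn_cons n (F : n.+1.-tuple R -> \bar R) :
  measurable_fun setT F -> (forall y, 0 <= F y)%E ->
  (\int[lebesgue_Rn R n.+1]_y F y =
   \int[lebesgue_Rn R n]_y \int[leb]_x F (tuple_cons (x, y)))%E.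
Proof.
move=> mF F0.
have -> : (\int[lebesgue_Rn R n.+1]_y F y =
    \int[leb \x lebesgue_Rn R n]_z F (tuple_cons z))%E.
  exact: (@ge0_integral_pushforward _ _ _ _ _ _ (@measurable_tuple_cons R n)
    (leb \x lebesgue_Rn R n)%E setT F measurableT mF (fun y _ => F0 y)).
rewrite (fubini_tonelli2 (m1 := leb) (m2 := lebesgue_Rn R n) (fun z => F (tuple_cons z)))//.
by apply: measurableT_comp => //; exact: measurable_tuple_cons.
Qed.

Lemma integral_Rn_cons n (F : n.+1.-tuple R -> \bar R) :
  (lebesgue_Rn R n.+1).-integrable setT F ->
  (\int[lebesgue_Rn R n.+1]_y F y =
   \int[lebesgue_Rn R n]_y \int[leb]_x F (tuple_cons (x, y)))%E.
Proof.
move=> iF; have mF := measurable_int _ iF.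
have mFc : measurable_fun setT (F \o @tuple_cons R n).
  by apply: measurableT_comp => //; exact: measurable_tuple_cons.
have iFc : (leb \x lebesgue_Rn R n)%E.-integrable setT (F \o @tuple_cons R n).
  apply/integrableP; split=> //; have /integrableP[_] := iF.
  apply: le_lt_trans; rewrite le_eqVlt; apply/orP; left; apply/eqP/esym.
  apply: (@ge0_integral_pushforward _ _ _ _ _ _ (@measurable_tuple_cons R n)
    (leb \x lebesgue_Rn R n)%E setT (abse \o F) measurableT) => //.
    exact: measurableT_comp.
  by move=> y _; exact: abse_ge0.
have -> : (\int[lebesgue_Rn R n.+1]_y F y =
    \int[leb \x lebesgue_Rn R n]_z F (tuple_cons z))%E.
  exact: (@integral_pushforward _ _ _ _ _ _ (@measurable_tuple_cons R n)
    (leb \x lebesgue_Rn R n)%E setT F mF iFc measurableT).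
by rewrite -(integral21_prod_meas1 (m1 := leb) (m2 := lebesgue_Rn R n) iFc).
Qed.

Definition triangle_Rn n (rho : R) (c y : n.-tuple R) : R :=
  \prod_(i < n) triangle rho (tnth c i) (tnth y i).

Lemma triangle_Rn_ge0 n (rho : R) (c y : n.-tuple R) : 0 <= triangle_Rn rho c y.
Proof. by apply: prodr_ge0 => i _; exact: triangle_ge0. Qed.

Lemma measurable_triangle_Rn n (rho : R) (c : n.-tuple R) :
  measurable_fun setT (triangle_Rn rho c).
Proof.
apply: measurable_prod => i _.
apply: (measurableT_comp (measurable_triangle rho (tnth c i))).
exact: measurable_tnth.
Qed.

Lemma triangle_Rn_cons n (rho : R) c0 (c : n.-tuple R) y0 (y : n.-tuple R) :
  triangle_Rn rho [tuple of c0 :: c] (tuple_cons (y0, y)) =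
  triangle rho c0 y0 * triangle_Rn rho c y.
Proof.
rewrite /triangle_Rn big_ord_recl /tuple_cons /= !tnth0; congr (_ * _).
by apply: eq_bigr => i _; rewrite !tnthS.
Qed.

Lemma dotp_cons n t0 (t : n.-tuple R) y0 (y : n.-tuple R) :
  dotp [tuple of t0 :: t] (tuple_cons (y0, y)) = t0 * y0 + dotp t y.
Proof.
rewrite /dotp big_ord_recl /tuple_cons /= !tnth0; congr (_ + _).
by apply: eq_bigr => i _; rewrite !tnthS.
Qed.

Lemma integral_triangle_Rn n (rho : R) (c : n.-tuple R) : 0 < rho ->
  (\int[lebesgue_Rn R n]_y (triangle_Rn rho c y)%:E = (rho ^+ n)%:E)%E.
Proof.
move=> rho0; elim: n c => [|n IHn] c.
  rewrite /= integral_dirac//; last by apply/measurable_EFinP; exact: measurable_triangle_Rn.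
  by rewrite diracT mul1e /triangle_Rn big_ord0.
case/tupleP: c => c0 c.
rewrite ge0_integral_Rn_cons; last 2 first.
- by apply/measurable_EFinP; exact: measurable_triangle_Rn.
- by move=> y; rewrite lee_fin triangle_Rn_ge0.
transitivity (\int[lebesgue_Rn R n]_y (rho%:E * (triangle_Rn rho c y)%:E))%E.
  apply: eq_integral => y _; rewrite -(integral_triangle c0 rho0) -ge0_integralZr//.
  - by apply: eq_integral => x _; rewrite triangle_Rn_cons.
  - by apply/measurable_EFinP; exact: measurable_triangle.
  - by move=> x _; rewrite lee_fin triangle_ge0.
  - by rewrite lee_fin triangle_Rn_ge0.
rewrite ge0_integralZl//.
- by rewrite IHn -EFinM exprS.
- by apply/measurable_EFinP; exact: measurable_triangle_Rn.
- by move=> y _; rewrite lee_fin triangle_Rn_ge0.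
- by rewrite lee_fin ltW.
Qed.

Lemma integrable_triangle_Rn n (rho : R) (c : n.-tuple R) : 0 < rho ->
  (lebesgue_Rn R n).-integrable setT (EFin \o triangle_Rn rho c).
Proof.
move=> rho0; apply/integrableP; split.
  by apply/measurable_EFinP; exact: measurable_triangle_Rn.
under eq_integral do rewrite gee0_abs ?lee_fin ?triangle_Rn_ge0//=.
by rewrite integral_triangle_Rn// ltry.
Qed.

Lemma measurable_cosR : measurable_fun setT (@cos R).
Proof. by apply: continuous_measurable_fun; exact: continuous_cos. Qed.

Lemma measurable_dotp n (t : n.-tuple R) : measurable_fun setT (dotp t).
Proof.
apply: measurable_sum => i; apply: measurable_funM => //.
exact: measurable_tnth.
Qed.

(** The arbitrary phase th makes the induction on the dimension work: integrating out one
    coordinate only shifts it. *)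
Lemma integral_triangle_Rn_cos n (rho : R) (c t : n.-tuple R) th : 0 < rho ->
  \int[lebesgue_Rn R n]_y (triangle_Rn rho c y * cos (th + dotp t y)) =
  cos (th + dotp t c) * \prod_(i < n) triangle_hat rho (tnth t i).
Proof.
move=> rho0; rewrite /Rintegral -[RHS]/(fine (_%:E)); congr fine.
have mcos k (s : k.-tuple R) h : measurable_fun setT (fun y => cos (h + dotp s y)).
  apply: (measurableT_comp measurable_cosR); apply: measurable_funD => //.
  exact: measurable_dotp.
have icos k (b s : k.-tuple R) h : (lebesgue_Rn R k).-integrable setT
    (fun y => (triangle_Rn rho b y * cos (h + dotp s y))%:E).
  apply: (@integrable_mul_bounded _ _ _ _ _ _ 1) => //.
  - exact: integrable_triangle_Rn.
  - exact: mcos.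
  - by move=> y; rewrite ler_norml cos_geN1 cos_le1.
elim: n c t th => [|n IHn] c t th.
  rewrite /= integral_dirac//.
    rewrite diracT mul1e /triangle_Rn /dotp !big_ord0; congr EFin; ring.
  exact: measurable_int (icos 0%N c t th).
rewrite integral_Rn_cons; last exact: icos.
case/tupleP: c => c0 c; case/tupleP: t => t0 t.
transitivity (\int[lebesgue_Rn R n]_y ((triangle_hat rho t0)%:E *
   (triangle_Rn rho c y * cos (th + t0 * c0 + dotp t y))%:E))%E.
  apply: eq_integral => y _.
  transitivity (\int[leb]_x ((triangle_Rn rho c y)%:E *
      (triangle rho c0 x * cos (th + dotp t y + t0 * x))%:E))%E.
    apply: eq_integral => x _; rewrite triangle_Rn_cons dotp_cons -EFinM.
    congr EFin; have -> : th + (t0 * x + dotp t y) = th + dotp t y + t0 * x by ring.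
    ring.
  rewrite integralZl//; last first.
    apply: (@integrable_mul_bounded _ _ _ _ _ _ 1) => //.
    - apply/integrableP; split; first by apply/measurable_EFinP; exact: measurable_triangle.
      under eq_integral do rewrite gee0_abs ?lee_fin ?triangle_ge0//=.
      by rewrite integral_triangle// ltry.
    - exact: measurable_cos_affine.
    - by move=> z; rewrite ler_norml cos_geN1 cos_le1.
  rewrite integral_triangle_cos// -!EFinM; congr EFin.
  have -> : th + dotp t y + t0 * c0 = th + t0 * c0 + dotp t y by ring.
  ring.
rewrite integralZl; [|exact: measurableT|exact: icos].
rewrite IHn.
rewrite -EFinM; congr EFin.
rewrite big_ord_recl tnth0 (dotp_cons t0 t c0 c : dotp _ [tuple of c0 :: c] = _).
under [in RHS]eq_bigr do rewrite tnthS.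
have -> : th + (t0 * c0 + dotp t c) = th + t0 * c0 + dotp t c by ring.
ring.
Qed.

End triangle_weight_Rn.

(** * Local L_2 estimate for Fourier transforms *)

Section lattice_sums.
Context {R : realType}.
Local Open Scope classical_set_scope.

(** Compared with the telescoping sum of 1/N - 1/(N+1). *)
Lemma sum_inv_sq_le (N : nat) :
  \sum_(0 <= i < N) ((1 + i%:R) ^+ 2)^-1 <= (2 : R).
Proof.
case: N => [|N]; first by rewrite big_geq.
suff : \sum_(0 <= i < N.+1) ((1 + i%:R) ^+ 2)^-1 <= 2 - N.+1%:R^-1 :> R.
  by move/le_trans; apply; rewrite lerBlDr lerDl invr_ge0.
elim: N => [|N IHN]; first by rewrite big_nat1 addr0 expr1n !invr1; lra.
rewrite big_nat_recr//=; apply: le_trans (lerD IHN (lexx _)) _.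
set x : R := N.+1%:R.
have -> : (N.+2%:R : R) = x + 1 by rewrite /x natr1.
rewrite (addrC 1 x).
have x0 : 0 < x by rewrite ltr0n.
rewrite -subr_ge0.
have -> : 2 - (x + 1)^-1 - (2 - x^-1 + ((x + 1) ^+ 2)^-1) = (x * (x + 1) ^+ 2)^-1.
  by field; apply/andP; split; apply: lt0r_neq0; lra.
by rewrite invr_ge0 mulr_ge0 ?ltW// exprn_gt0//; lra.
Qed.

Lemma esum_kappa_le (k : int) :
  (\esum_(j in [set: int]) (kappa (k - j) : R)%:E <= 36%:E)%E.
Proof.
have -> : (\esum_(j in [set: int]) (kappa (k - j) : R)%:E =
           \esum_(j in [set: int]) (kappa j : R)%:E)%E.
  apply/esym/(@reindex_esum _ _ _ setT setT (fun j => k - j)); split => //.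
    by move=> i j _ _ /addrI /oppr_inj.
  by move=> j _; exists (k - j) => //; rewrite subKr.
have k0 (j : int) : (0 <= (kappa j : R)%:E)%E by rewrite lee_fin kappa_ge0.
rewrite esum_int// -!nneseries_esumT//.
have -> : (36%:E = 18%:E + 18%:E :> \bar R)%E by rewrite -EFinD; congr EFin; ring.
apply: leeD; apply: nneseries_le_ub => // N; rewrite sumEFin lee_fin.
  apply: (@le_trans _ _ (9 * \sum_(0 <= i < N) ((1 + i%:R) ^+ 2)^-1)).
    by rewrite mulr_sumr; apply: ler_sum => i _; rewrite /kappa.
  by have := sum_inv_sq_le N; lra.
apply: (@le_trans _ _ (9 * \sum_(0 <= i < N) ((1 + i%:R) ^+ 2)^-1)).
  rewrite mulr_sumr; apply: ler_sum => i _; rewrite /kappa.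
  rewrite ler_pM2l// lef_pV2 ?posrE ?exprn_gt0 ?ltr_wpDr//.
  apply: lerXn2r; rewrite ?nnegrE ?addr_ge0// lerD2l.
  by rewrite ler_nat; lia.
by have := sum_inv_sq_le N; lra.
Qed.

Lemma esum_tuple_prod n (phi : 'I_n -> int -> R) (s : R) :
  (forall i j, 0 <= phi i j) ->
  (forall i, \esum_(j in [set: int]) (phi i j)%:E <= s%:E)%E ->
  (\esum_(l in [set: n.-tuple int]) (\prod_(i < n) phi i (tnth l i))%:E <=
   (s ^+ n)%:E)%E.
Proof.
elim: n phi => [|n IHn] phi phi0 phis.
  rewrite (@esum_single _ _ _ [tuple]) ?big_ord0//.
    by move=> l; rewrite big_ord0.
  by move=> l; rewrite (tuple0 l) eqxx.
have s0 : 0 <= s.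
  rewrite -lee_fin; apply: le_trans (phis ord0).
  by apply: esum_ge0 => j _; rewrite lee_fin.
pose P (l : n.-tuple int) := \prod_(i < n) phi (lift ord0 i) (tnth l i).
have P0 l : 0 <= P l by exact: prodr_ge0.
rewrite (@reindex_esum _ _ _ ([set: int] `*`` (fun=> [set: n.-tuple int])) _
  (fun z => [tuple of z.1 :: z.2])); last first.
  split=> //.
    move=> [j l] [j' l'] _ _ /= /(congr1 val) [-> ll]; congr pair.
    exact: val_inj.
  by move=> l _; case/tupleP: l => j l; exists (j, l).
rewrite -(@esum_esum _ _ _ _ _ (fun (j : int) (l : n.-tuple int) =>
   (\prod_(i < n.+1) phi i (tnth [tuple of j :: l] i))%:E)); last first.
  by move=> j l _ _; rewrite lee_fin prodr_ge0.
have E (j : int) (l : n.-tuple int) :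
    \prod_(i < n.+1) phi i (tnth [tuple of j :: l] i) = phi ord0 j * P l.
  rewrite big_ord_recl tnth0; congr (_ * _).
  by apply: eq_bigr => i _; rewrite tnthS.
apply: (@le_trans _ _ (\esum_(j in [set: int]) ((s ^+ n)%:E * (phi ord0 j)%:E)))%E.
  apply: le_esum => j _.
  rewrite (eq_esum (b := fun l => ((phi ord0 j)%:E * (P l)%:E)%E)); last first.
    by move=> l _; rewrite E EFinM.
  rewrite esumZl//.
  rewrite muleC; apply: lee_wpmul2r; rewrite ?lee_fin//.
  exact: (IHn (fun i => phi (lift ord0 i)) (fun i => phi0 _) (fun i => phis _)).
rewrite esumZl ?exprn_ge0//; last by move=> j; rewrite lee_fin.
by rewrite exprSr EFinM lee_wpmul2l// lee_fin exprn_ge0.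
Qed.

Definition kappa_tuple n (k l : n.-tuple int) : R :=
  \prod_(i < n) kappa (tnth k i - tnth l i).

Lemma kappa_tuple_ge0 n (k l : n.-tuple int) : 0 <= kappa_tuple k l.
Proof. by apply: prodr_ge0 => i _; exact: kappa_ge0. Qed.

Lemma kappa_tupleC n (k l : n.-tuple int) : kappa_tuple k l = kappa_tuple l k.
Proof. by apply: eq_bigr => i _; rewrite /kappa distnC. Qed.

Lemma sum_kappa_tuple_le n (k : n.-tuple int) (e : {fset n.-tuple int}) :
  \sum_(l <- e) kappa_tuple k l <= 36 ^+ n.
Proof.
rewrite -lee_fin.
apply: le_trans (@esum_tuple_prod n (fun i j => kappa (tnth k i - j)) 36 _ _).
- apply: esum_ge; exists [set` e]; first by split => //; exact: finite_fset.
  by rewrite fsbig_finite//= set_fsetK -sumEFin; exact: lexx.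
- by move=> i j; exact: kappa_ge0.
- by move=> i; exact: esum_kappa_le.
Qed.

(** The Schur test: bound each product a k * a l by half the sum of the squares, then use
    that the symmetric kernel has bounded row sums. *)
Lemma schur_kappa n (a : n.-tuple int -> R) (e : {fset n.-tuple int}) :
  \sum_(k <- e) a k * (\sum_(l <- e) a l * kappa_tuple k l) <=
  36 ^+ n * \sum_(k <- e) a k ^+ 2.
Proof.
apply: (@le_trans _ _ (\sum_(k <- e) \sum_(l <- e)
    (a k ^+ 2 * kappa_tuple k l / 2 + a l ^+ 2 * kappa_tuple l k / 2))).
  apply: ler_sum => k _; rewrite mulr_sumr; apply: ler_sum => l _.
  rewrite (kappa_tupleC l k); have := kappa_tuple_ge0 k l.
  set K := kappa_tuple _ _ => K0; have : 0 <= (a k - a l) ^+ 2 * K.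
    by rewrite mulr_ge0// sqr_ge0.
  lra.
under eq_bigr do rewrite big_split/=.
rewrite big_split/= [X in _ + X]exchange_big/= -big_split/=.
rewrite mulr_sumr; apply: ler_sum => k _.
rewrite -!mulr_suml -mulr_sumr -splitr mulrC ler_wpM2r ?sqr_ge0//.
exact: sum_kappa_tuple_le.
Qed.

End lattice_sums.

Section local_L2.
Context {R : realType} {n : nat}.
Local Open Scope classical_set_scope.
Local Notation mu := (lebesgue_Rn R n).
Local Notation Rn := (n.-tuple R).

Definition cos_transform (g : Rn -> R) (y : Rn) : R :=
  \int[mu]_x (g x * cos (2 * pi * dotp x y)).

Definition sin_transform (g : Rn -> R) (y : Rn) : R :=
  \int[mu]_x (g x * sin (2 * pi * dotp x y)).

Lemma measurable_dotp_prod d (X : measurableType d) (u v : X -> Rn) :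
  measurable_fun setT u -> measurable_fun setT v ->
  measurable_fun setT (fun z => dotp (u z) (v z)).
Proof.
move=> mu mv; apply: measurable_sum => i; apply: measurable_funM.
  exact: (measurableT_comp (measurable_tnth i) mu).
exact: (measurableT_comp (measurable_tnth i) mv).
Qed.

Lemma measurable_cos_dotp d (X : measurableType d) (u v : X -> Rn) :
  measurable_fun setT u -> measurable_fun setT v ->
  measurable_fun setT (fun z => cos (2 * pi * dotp (u z) (v z))).
Proof.
move=> mu mv; apply: (measurableT_comp measurable_cosR).
by apply: measurable_funM => //; exact: measurable_dotp_prod.
Qed.

Lemma measurable_sin_dotp d (X : measurableType d) (u v : X -> Rn) :
  measurable_fun setT u -> measurable_fun setT v ->
  measurable_fun setT (fun z => sin (2 * pi * dotp (u z) (v z))).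
Proof.
move=> mu mv.
have ms : measurable_fun setT (@sin R).
  by apply: continuous_measurable_fun; exact: continuous_sin.
apply: (measurableT_comp ms).
by apply: measurable_funM => //; exact: measurable_dotp_prod.
Qed.

Lemma normr_cos_le1 (x : R) : `|cos x| <= 1.
Proof. by rewrite ler_norml cos_geN1 cos_le1. Qed.

Lemma normr_sin_le1 (x : R) : `|sin x| <= 1.
Proof. by rewrite ler_norml sin_geN1 sin_le1. Qed.

Variables (g : Rn -> R) (ig : mu.-integrable setT (EFin \o g)).

Let mg : measurable_fun setT g.
Proof. by apply/measurable_EFinP; exact: measurable_int ig. Qed.

Lemma integrable_mul_cos (y : Rn) :
  mu.-integrable setT (fun x => (g x * cos (2 * pi * dotp x y))%:E).
Proof.
apply: (@integrable_mul_bounded _ _ _ _ _ _ 1) => // [|x].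
  by apply: measurable_cos_dotp.
exact: normr_cos_le1.
Qed.

Lemma integrable_mul_sin (y : Rn) :
  mu.-integrable setT (fun x => (g x * sin (2 * pi * dotp x y))%:E).
Proof.
apply: (@integrable_mul_bounded _ _ _ _ _ _ 1) => // [|x].
  by apply: measurable_sin_dotp.
exact: normr_sin_le1.
Qed.

Lemma measurable_cos_transform : measurable_fun setT (cos_transform g).
Proof.
apply: (@measurable_kernel_integral _ _ _ _ _ mu g
  (fun z => cos (2 * pi * dotp z.2 z.1)) ig).
exact: measurable_cos_dotp.
Qed.

Lemma measurable_sin_transform : measurable_fun setT (sin_transform g).
Proof.
apply: (@measurable_kernel_integral _ _ _ _ _ mu g
  (fun z => sin (2 * pi * dotp z.2 z.1)) ig).
exact: measurable_sin_dotp.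
Qed.

(** The real part of the transform at y after multiplication by the character of u: its
    integral against g u is the squared modulus of the transform, in a form that is
    bilinear in g. *)
Definition correlation (y u : Rn) : R :=
  \int[mu]_v (g v * cos (2 * pi * dotp u y - 2 * pi * dotp v y)).

Lemma correlationE y u : correlation y u =
  cos (2 * pi * dotp u y) * cos_transform g y +
  sin (2 * pi * dotp u y) * sin_transform g y.
Proof.
rewrite /correlation /cos_transform /sin_transform.
rewrite -RintegralZl//; last exact: integrable_mul_cos.
rewrite -RintegralZl//; last exact: integrable_mul_sin.
rewrite -RintegralD//.
- by apply: eq_Rintegral => v _; rewrite cosB; ring.
- have := @integrableZl _ _ _ mu setT measurableT (cos (2 * pi * dotp u y)) _ (integrable_mul_cos y).
  by [].
- have := @integrableZl _ _ _ mu setT measurableT (sin (2 * pi * dotp u y)) _ (integrable_mul_sin y).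
  by [].
Qed.

Lemma sqr_transformE y :
  cos_transform g y ^+ 2 + sin_transform g y ^+ 2 =
  \int[mu]_u (g u * correlation y u).
Proof.
set C := cos_transform g y; set S := sin_transform g y.
rewrite !expr2 {2}/C {2}/S /cos_transform /sin_transform.
rewrite -RintegralZl//; last exact: integrable_mul_cos.
rewrite -RintegralZl//; last exact: integrable_mul_sin.
rewrite -RintegralD//.
- by apply: eq_Rintegral => u _; rewrite correlationE -/C -/S; ring.
- have := @integrableZl _ _ _ mu setT measurableT C _ (integrable_mul_cos y).
  by [].
- have := @integrableZl _ _ _ mu setT measurableT S _ (integrable_mul_sin y).
  by [].
Qed.

Let L1 := \int[mu]_x `|g x|.

Lemma normr_Rintegral_mul_le (h : Rn -> R) : measurable_fun setT h ->
  (forall x, `|h x| <= 1) -> `|\int[mu]_x (g x * h x)| <= L1.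
Proof.
move=> mh h1; have igh := integrable_mul_bounded ig mh h1.
apply: le_trans (le_normr_Rintegral _ igh) _ => //.
apply: le_Rintegral => //.
- have := integrable_norm igh; apply: eq_integrable => // x _ /=.
- have := integrable_norm ig; apply: eq_integrable => // x _ /=.
- by move=> x _; rewrite normrM ler_piMr.
Qed.

Lemma cos_transform_bounded y : `|cos_transform g y| <= L1.
Proof.
apply: normr_Rintegral_mul_le => [|x]; last exact: normr_cos_le1.
exact: measurable_cos_dotp.
Qed.

Lemma sin_transform_bounded y : `|sin_transform g y| <= L1.
Proof.
apply: normr_Rintegral_mul_le => [|x]; last exact: normr_sin_le1.
exact: measurable_sin_dotp.
Qed.

Variables (rho : R) (rho0 : 0 < rho) (c : Rn).
Let W := triangle_Rn rho c.

Lemma measurable_cos_diff d (X : measurableType d) (u v y : X -> Rn) :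
  measurable_fun setT u -> measurable_fun setT v -> measurable_fun setT y ->
  measurable_fun setT (fun z => cos (2 * pi * dotp (u z) (y z) - 2 * pi * dotp (v z) (y z))).
Proof.
move=> mu mv my; apply: (measurableT_comp measurable_cosR).
by apply: measurable_funB; apply: measurable_funM => //; exact: measurable_dotp_prod.
Qed.

(** Both integrations in g are moved outside, which leaves the transform of the weight at
    u - v as the kernel. *)
Lemma integral_weighted_sqr_transform :
  \int[mu]_y (W y * (cos_transform g y ^+ 2 + sin_transform g y ^+ 2)) =
  \int[mu]_u (g u * \int[mu]_v (g v *
    \int[mu]_y (W y * cos (2 * pi * dotp u y - 2 * pi * dotp v y)))).
Proof.
under eq_Rintegral do rewrite sqr_transformE.
have iW : mu.-integrable setT (EFin \o W) by exact: integrable_triangle_Rn.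
have mcorr : measurable_fun setT (fun z : Rn * Rn => correlation z.1 z.2).
  apply: (@measurable_kernel_integral _ _ _ _ _ mu g
   (fun z => cos (2 * pi * dotp z.1.2 z.1.1 - 2 * pi * dotp z.2 z.1.1)) ig).
  apply: (@measurable_cos_diff _ _ (fun z => z.1.2) snd (fun z => z.1.1)) => //.
  - exact: (measurableT_comp measurable_snd).
  - exact: (measurableT_comp measurable_fst).
have bcorr (z : Rn * Rn) : `|correlation z.1 z.2| <= L1.
  apply: normr_Rintegral_mul_le => [|v]; last exact: normr_cos_le1.
  exact: (@measurable_cos_diff _ _ (fun=> z.2) id (fun=> z.1)).
etransitivity; first exact: (Rintegral_kernel_swap iW ig mcorr bcorr).
apply: eq_Rintegral => u _; apply: (congr1 (fun r => g u * r)).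
have mcos : measurable_fun setT
    (fun z : Rn * Rn => cos (2 * pi * dotp u z.1 - 2 * pi * dotp z.2 z.1)).
  exact: (@measurable_cos_diff _ _ (fun=> u)).
exact: (Rintegral_kernel_swap iW ig mcos (fun z => normr_cos_le1 _)).
Qed.

(** Replacing a kernel by its suprema b k over the cubes turns integrals against g into sums
    of cube masses; applied in each of the two variables, this reduces the double integral
    to the quadratic form of [schur_kappa]. *)
Lemma normr_Rintegral_dcubes_le (m : int) (e : {fset n.-tuple int}) (h : Rn -> R)
    (b : n.-tuple int -> R) :
  (forall x, ~ dcubes m e x -> g x = 0) -> measurable_fun setT h ->
  (forall k x, k \in e -> dcube m k x -> `|h x| <= b k) ->
  `|\int[mu]_x (g x * h x)| <=
  \sum_(k <- e) fine (\int[mu]_(x in dcube m k) `|g x|%:E)%E * b k.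
Proof.
move=> g0 mh hb.
have mgh : measurable_fun setT (fun x => (g x * h x)%:E).
  by apply/measurable_EFinP; exact: measurable_funM.
have mgb k : measurable_fun (dcube m k) (fun x => `|g x|%:E).
  by apply/measurable_EFinP; apply: measurable_funTS; exact: measurableT_comp.
have gk_fin k : (\int[mu]_(x in dcube m k) `|g x|%:E)%E \is a fin_num.
  rewrite ge0_fin_numE; last by apply: integral_ge0 => x _; rewrite lee_fin.
  have /integrableP[_] := ig; apply: le_lt_trans.
  rewrite [leLHS]integral_mkcond.
  apply: ge0_le_integral_nomeas => x _; rewrite patchE; case: ifPn => // _.
  by rewrite lee_fin.
have H : (`|\int[mu]_x (g x * h x)%:E| <=
  (\sum_(k <- e) fine (\int[mu]_(x in dcube m k) `|g x|%:E)%E * b k)%:E)%E.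
  apply: le_trans (le_abse_integral _ _ _) _ => //.
  apply: (@le_trans _ _ (\int[mu]_(x in dcubes m e) `|(g x * h x)%:E|))%E.
    rewrite [leRHS]integral_mkcond.
    apply: ge0_le_integral_nomeas => x _ //; rewrite patchE; case: ifPn => //.
    by rewrite notin_setE => /g0 ->; rewrite mul0r abse0; exact: lexx.
  rewrite ge0_integral_dcubes//; last first.
    by apply: measurable_funTS; exact: measurableT_comp.
  rewrite -sumEFin big_seq [leRHS]big_seq; apply: lee_sum => k ke.
  apply: (@le_trans _ _ (\int[mu]_(x in dcube m k) (`|g x|%:E * (b k)%:E)))%E.
    apply: ge0_le_integral_nomeas => x xk //.
    by rewrite lee_fin normrM ler_wpM2l// hb.
  have [xk|ne] := pselect (exists x : Rn, dcube m k x).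
    have b0 : 0 <= b k.
      by have [x xkx] := xk; apply: le_trans (hb k x ke xkx).
    rewrite ge0_integralZr//; last exact: measurable_dcube.
    by rewrite EFinM fineK.
  rewrite (_ : dcube m k = set0); last first.
    by apply/seteqP; split => // x xk; apply: ne; exists x.
  by rewrite !integral_set0 mul0r.
have Hfin : (\int[mu]_x (g x * h x)%:E)%E \is a fin_num.
  by rewrite fin_num_abs; apply: le_lt_trans H (ltry _).
rewrite -lee_fin /Rintegral; move: H; rewrite -{1}(fineK Hfin).
by [].
Qed.

End local_L2.

Section local_L2_estimate.
Context {R : realType} {n : nat}.
Local Open Scope classical_set_scope.
Local Notation mu := (lebesgue_Rn R n).
Local Notation Rn := (n.-tuple R).

Lemma sqr_le_of_normr_le (x L : R) : `|x| <= L -> x ^+ 2 <= L ^+ 2.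
Proof.
move=> xL; rewrite -real_normK ?num_real//; apply: lerXn2r => //.
by rewrite nnegrE (le_trans _ xL).
Qed.

(** Almost orthogonality of the pieces of g on different cubes, seen from a set of diameter
    comparable to the inverse of their side. *)
Theorem local_L2_estimate (g : Rn -> R) (m : int) (e : {fset n.-tuple int})
    (c : Rn) (B : set Rn) : mu.-integrable setT (EFin \o g) ->
  (forall x, ~ dcubes m e x -> g x = 0) ->
  (forall y, B y -> forall i, `|tnth y i - tnth c i| <= (2 ^ m)^-1) ->
  (\int[mu]_(y in B) (cos_transform g y ^+ 2 + sin_transform g y ^+ 2)%:E <=
   (144 ^+ n * ((2 ^ m)^-1) ^+ n *
    \sum_(k <- e) fine (\int[mu]_(x in dcube m k) `|g x|%:E)%E ^+ 2)%:E)%E.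
Proof.
move=> ig g0 Bc; set h : R := 2 ^ m.
have h0 : 0 < h by rewrite exprz_gt0.
pose rho := 2 / h; have rho0 : 0 < rho by rewrite divr_gt0.
pose a k := fine (\int[mu]_(x in dcube m k) `|g x|%:E)%E.
have a0 k : 0 <= a k by apply/fine_ge0/integral_ge0 => x _; rewrite lee_fin.
pose W := triangle_Rn rho c.
pose E y := cos_transform g y ^+ 2 + sin_transform g y ^+ 2.
have E0 y : 0 <= E y by rewrite addr_ge0 ?sqr_ge0.
pose V u v := \int[mu]_y (W y * cos (2 * pi * dotp u y - 2 * pi * dotp v y)).
have VE u v : V u v = cos (\sum_(i < n) (2 * pi * (tnth u i - tnth v i)) * tnth c i) *
    \prod_(i < n) triangle_hat rho (2 * pi * (tnth u i - tnth v i)).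
  pose t : Rn := [tuple 2 * pi * (tnth u i - tnth v i) | i < n].
  have tE y : 2 * pi * dotp u y - 2 * pi * dotp v y = 0 + dotp t y.
    rewrite add0r /dotp !mulr_sumr -sumrB; apply: eq_bigr => i _.
    by rewrite tnth_mktuple; ring.
  rewrite /V; under eq_Rintegral do rewrite tE.
  rewrite integral_triangle_Rn_cos// add0r; congr (cos _ * _).
    by apply: eq_bigr => i _; rewrite tnth_mktuple.
  by apply: eq_bigr => i _; rewrite tnth_mktuple.
have Vle k l u v : dcube m k u -> dcube m l v ->
    `|V u v| <= rho ^+ n * kappa_tuple k l.
  move=> uk vl; rewrite VE normrM.
  rewrite -[leRHS]mul1r ler_pM//; first exact: normr_cos_le1.
  rewrite ger0_norm; last by apply: prodr_ge0 => i _; exact: triangle_hat_ge0.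
  rewrite /kappa_tuple -[n in rho ^+ n]card_ord -prodr_const -big_split/=.
  apply: ler_prod => i _; rewrite triangle_hat_ge0//=.
  exact: triangle_hat_le_kappa.
have mV : measurable_fun setT (fun z : Rn * Rn => V z.1 z.2).
  have iW : mu.-integrable setT (EFin \o W) by exact: integrable_triangle_Rn.
  apply: (@measurable_kernel_integral _ _ _ _ _ mu W
    (fun z => cos (2 * pi * dotp z.1.1 z.2 - 2 * pi * dotp z.1.2 z.2)) iW).
  apply: (@measurable_cos_diff _ _ _ _ (fun z => z.1.1) (fun z => z.1.2) snd) => //.
  - exact: (measurableT_comp measurable_fst).
  - exact: (measurableT_comp measurable_snd).
have mVu u : measurable_fun setT (V u) by exact: (measurableT_comp mV (pair1_measurable u)).
pose I u := \int[mu]_v (g v * V u v).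
have Ile k u : k \in e -> dcube m k u ->
    `|I u| <= rho ^+ n * \sum_(l <- e) a l * kappa_tuple k l.
  move=> ke uk; apply: le_trans (normr_Rintegral_dcubes_le ig (m := m) (e := e)
    (b := fun l => rho ^+ n * kappa_tuple k l) g0 (mVu u) _) _.
    by move=> l v le vl; exact: Vle.
  by rewrite mulr_sumr le_eqVlt; apply/orP; left; apply/eqP/eq_bigr => l _; rewrite mulrCA.
have mI : measurable_fun setT I.
  exact: (@measurable_kernel_integral _ _ _ _ _ mu g (fun z => V z.1 z.2) ig mV).
have total : \int[mu]_y (W y * E y) <= (rho * 36) ^+ n * \sum_(k <- e) a k ^+ 2.
  rewrite integral_weighted_sqr_transform//.
  apply: le_trans (ler_norm _) _.
  apply: le_trans (normr_Rintegral_dcubes_le ig (m := m) (e := e)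
    (b := fun k => rho ^+ n * \sum_(l <- e) a l * kappa_tuple k l) g0 mI _) _.
    by move=> k x ke xk; exact: Ile.
  have rn0 : 0 <= rho ^+ n by rewrite exprn_ge0// ltW.
  apply: (@le_trans _ _ (rho ^+ n * \sum_(k <- e) a k * (\sum_(l <- e) a l * kappa_tuple k l))); last first.
    by rewrite [(rho * 36) ^+ n]exprMn -[leRHS]mulrA ler_wpM2l//; exact: schur_kappa.
  by rewrite mulr_sumr le_eqVlt; apply/orP; left; apply/eqP/eq_bigr => k _; rewrite mulrCA.
have mE : measurable_fun setT E.
  by apply: measurable_funD; apply: measurable_funX;
    [exact: measurable_cos_transform|exact: measurable_sin_transform].
have iWE : mu.-integrable setT (fun y => (W y * E y)%:E).
  pose L := \int[mu]_x `|g x|.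
  apply: (@integrable_mul_bounded _ _ _ _ _ _ (L ^+ 2 + L ^+ 2)) => //.
    exact: integrable_triangle_Rn.
  move=> y; rewrite ger0_norm//; apply: lerD.
    exact/sqr_le_of_normr_le/cos_transform_bounded.
  exact/sqr_le_of_normr_le/sin_transform_bounded.
apply: (@le_trans _ _ (\int[mu]_y ((2 ^+ n)%:E * (W y * E y)%:E)))%E.
  rewrite integral_mkcond; apply: ge0_le_integral_nomeas => y _.
    by apply: erestrict_ge0 => z _; rewrite lee_fin; exact: E0.
  rewrite patchE; case: ifPn => [|_]; last first.
    change ((0 : \bar R) <= (2 ^+ n)%:E * (W y * E y)%:E)%E.
    by rewrite -EFinM lee_fin mulr_ge0// mulr_ge0// triangle_Rn_ge0.
  (* rho is twice the half-side of B, so each triangle factor is at least 1/2 there *)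
  rewrite inE => /Bc yc; rewrite -EFinM lee_fin mulrA ler_peMl//.
    exact: E0.
  have -> : (2 : R) ^+ n = \prod_(i < n) 2 by rewrite prodr_const card_ord.
  rewrite [leLHS](_ : 1 = \prod_(i < n) 1); last by rewrite big1.
  rewrite /W /triangle_Rn -big_split/=.
  apply: ler_prod => i _; rewrite ler01/=.
  have : 1 - `|tnth y i - tnth c i| / rho >= 1 / 2.
    rewrite lerBrDr -lerBrDl ler_pdivrMr// /rho.
    have -> : (1 - 1 / 2) * (2 / h) = h^-1 by field; rewrite gt_eqF.
    exact: yc.
  by rewrite /triangle => H; rewrite max_r; lra.
rewrite ge0_integralZl//; last 2 first.
- exact: measurable_int iWE.
- by move=> y _; rewrite lee_fin mulr_ge0// triangle_Rn_ge0.
have -> : (\int[mu]_y (W y * E y)%:E = (\int[mu]_y (W y * E y))%:E)%E.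
  by rewrite /Rintegral fineK//; exact: integrable_fin_num.
rewrite -EFinM lee_fin; apply: le_trans (ler_wpM2l _ total) _.
  by rewrite exprn_ge0.
rewrite mulrA -!exprMn le_eqVlt; apply/orP; left; apply/eqP.
congr (_ ^+ _ * _); rewrite /rho; field; exact: lt0r_neq0.
Qed.

End local_L2_estimate.

(** * Weights for summing over levels of cube masses *)

Section summable_weights.
Context {R : realType}.
Local Open Scope ereal_scope.

Lemma abse_nneseries_le (f : nat -> \bar R) : summable setT f ->
  `|\sum_(i <oo) f i| <= \sum_(i <oo) `|f i|.
Proof.
move=> sf.
have sf' : summable (fun i : nat => xpredT i) f.
  by rewrite (_ : (fun _ => _) = setT)//; apply/seteqP; split.
rewrite (@summable_eseries _ f xpredT sf').
have p0 : 0 <= \sum_(i <oo) f^\+ i by apply: nneseries_ge0 => i _ _; exact: funepos_ge0.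
have n0 : 0 <= \sum_(i <oo) f^\- i by apply: nneseries_ge0 => i _ _; exact: funeneg_ge0.
have pf : \sum_(i <oo) f^\+ i <= \sum_(i <oo) `|f i|.
  apply: lee_nneseries => [i _ _|i _]; first exact: funepos_ge0.
  by rewrite -[leRHS]/((abse \o f) i) fune_abse leeDl// funeneg_ge0.
have nf : \sum_(i <oo) f^\- i <= \sum_(i <oo) `|f i|.
  apply: lee_nneseries => [i _ _|i _]; first exact: funeneg_ge0.
  by rewrite -[leRHS]/((abse \o f) i) fune_abse leeDr// funepos_ge0.
set p := \sum_(i <oo) f^\+ i in p0 pf *; set q := \sum_(i <oo) f^\- i in n0 nf *.
have h1 : p - q <= p by have := leeB (lexx p) n0; rewrite sube0.
have h2 : - (p - q) <= q by rewrite leeNl; have := leeB p0 (lexx q); rewrite sub0e.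
have [h|/ltW h] := leP 0 (p - q).
  by rewrite gee0_abs// (le_trans h1).
by rewrite lee0_abs// (le_trans h2).
Qed.

(** Every x j is at most c j times the p-th root of the weighted sum, and the c j are
    summable; no convexity is involved, so p > 0 is arbitrary. *)
Lemma poweR_nneseries_le (x : nat -> \bar R) (c : nat -> R) (p C : R) :
  (0 < p)%R -> (forall j, 0 <= x j) -> (forall j, 0 < c j)%R ->
  \sum_(j <oo) (c j)%:E <= C%:E ->
  (\sum_(j <oo) x j) `^ p <=
  (C `^ p)%:E * \sum_(j <oo) (((c j)^-1 `^ p)%:E * x j `^ p).
Proof.
move=> p0 x0 c0 cC.
set S := \sum_(j <oo) (_ * _).
have t0 j : 0 <= ((c j)^-1 `^ p)%:E * x j `^ p.
  by rewrite mule_ge0 ?poweR_ge0// lee_fin powR_ge0.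
have S0 : 0 <= S by apply: nneseries_ge0.
have C0 : (0 <= C)%R.
  rewrite -lee_fin; apply: le_trans cC; apply: nneseries_ge0 => j _ _.
  by rewrite lee_fin ltW.
have tS j : ((c j)^-1 `^ p)%:E * x j `^ p <= S.
  rewrite /S nneseries_esumT//.
  exact: (@esum_ge1 _ _ (fun j => ((c j)^-1 `^ p)%:E * x j `^ p)).
have xS j : x j <= (c j)%:E * S `^ p^-1.
  have ci : (0 <= (c j)^-1)%R by rewrite invr_ge0 ltW.
  have : ((c j)^-1)%:E * x j <= S `^ p^-1.
    have -> : ((c j)^-1)%:E * x j = (((c j)^-1 `^ p)%:E * x j `^ p) `^ p^-1.
      rewrite -poweR_EFin -poweRM ?lee_fin// -poweRrM mulfV ?gt_eqF// poweRe1//.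
      by rewrite mule_ge0.
    by apply: ge0_le_poweR => //; rewrite invr_ge0 ltW.
  move=> H; rewrite -[leLHS]mul1e -(@mulfV _ (c j)) ?gt_eqF// EFinM -muleA.
  by rewrite lee_pmul2l// lte_fin.
have : \sum_(j <oo) x j <= C%:E * S `^ p^-1.
  apply: (@le_trans _ _ (\sum_(j <oo) ((c j)%:E * S `^ p^-1))).
    exact: lee_nneseries.
  case: (S `^ p^-1) (poweR_ge0 S p^-1) => [r|_|//].
    rewrite lee_fin => r0; under eq_eseriesr do rewrite muleC.
    rewrite nneseriesZl; last by move=> j _; rewrite lee_fin ltW.
    by rewrite muleC; apply: lee_wpmul2r; rewrite ?lee_fin.
  have C1 : (0 < C)%R.
    rewrite -lte_fin; apply: lt_le_trans cC.
    rewrite nneseries_esumT; last by move=> j; rewrite lee_fin ltW.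
    apply: lt_le_trans (@esum_ge1 _ _ (fun j => (c j)%:E) 0%N _).
      by rewrite lte_fin.
    by move=> j; rewrite lee_fin ltW.
  by rewrite gt0_muley ?lte_fin// leey.
move=> /(ge0_le_poweR (ltW p0)) H.
apply: le_trans (H _) _; first exact: nneseries_ge0.
rewrite poweRM ?lee_fin ?poweR_ge0// poweR_EFin -poweRrM mulVf ?gt_eqF// poweRe1//.
Qed.

End summable_weights.

Section level_sizes.
Context {R : realType}.

(** The weight (1+j)^(-4/3): it is summable, and dividing (1+j)^-2 by it leaves
    (1+j)^(-2/3), whose P-th power is at most the weight again because P >= 2. *)
Definition level_weight (j : nat) : R := (((1 + j%:R) `^ 3^-1) ^+ 4)^-1.

Let v (j : nat) : R := (1 + j%:R) `^ 3^-1.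

Let v3 j : v j ^+ 3 = 1 + j%:R.
Proof.
rewrite /v -powR_mulrn ?powR_ge0// -powRrM mulVf ?pnatr_eq0// powRr1//.
Qed.

Let v_ge1 j : 1 <= v j.
Proof.
rewrite -(@ler_pXn2r _ 3) ?nnegrE ?powR_ge0// v3 expr1n lerDl ler0n//.
Qed.

Lemma level_weight_gt0 j : 0 < level_weight j.
Proof. by rewrite invr_gt0 exprn_gt0// (lt_le_trans ltr01 (v_ge1 j)). Qed.

(** With v the cube root of 1 + j, the weight v^-4 is at most the increment of -3/v. *)
Lemma sum_level_weight N : \sum_(0 <= j < N) level_weight j <= 4.
Proof.
case: N => [|N]; first by rewrite big_geq.
suff : \sum_(0 <= j < N.+1) level_weight j <= 4 - 3 / v N.
  move/le_trans; apply; rewrite lerBlDr lerDl divr_ge0//.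
  by rewrite (le_trans ler01 (v_ge1 N)).
elim: N => [|N IHN].
  rewrite big_nat1 /level_weight /v addr0 powR1 expr1n !invr1; lra.
rewrite big_nat_recr//=; apply: le_trans (lerD IHN (lexx _)) _.
rewrite /level_weight -/(v N.+1).
have := v_ge1 N; have := v3 N; have := v_ge1 N.+1; have := v3 N.+1.
rewrite -natr1; set a := v N.+1; set b := v N => ha a1 hb b1.
have ab : a ^+ 3 - b ^+ 3 = 1 by rewrite ha hb; ring.
have ba : b <= a.
  have b3 : b ^+ 3 <= a ^+ 3 by rewrite -subr_ge0 ab.
  by rewrite -(@ler_pXn2r _ 3) ?nnegrE//; lra.
rewrite -subr_ge0.
have -> : 4 - 3 / a - (4 - 3 / b + (a ^+ 4)^-1) =
    (3 * a ^+ 3 * (a - b) - b) / (a ^+ 4 * b).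
  by field; apply/andP; split; apply: lt0r_neq0; lra.
rewrite divr_ge0//; last by rewrite mulr_ge0 ?exprn_ge0//; lra.
have H : (a - b) * (a ^+ 2 + a * b + b ^+ 2) = 1 by rewrite -ab; ring.
have H2 : (a - b) * (3 * a ^+ 2) >= 1.
  rewrite -H ler_wpM2l ?subr_ge0//; nra.
have : a * ((a - b) * (3 * a ^+ 2)) >= a * 1 by rewrite ler_wpM2l//; lra.
have -> : a * ((a - b) * (3 * a ^+ 2)) = 3 * a ^+ 3 * (a - b) by ring.
lra.
Qed.

Lemma nneseries_level_weight_le :
  (\sum_(j <oo) (level_weight j)%:E <= 4%:E)%E.
Proof.
apply: nneseries_le_ub => [j|N]; first by rewrite lee_fin ltW ?level_weight_gt0.
by rewrite sumEFin lee_fin sum_level_weight.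
Qed.

Lemma ln2_ge_half : 2^-1 <= ln 2 :> R.
Proof.
rewrite -ler_expR lnK ?posrE//.
have := expR_ge1Dx (- 2^-1 : R); rewrite expRN -[X in _ <= X -> _]mul1r.
by rewrite ler_pdivlMr ?expR_gt0//; lra.
Qed.

Lemma expRN_le (z : R) : 0 < z -> expR (- z) <= 4 / z ^+ 2.
Proof.
move=> z0; rewrite expRN -[leRHS]invrK invf_div lef_pV2 ?posrE ?expR_gt0 ?divr_gt0 ?exprn_gt0//.
have -> : z = z / 2 + z / 2 by lra.
rewrite expRD -splitr.
have := expR_ge1Dx (z / 2); have := expR_gt0 (z / 2); nra.
Qed.

(** If 1 + ln N is at least (1+j)/4, the hypothesis gives the decay; otherwise N is at most
    the exponential of (1+j)/4, which is negligible against 2^j. *)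
Lemma level_size_bound (N j : nat) (P : R) : (0 < N)%N -> 2 <= P ->
  N%:R `^ (1 - P^-1) / 2 ^+ j.+1 <= ((1 + ln N%:R) ^+ 2)^-1 ->
  N%:R `^ (1 - P^-1) / 2 ^+ j <= 128 / (1 + j%:R) ^+ 2.
Proof.
move=> N0 P2 H; have N1 : 1 <= N%:R :> R by rewrite ler1n.
have L0 : 0 <= ln N%:R :> R by rewrite ln_ge0.
have j0 : 0 <= j%:R :> R by rewrite ler0n.
set y : R := N%:R `^ _ in H *.
have [big|small] := leP ((1 + j%:R) / 4 : R) (1 + ln N%:R).
  have -> : y / 2 ^+ j = 2 * (y / 2 ^+ j.+1).
    by rewrite exprS; field; rewrite expf_neq0.
  apply: le_trans (_ : 2 * ((1 + ln N%:R) ^+ 2)^-1 <= _).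
    by rewrite ler_wpM2l.
  apply: (@le_trans _ _ (2 * (((1 + j%:R) / 4) ^+ 2)^-1)).
    rewrite ler_pM2l//; rewrite lef_pV2 ?posrE; last 2 first.
    - by rewrite exprn_gt0//; lra.
    - by rewrite exprn_gt0 ?divr_gt0//; lra.
    by apply: lerXn2r => //; rewrite nnegrE; lra.
  have -> : 2 * (((1 + j%:R) / 4) ^+ 2)^-1 = 32 / (1 + j%:R) ^+ 2 :> R.
    by field; apply: lt0r_neq0; lra.
  by rewrite ler_pM2r; [lra|rewrite invr_gt0 exprn_gt0//; lra].
have yN : y <= N%:R.
  apply: ler1_powR => //; rewrite gerBl invr_ge0; lra.
apply: le_trans (_ : N%:R / 2 ^+ j <= _).
  by rewrite ler_wpM2r// invr_ge0 exprn_ge0.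
have NE : N%:R <= expR ((1 + j%:R) / 4) :> R.
  by rewrite -[leLHS]lnK ?posrE ?ltr0n// ler_expR; lra.
have jE : (2 ^+ j)^-1 <= 2 * expR (- ((1 + j%:R) / 2)) :> R.
  have -> : (2 ^+ j)^-1 = 2 * expR (- (ln 2 * j.+1%:R)) :> R.
      by rewrite expRN expRM_natr lnK ?posrE// exprS invfM mulrA mulfV// mul1r.
  have -> : j.+1%:R = 1 + j%:R :> R by rewrite -natr1 addrC.
  rewrite ler_pM2l// ler_expR lerN2 mulrC ler_wpM2r ?addr_ge0//.
  exact: ln2_ge_half.
apply: le_trans (_ : expR ((1 + j%:R) / 4) * (2 * expR (- ((1 + j%:R) / 2))) <= _).
  by apply: ler_pM => //; rewrite ?invr_ge0 ?exprn_ge0.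
rewrite mulrCA -expRD.
have -> : (1 + j%:R) / 4 - (1 + j%:R) / 2 = - ((1 + j%:R) / 4) :> R by lra.
have z0 : 0 < (1 + j%:R) / 4 :> R by lra.
apply: le_trans (ler_wpM2l _ (expRN_le z0)) _ => //.
rewrite le_eqVlt; apply/orP; left; apply/eqP; field; apply: lt0r_neq0; lra.
Qed.

Lemma level_weight_powR (x P : R) (j : nat) : 2 <= P ->
  0 <= x <= 128 / (1 + j%:R) ^+ 2 ->
  (level_weight j)^-1 `^ P * x `^ P <= 128 `^ P * level_weight j.
Proof.
move=> P2 /andP[x0 xj]; rewrite -powRM ?invr_ge0 ?(ltW (level_weight_gt0 _))//.
have a1 := v_ge1 j; rewrite /level_weight -/(v j) -[1 + _]v3 in xj *.
set a := v j in a1 xj *; rewrite invrK.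
have le1 : a ^+ 4 * x <= 128 * (a ^+ 2)^-1.
  apply: le_trans (ler_wpM2l _ xj) _; first by rewrite exprn_ge0//; lra.
  rewrite le_eqVlt; apply/orP; left; apply/eqP; field; apply: lt0r_neq0; lra.
have a4 : 0 <= a ^+ 4 * x by rewrite mulr_ge0// exprn_ge0//; lra.
apply: (@le_trans _ _ ((128 * (a ^+ 2)^-1) `^ P)).
  apply: ge0_ler_powR; rewrite ?nnegrE//; first lra.
  by rewrite (le_trans a4 le1).
have ai : 0 < (a ^+ 2)^-1 by rewrite invr_gt0 exprn_gt0//; lra.
rewrite powRM ?(ltW ai)// ler_pM2l ?powR_gt0//.
have -> : (a ^+ 4)^-1 = (a ^+ 2)^-1 `^ 2%:R.
  by rewrite powR_mulrn ?(ltW ai)// exprVn -exprM.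
apply: ger_powR => //; rewrite ai/= invf_le1 ?exprn_ege1//.
by rewrite exprn_gt0//; lra.
Qed.

End level_sizes.

(** * Trigonometric transforms and blocks of cubes *)

Section trig_transform.
Context {R : realType} {n : nat}.
Local Open Scope classical_set_scope.
Local Notation mu := (lebesgue_Rn R n).
Local Notation Rn := (n.-tuple R).

(** With w the cosine or the sine, the real and imaginary parts of a Fourier transform are
    sums or differences of two such transforms of real functions. *)
Definition trig_transform (w : R -> R) (g : Rn -> R) (y : Rn) : R :=
  \int[mu]_x (g x * w (2 * pi * dotp x y)).

Definition cube_mass (m : int) (g : Rn -> R) (k : n.-tuple int) : R :=
  fine (\int[mu]_(x in dcube m k) `|g x|%:E)%E.

Definition box (c : Rn) (r : R) : set Rn :=
  [set y | forall i, tnth c i - r <= tnth y i < tnth c i + r].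

Lemma lebesgue_box (c : Rn) (r : R) : 0 <= r ->
  measurable (box c r) /\ mu (box c r) = ((2 * r) ^+ n)%:E.
Proof.
move=> r0.
pose a : Rn := [tuple tnth c i - r | i < n].
pose b : Rn := [tuple tnth c i + r | i < n].
have ab i : tnth a i <= tnth b i by rewrite !tnth_mktuple; lra.
have [] := lebesgue_Rn_box ab; set box' := [set x | _].
have -> : box' = box c r.
  by apply/seteqP; split=> x /= H i; have := H i; rewrite !tnth_mktuple.
move=> mbox ->; split => //; congr EFin.
under eq_bigr do rewrite !tnth_mktuple.
rewrite (eq_bigr (fun=> 2 * r)); last by move=> i _; ring.
by rewrite prodr_const card_ord.
Qed.

Lemma box_dist c r y : box c r y -> forall i, `|tnth y i - tnth c i| <= r.
Proof.
by move=> yB i; have /andP[] := yB i; rewrite ler_norml; lra.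
Qed.

Lemma eball_sub_box c (t r : R) : t <= r -> eball c t `<=` box c r.
Proof.
move=> tr y /= yt i.
have : `|tnth y i - tnth c i| < r.
  apply: lt_le_trans tr; apply: le_lt_trans yt; rewrite -sqrtr_sqr ler_sqrt.
    by rewrite (bigD1 i)//= lerDl sumr_ge0// => j _; exact: sqr_ge0.
  by apply: sumr_ge0 => j _; exact: sqr_ge0.
by rewrite ltr_norml => /andP[? ?]; apply/andP; split; lra.
Qed.

Variables (w : R -> R) (hw : w = cos \/ w = sin).

Lemma measurable_trig (y : Rn) :
  measurable_fun setT (fun x : Rn => w (2 * pi * dotp x y)).
Proof.
by case: hw => ->; [exact: measurable_cos_dotp|exact: measurable_sin_dotp].
Qed.

Lemma normr_trig_le1 (x : R) : `|w x| <= 1.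
Proof. by case: hw => ->; [exact: normr_cos_le1|exact: normr_sin_le1]. Qed.

Lemma sqr_trig_transform_le g y : (trig_transform w g y) ^+ 2 <=
  cos_transform g y ^+ 2 + sin_transform g y ^+ 2.
Proof.
by case: hw => ->; rewrite ?lerDl ?lerDr ?sqr_ge0.
Qed.

Variables (g : Rn -> R) (ig : mu.-integrable setT (EFin \o g)).

Let mg : measurable_fun setT g.
Proof. by apply/measurable_EFinP; exact: measurable_int ig. Qed.

Lemma integrable_mul_trig (y : Rn) :
  mu.-integrable setT (fun x => (g x * w (2 * pi * dotp x y))%:E).
Proof.
apply: (@integrable_mul_bounded _ _ _ _ _ _ 1) => // [|x].
  exact: measurable_trig.
exact: normr_trig_le1.
Qed.

Lemma measurable_trig_transform : measurable_fun setT (trig_transform w g).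
Proof.
by case: hw => ->; [exact: measurable_cos_transform|exact: measurable_sin_transform].
Qed.

Lemma erestrict_le (T : Type) (D : set T) (f : T -> \bar R) x :
  (0 <= f x -> (f \_ D) x <= f x)%E.
Proof. by rewrite patchE; case: ifPn. Qed.

Lemma ge0_integral_cubes (m : int) (f : Rn -> \bar R) :
  measurable_fun setT f -> (forall x, 0 <= f x)%E ->
  (\int[mu]_x f x = \esum_(k in [set: n.-tuple int]) \int[mu]_(x in dcube m k) f x)%E.
Proof.
move=> mf f0.
under eq_esum do rewrite integral_mkcond.
rewrite -ge0_integral_esum//.
- apply: eq_integral => x _.
  rewrite (@esum_single _ _ _ (cube_index m x)).
  + by rewrite patchE mem_set//; exact/dcubeP.
  + by move=> k; exact: erestrict_ge0.
  + move=> k kx; rewrite patchE memNset// => /dcubeP xk.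
    by move: kx; rewrite xk eqxx.
- move=> k; apply/(measurable_restrictT _ _).1; first exact: measurable_dcube.
  exact: measurable_funTS.
- by move=> k x; exact: erestrict_ge0.
Qed.

Lemma cube_mass_ge0 m k : 0 <= cube_mass m g k.
Proof. by apply/fine_ge0/integral_ge0 => x _; rewrite lee_fin. Qed.

Lemma cube_massE m k : ((cube_mass m g k)%:E = \int[mu]_(x in dcube m k) `|g x|%:E)%E.
Proof.
rewrite fineK// ge0_fin_numE; last by apply: integral_ge0 => x _; rewrite lee_fin.
have /integrableP[_] := ig; apply: le_lt_trans.
rewrite [leLHS]integral_mkcond; apply: ge0_le_integral_nomeas => x _.
  by apply: erestrict_ge0 => z _; rewrite lee_fin.
by apply: erestrict_le; rewrite lee_fin.
Qed.

Lemma sum_cube_mass m (e : {fset n.-tuple int}) :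
  (\sum_(k <- e) cube_mass m g k)%:E = (\int[mu]_(x in dcubes m e) `|g x|%:E)%E.
Proof.
rewrite ge0_integral_dcubes//.
- by rewrite -sumEFin; apply: eq_bigr => k _; rewrite cube_massE.
- by apply/measurable_EFinP; apply: measurable_funTS; exact: measurableT_comp.
Qed.

Lemma sum_cube_mass_le m (e : {fset n.-tuple int}) :
  \sum_(k <- e) cube_mass m g k <= \int[mu]_x `|g x|.
Proof.
rewrite -lee_fin sum_cube_mass /Rintegral fineK; last first.
  exact/integrable_fin_num/integrable_norm.
rewrite [leLHS]integral_mkcond; apply: ge0_le_integral_nomeas => x _.
  by apply: erestrict_ge0 => z _; rewrite lee_fin.
by apply: erestrict_le; rewrite lee_fin.
Qed.

Variables (m : int) (E : nat -> {fset n.-tuple int}).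
Hypothesis Edisj : forall i j k, k \in E i -> k \in E j -> i = j.
Hypothesis Ecover : forall k, cube_mass m g k != 0 -> exists j, k \in E j.

Definition block_part (e : {fset n.-tuple int}) : Rn -> R := g \_ (dcubes m e).

Lemma integrable_block_part e : mu.-integrable setT (EFin \o block_part e).
Proof.
rewrite /block_part -restrict_EFin; apply/integrable_restrict => //.
  exact: measurable_dcubes.
by rewrite setTI; apply: integrableS ig => //; exact: measurable_dcubes.
Qed.

Lemma block_part_out e x : ~ dcubes m e x -> block_part e x = 0.
Proof. by move=> xe; rewrite /block_part patchE memNset. Qed.

Lemma cube_mass_block_part e k : k \in e -> cube_mass m (block_part e) k = cube_mass m g k.
Proof.
move=> ke; congr fine; apply: eq_integral => x; rewrite inE => xk.
by rewrite /block_part patchE mem_set//; exists k.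
Qed.

Lemma trig_transform_block_part e y : (trig_transform w (block_part e) y)%:E =
  (\int[mu]_(x in dcubes m e) (g x * w (2 * pi * dotp x y))%:E)%E.
Proof.
rewrite /trig_transform /Rintegral fineK; last first.
  apply: integrable_fin_num => //.
  apply: (@integrable_mul_bounded _ _ _ _ _ _ 1) => // [||x].
  - exact: integrable_block_part.
  - exact: measurable_trig.
  - exact: normr_trig_le1.
rewrite [RHS]integral_mkcond; apply: eq_integral => x _.
by rewrite /block_part !patchE; case: ifPn => // _; rewrite mul0r.
Qed.

(** The cubes outside all blocks have mass zero, so the blocks carry the whole integral. *)
Lemma trig_transform_le_blocks y : (`|trig_transform w g y|%:E <=
  \sum_(j <oo) `|trig_transform w (block_part (E j)) y|%:E)%E.
Proof.
pose Z : set Rn := ~` \bigcup_j dcubes m (E j).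
pose F (j : nat) := if j is j'.+1 then dcubes m (E j') else Z.
have mF j : measurable (F j).
  case: j => [|j] /=; last exact: measurable_dcubes.
  by apply/measurableC/bigcup_measurable => j _; exact: measurable_dcubes.
have UF : \bigcup_j F j = setT.
  rewrite -subTset => x _; have [[j _ xj]|xZ] := pselect ((\bigcup_j dcubes m (E j)) x).
    by exists j.+1.
  by exists 0%N.
have tF : trivIset setT F.
  move=> [|i] [|j] _ _ // [x []] /=.
  - by move=> xZ xj; exfalso; apply: xZ; exists j.
  - by move=> xj xZ; exfalso; apply: xZ; exists i.
  - by move=> /dcubesP xi /dcubesP xj; congr S; exact: Edisj xi xj.
pose h x := (g x * w (2 * pi * dotp x y))%:E.
have ih : mu.-integrable setT h := integrable_mul_trig y.
have ih' : mu.-integrable (\bigcup_j F j) h by rewrite UF.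
have gZ : (\int[mu]_(x in Z) `|g x|%:E = 0)%E.
  rewrite integral_mkcond (ge0_integral_cubes m); last 2 first.
  - apply/(measurable_restrictT _ _).1; first exact: (mF 0%N).
    by apply/measurable_EFinP; apply: measurable_funTS; exact: measurableT_comp.
  - by move=> x; apply: erestrict_ge0 => z _; rewrite lee_fin.
  apply: esum1 => k _.
  have [k0|/Ecover[j kj]] := eqVneq (cube_mass m g k) 0.
    apply/eqP; rewrite eq_le; apply/andP; split; last first.
      by apply: integral_ge0 => x _; apply: erestrict_ge0 => z _; rewrite lee_fin.
    rewrite -[leRHS]/(0%:E) -k0 cube_massE.
    apply: ge0_le_integral_nomeas => x _.
      by apply: erestrict_ge0 => z _; rewrite lee_fin.
    by apply: erestrict_le; rewrite lee_fin.
  apply: integral0_eq => x xk; rewrite patchE memNset// => xZ.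
  by apply: xZ; exists j => //; exists k.
have hZ : (\int[mu]_(x in Z) h x = 0)%E.
  apply/eqP; rewrite -abse_eq0 eq_le abse_ge0 andbT.
  have mZ : measurable_fun Z h by apply: measurable_funTS; exact: measurable_int ih.
  apply: le_trans (le_abse_integral _ (mF 0%N) mZ) _; rewrite -gZ.
  apply: ge0_le_integral_nomeas => x _ //=.
  by rewrite lee_fin normrM ler_piMr//; exact: normr_trig_le1.
have -> : (`|trig_transform w g y|%:E = `|\int[mu]_x h x|)%E.
  by rewrite /trig_transform /Rintegral -[RHS]fineK ?abse_fin_num ?integrable_fin_num// fine_abse ?integrable_fin_num.
rewrite -[in leLHS]UF integral_bigcup//.
apply: le_trans (abse_nneseries_le (integrable_summable tF mF ih')) _.
apply: nneseries_le_ub => [i|[|N]]; first exact: abse_ge0.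
  by rewrite big_geq//; apply: nneseries_ge0 => j _ _; rewrite lee_fin.
rewrite big_nat_recl//= hZ abse0 add0e.
rewrite (eq_bigr (fun j => `|trig_transform w (block_part (E j)) y|%:E)); last first.
  by move=> j _; rewrite -trig_transform_block_part.
by apply: nneseries_lim_ge => j _; rewrite lee_fin.
Qed.

End trig_transform.

(** * Local L_p estimate for trigonometric transforms *)

Section local_Lp.
Context {R : realType} {n : nat}.
Local Open Scope classical_set_scope.
Local Notation mu := (lebesgue_Rn R n).
Local Notation Rn := (n.-tuple R).

Lemma sumr_const_fset (T : choiceType) (e : {fset T}) (x : R) :
  \sum_(k <- e) x = #|` e|%:R * x.
Proof. by rewrite big_const_seq count_predT iter_addr_0 mulr_natl. Qed.

Variables (w : R -> R) (hw : w = cos \/ w = sin).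
Variables (g : Rn -> R) (ig : mu.-integrable setT (EFin \o g)) (m : int).
Variables (P M : R) (P2 : 2 <= P) (M0 : 0 < M).
Local Notation a := (cube_mass m g).
Hypothesis massM : forall e : {fset n.-tuple int}, e != fset0 ->
  \sum_(k <- e) a k <= M * (#|` e|%:R `^ P^-1 / (1 + ln #|` e|%:R) ^+ 2).

Let P0 : 0 < P. Proof. by apply: lt_le_trans P2. Qed.

Definition level (j : nat) : set (n.-tuple int) :=
  [set k | M / 2 ^+ j.+1 < a k <= M / 2 ^+ j].

(** Infinitely many cubes of mass bounded below would contradict the integrability of g. *)
Lemma finite_level j : finite_set (level j).
Proof.
apply: contrapT => /infinite_set_fset infl.
pose tau := M / 2 ^+ j.+1; have tau0 : 0 < tau by rewrite divr_gt0 ?exprn_gt0.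
pose L := \int[mu]_x `|g x|.
have L0 : 0 <= L by apply: Rintegral_ge0 => x _.
have [e el ne] := infl (Num.truncn (L / tau)).+1.
have := sum_cube_mass_le ig m e; rewrite leNgt => /negP; apply.
apply: (@lt_le_trans _ _ (#|` e|%:R * tau)).
  rewrite -ltr_pdivrMr//; apply: lt_le_trans (truncnS_gt _) _.
  by rewrite ler_nat.
rewrite -sumr_const_fset big_seq [leRHS]big_seq; apply: ler_sum => k /el /= /andP[+ _].
exact: ltW.
Qed.

Definition levels (j : nat) : {fset n.-tuple int} := fset_set (level j).

Lemma in_levels j k : (k \in levels j) = (M / 2 ^+ j.+1 < a k <= M / 2 ^+ j).
Proof.
rewrite /levels in_fset_set; last exact: finite_level.
by apply/idP/idP; rewrite inE.
Qed.

Lemma levels_disj i j k : k \in levels i -> k \in levels j -> i = j.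
Proof.
rewrite !in_levels => /andP[i1 i2] /andP[j1 j2].
have H i' j' : (i' < j')%N -> M / 2 ^+ i'.+1 < a k -> a k <= M / 2 ^+ j' -> False.
  move=> ij h1 h2; have := lt_le_trans h1 h2.
  rewrite ltr_pM2l// ltf_pV2 ?posrE ?exprn_gt0// ltr_eXn2l ?ltr1n//.
  by rewrite ltnS leqNgt ij.
by case: (ltngtP i j) => // ij; exfalso; apply: (H _ _ ij).
Qed.

Lemma cube_mass_le k : a k <= M.
Proof.
have kN0 : [fset k]%fset != fset0 by rewrite -cardfs_gt0 cardfs1.
have := massM kN0; rewrite big_seq_fset1 cardfs1.
by rewrite powR1 ln1 addr0 expr1n divr1 mulr1.
Qed.

Lemma levels_cover k : a k != 0 -> exists j, k \in levels j.
Proof.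
move=> ak0; have ak : 0 < a k by rewrite lt_neqAle eq_sym ak0 cube_mass_ge0.
have ex : exists j, M / 2 ^+ j < a k.
  exists (Num.truncn (M / a k)).+1.
  rewrite ltr_pdivrMr ?exprn_gt0// mulrC -ltr_pdivrMr//.
  apply: lt_trans (truncnS_gt _) _; rewrite -natrX ltr_nat; exact: ltn_expl.
case: (ex_minnP ex) => -[|j] jk jmin.
  by move: jk; rewrite expr0 divr1 ltNge cube_mass_le.
exists j; rewrite in_levels jk/= leNgt; apply/negP => /jmin.
by rewrite ltnn.
Qed.

Local Notation r := (((2 : R) ^ m)^-1).
Local Notation part j := (block_part g m (levels j)).

Let r0 : 0 < r. Proof. by rewrite invr_gt0 exprz_gt0. Qed.

(** M times this number is the L_P norm of the j-th block as predicted by interpolation: a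
    block of N cubes of mass tau has L_2 square N tau^2 and sup norm N tau, and
    (N tau)^(P-2) N tau^2 is the P-th power of N^(1-1/P) tau. *)
Definition relative_size (j : nat) : R := #|` levels j|%:R `^ (1 - P^-1) / 2 ^+ j.

Lemma relative_size_bound j : 0 <= relative_size j <= 128 / (1 + j%:R) ^+ 2.
Proof.
have P1 : 1 - P^-1 != 0.
  by rewrite subr_eq0 eq_sym invr_eq1 gt_eqF// (lt_le_trans _ P2)// ltr1n.
rewrite /relative_size divr_ge0 ?powR_ge0 ?exprn_ge0//=.
have [->|e0] := eqVneq (levels j) fset0.
  by rewrite cardfs0 powR0// mul0r divr_ge0// sqr_ge0.
have N0 : (0 < #|` levels j|)%N by rewrite cardfs_gt0.
apply: level_size_bound => //.
set N : R := #|` levels j|%:R.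
have Ngt0 : 0 < N by rewrite ltr0n.
have H : N * (M / 2 ^+ j.+1) <= M * (N `^ P^-1 / (1 + ln N) ^+ 2).
  apply: le_trans (massM e0); rewrite -sumr_const_fset big_seq [leRHS]big_seq.
  by apply: ler_sum => k; rewrite in_levels => /andP[/ltW].
have NP : N = N `^ P^-1 * N `^ (1 - P^-1).
  rewrite -powRD; last by rewrite (gt_eqF Ngt0) implybT.
  by rewrite addrC subrK powRr1// ltW.
move: H; rewrite {1}NP mulrCA ler_pM2l// -mulrA ler_pM2l ?powR_gt0//.
Qed.

Lemma powR_split (x : R) : 0 <= x -> x `^ P = x `^ (P - 2) * x ^+ 2.
Proof.
move=> x0; rewrite -powR_mulrn// -powRD ?subrK//.
by rewrite (gt_eqF P0).
Qed.

(** Interpolation between the sup bound and the local L_2 estimate. *)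
Lemma integral_block_powR_le (c : Rn) j :
  (\int[mu]_(y in box c r) (`|trig_transform w (part j) y| `^ P)%:E <=
   (144 ^+ n * r ^+ n * (M * relative_size j) `^ P)%:E)%E.
Proof.
set K : R := 144 ^+ n * r ^+ n.
have K0 : 0 <= K by rewrite mulr_ge0// exprn_ge0// ltW.
pose tau := M / 2 ^+ j; have tau0 : 0 < tau by rewrite divr_gt0 ?exprn_gt0.
set N : R := #|` levels j|%:R; have N0 : 0 <= N by rewrite ler0n.
have ip := integrable_block_part ig m (levels j).
have Tle y : `|trig_transform w (part j) y| <= N * tau.
  apply: le_trans (normr_Rintegral_dcubes_le ip (m := m) (e := levels j)
    (b := fun=> 1) _ (measurable_trig hw y) _) _.
  - by move=> x; exact: block_part_out.
  - by move=> *; exact: normr_trig_le1.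
  rewrite -sumr_const_fset big_seq [leRHS]big_seq; apply: ler_sum => k kj.
  rewrite mulr1 -[leLHS]/(cube_mass m (part j) k) cube_mass_block_part//.
  by move: kj; rewrite in_levels => /andP[].
have sq : \sum_(k <- levels j) cube_mass m (part j) k ^+ 2 <= N * tau ^+ 2.
  rewrite -sumr_const_fset big_seq [leRHS]big_seq; apply: ler_sum => k kj.
  rewrite cube_mass_block_part//; apply: lerXn2r; rewrite ?nnegrE ?cube_mass_ge0 ?(ltW tau0)//.
  by move: kj; rewrite in_levels => /andP[].
have P20 : 0 <= P - 2 by rewrite subr_ge0.
apply: (@le_trans _ _ (\int[mu]_(y in box c r) (((N * tau) `^ (P - 2))%:E *
    (cos_transform (part j) y ^+ 2 + sin_transform (part j) y ^+ 2)%:E)))%E.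
  apply: ge0_le_integral_nomeas => y _; first by rewrite lee_fin powR_ge0.
  rewrite -EFinM lee_fin powR_split//; apply: ler_pM; rewrite ?powR_ge0//.
    by apply: ge0_ler_powR; rewrite ?nnegrE// (le_trans _ (Tle y)).
  by rewrite real_normK ?num_real//; exact: sqr_trig_transform_le.
rewrite ge0_integralZl ?lee_fin ?powR_ge0//; last 3 first.
- by have [] := lebesgue_box c (ltW r0).
- apply/measurable_EFinP; apply: measurable_funTS; apply: measurable_funD;
    apply: measurable_funX; [exact: measurable_cos_transform|exact: measurable_sin_transform].
- by move=> y _; rewrite lee_fin addr_ge0 ?sqr_ge0.
have := local_L2_estimate (e := levels j) ip _ (@box_dist _ _ c r).
move=> /(_ (fun x => @block_part_out _ _ g m (levels j) x)) H2.
apply: (le_trans (lee_wpmul2l _ H2)); first by rewrite lee_fin powR_ge0.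
rewrite -/K -EFinM lee_fin mulrCA ler_wpM2l//.
apply: (le_trans (ler_wpM2l (powR_ge0 _ _) sq)).
have [N00|Npos] := eqVneq N 0.
  by rewrite N00 !mul0r mulr0 powR_ge0.
have Ngt0 : 0 < N by rewrite lt_neqAle eq_sym Npos.
have -> : M * relative_size j = N `^ (1 - P^-1) * tau.
  by rewrite /relative_size -/N /tau mulrCA.
have -> : N * tau ^+ 2 = (N * tau) ^+ 2 / N by field.
rewrite mulrA -powR_split ?(mulr_ge0 N0 (ltW tau0))//.
rewrite (powRM _ N0 (ltW tau0)) (powRM _ (powR_ge0 _ _) (ltW tau0)) mulrAC ler_pM2r ?powR_gt0//.
rewrite -powRrM mulrBl mul1r mulVf ?gt_eqF//.
by rewrite powRB ?powRr1 ?(ltW Ngt0)// (gt_eqF Ngt0) implybT.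
Qed.

(** The blocks are summed with [poweR_nneseries_le]: the decay (1+j)^-2 of their relative
    sizes beats the weights. *)
Lemma local_LP (c : Rn) :
  (\int[mu]_(y in box c r) (`|trig_transform w g y| `^ P)%:E <=
   ((4 * (4 * 128) `^ P * 144 ^+ n) * r ^+ n * M `^ P)%:E)%E.
Proof.
set K : R := 144 ^+ n * r ^+ n.
have K0 : 0 <= K by rewrite mulr_ge0// exprn_ge0// ltW.
have lw0 j : 0 <= (level_weight j)^-1 :> R by rewrite invr_ge0 ltW ?level_weight_gt0.
have mT j : measurable_fun (box c r) (fun y => (`|trig_transform w (part j) y| `^ P)%:E).
  apply/measurable_EFinP; apply: measurable_funTS.
  apply: (measurableT_comp (measurable_powR P)).
  apply: measurableT_comp => //; apply: (measurable_trig_transform hw).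
  exact: integrable_block_part.
have mbox : measurable (box c r) by have [] := lebesgue_box c (ltW r0).
apply: (@le_trans _ _ (\int[mu]_(y in box c r) ((4 `^ P)%:E *
   \sum_(j <oo) (((level_weight j)^-1 `^ P)%:E *
      (`|trig_transform w (part j) y| `^ P)%:E))))%E.
  apply: ge0_le_integral_nomeas => y _; first by rewrite lee_fin powR_ge0.
  have := trig_transform_le_blocks hw ig levels_disj levels_cover y.
  move=> /(ge0_le_poweR (ltW P0)); rewrite lee_fin normr_ge0 => /(_ isT).
  rewrite poweR_EFin => /le_trans; apply.
  have := @poweR_nneseries_le R (fun j => `|trig_transform w (part j) y|%:E)
    level_weight P 4 P0.
  apply => //.
  - by move=> j; rewrite level_weight_gt0.
  - exact: nneseries_level_weight_le.
have t0 j y : (0 <= ((level_weight j)^-1 `^ P)%:E *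
      (`|trig_transform w (part j) y| `^ P)%:E)%E.
  by rewrite -EFinM lee_fin mulr_ge0 ?powR_ge0.
have mt j : measurable_fun (box c r) (fun y => (((level_weight j)^-1 `^ P)%:E *
      (`|trig_transform w (part j) y| `^ P)%:E)%E).
  by apply: emeasurable_funM => //; exact: mT.
rewrite ge0_integralZl//; last 2 first.
- exact: ge0_emeasurable_sum.
- by move=> y _; apply: nneseries_ge0.
rewrite integral_nneseries//.
apply: (@le_trans _ _ ((4 `^ P)%:E * \sum_(j <oo) ((K * M `^ P * 128 `^ P)%:E * (level_weight j)%:E))%E).
  rewrite lee_wpmul2l ?lee_fin ?powR_ge0//.
  apply: lee_nneseries => j; first by move=> *; apply: integral_ge0.
  move=> _; rewrite ge0_integralZl ?lee_fin ?powR_ge0//.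
  apply: le_trans (lee_wpmul2l _ (integral_block_powR_le c j)) _.
    by rewrite lee_fin powR_ge0.
  rewrite -!EFinM lee_fin -/K.
  have /andP[s0 _] := relative_size_bound j.
  rewrite (powRM _ (ltW M0) s0) -[leRHS]mulrA.
  have H := level_weight_powR P2 (relative_size_bound j).
  apply: le_trans (ler_wpM2l _ H); last by rewrite mulr_ge0 ?powR_ge0.
  rewrite le_eqVlt; apply/orP; left; apply/eqP; ring.
rewrite nneseriesZl; last by move=> j _; rewrite lee_fin ltW ?level_weight_gt0.
have D0 : 0 <= K * M `^ P * 128 `^ P.
  by apply: mulr_ge0; rewrite ?powR_ge0//; apply: mulr_ge0; rewrite ?powR_ge0.
apply: le_trans (lee_wpmul2l _ (lee_wpmul2l _ nneseries_level_weight_le)) _.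
- by rewrite lee_fin powR_ge0.
- by rewrite lee_fin.
rewrite -!EFinM lee_fin /K powRM// le_eqVlt; apply/orP; left; apply/eqP; ring.
Qed.

(** Below the level M the integrand is at most M^p, and above it x^p is at most
    M^(p-P) x^P; this replaces Hoelder's inequality on the box. *)
Lemma local_Lp (p : R) (c : Rn) : 0 < p <= P ->
  (\int[mu]_(y in box c r) (`|trig_transform w g y| `^ p)%:E <=
   ((2 ^+ n + 4 * (4 * 128) `^ P * 144 ^+ n) * r ^+ n * M `^ p)%:E)%E.
Proof.
move=> /andP[p0 pP].
have [mbox boxE] := lebesgue_box c (ltW r0).
have mT q : measurable_fun (box c r) (fun y => (`|trig_transform w g y| `^ q)%:E).
  apply/measurable_EFinP; apply: measurable_funTS.
  apply: (measurableT_comp (measurable_powR q)).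
  by apply: measurableT_comp => //; exact: (measurable_trig_transform hw).
apply: (@le_trans _ _ (\int[mu]_(y in box c r) ((M `^ p)%:E + (M `^ (p - P))%:E *
    (`|trig_transform w g y| `^ P)%:E)))%E.
  apply: ge0_le_integral_nomeas => y _; first by rewrite lee_fin powR_ge0.
  rewrite -EFinM -EFinD lee_fin; set x := `|_|; have x0 : 0 <= x by rewrite normr_ge0.
  have [xM|Mx] := leP x M.
    apply: ler_wpDr; first by rewrite mulr_ge0 ?powR_ge0.
    by apply: ge0_ler_powR; rewrite ?nnegrE ?(ltW p0) ?(ltW M0).
  apply: ler_wpDl; first by rewrite powR_ge0.
  have xgt0 : 0 < x by exact: lt_trans Mx.
  have -> : x `^ p = x `^ (p - P) * x `^ P.
    by rewrite -powRD ?subrK// (gt_eqF xgt0) implybT.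
  rewrite ler_wpM2r ?powR_ge0//.
  have pPE : p - P = - (P - p) by rewrite opprB.
  rewrite pPE !powRN lef_pV2 ?posrE ?powR_gt0//.
  by apply: ge0_ler_powR; rewrite ?nnegrE ?subr_ge0 ?(ltW Mx) ?(ltW M0).
rewrite ge0_integralD//; last 3 first.
- by move=> y _; rewrite lee_fin powR_ge0.
- by move=> y _; rewrite mule_ge0 ?lee_fin ?powR_ge0.
- by apply: emeasurable_funM => //; exact: mT.
have -> : (\int[mu]_(_ in box c r) (M `^ p)%:E = (M `^ p * (2 * r) ^+ n)%:E)%E.
  have := integral_cst mu mbox (M `^ p)%:E => /= ->.
  by rewrite [X in (_ * X)%E]boxE.
rewrite ge0_integralZl ?lee_fin ?powR_ge0//.
apply: le_trans (leeD (lexx _) (lee_wpmul2l _ (local_LP c))) _.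
  by rewrite lee_fin powR_ge0.
rewrite -!EFinM -EFinD lee_fin.
have -> : M `^ p = M `^ (p - P) * M `^ P.
  by rewrite -powRD ?subrK// (gt_eqF M0) implybT.
rewrite exprMn le_eqVlt; apply/orP; left; apply/eqP; ring.
Qed.

End local_Lp.

(** * The Morrey norm of the Fourier transform *)

Section morrey_estimate.
Context {R : realType}.
Local Open Scope classical_set_scope.
Import ComplexField.Normc.

Lemma normc_le_add (z : R[i]) :
  normc z <= `|complex.Re z| + `|complex.Im z|.
Proof.
case: z => a b /=; rewrite -[leRHS]ger0_norm ?addr_ge0// -sqrtr_sqr.
rewrite ler_sqrt ?sqr_ge0// sqrrD !real_normK ?num_real// addrAC lerDl.
by rewrite mulrn_wge0// mulr_ge0.
Qed.

Lemma normr_Re_le_normc (z : R[i]) : `|complex.Re z| <= normc z.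
Proof.
by case: z => a b /=; rewrite -sqrtr_sqr ler_sqrt ?addr_ge0 ?sqr_ge0// lerDl sqr_ge0.
Qed.

Lemma normr_Im_le_normc (z : R[i]) : `|complex.Im z| <= normc z.
Proof.
by case: z => a b /=; rewrite -sqrtr_sqr ler_sqrt ?addr_ge0 ?sqr_ge0// lerDr sqr_ge0.
Qed.

Lemma normc_ge0 (z : R[i]) : 0 <= normc z.
Proof. by case: z => a b /=; rewrite sqrtr_ge0. Qed.

Lemma measurable_normc n (f : n.-tuple R -> R[i]) : cmeasurable f ->
  measurable_fun setT (fun x => normc (f x)).
Proof.
move=> [mRe mIm].
rewrite (_ : (fun x => _) = (fun x => ((complex.Re (f x)) ^+ 2 + (complex.Im (f x)) ^+ 2) `^ 2^-1)).
  apply: (measurableT_comp (measurable_powR _)).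
  by apply: measurable_funD; apply: measurable_funX.
apply/funext => x; rewrite powR12_sqrt ?addr_ge0 ?sqr_ge0//.
by case: (f x).
Qed.

Lemma cintegrable_cmeasurable n (f : n.-tuple R -> R[i]) :
  cintegrable f -> cmeasurable f.
Proof.
by move=> [i1 i2]; split; apply/measurable_EFinP; [exact: measurable_int i1|exact: measurable_int i2].
Qed.

Section fourier_components.
Context {n : nat} (f : n.-tuple R -> R[i]) (fi : cintegrable f).
Local Notation mu := (lebesgue_Rn R n).
Let g1 := @complex.Re R \o f.
Let g2 := @complex.Im R \o f.

Lemma Re_fourier y : complex.Re (fourier f y) = cos_transform g1 y + sin_transform g2 y.
Proof.
have [i1 i2] := fi.
rewrite /= /cos_transform /sin_transform -RintegralD//.
- apply: eq_Rintegral => x _; rewrite /g1 /g2 /=; case: (f x) => a b /=.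
  by rewrite cosN sinN; ring.
- exact: integrable_mul_cos.
- exact: integrable_mul_sin.
Qed.

Lemma Im_fourier y : complex.Im (fourier f y) = cos_transform g2 y - sin_transform g1 y.
Proof.
have [i1 i2] := fi.
rewrite /= /cos_transform /sin_transform -RintegralB//.
- apply: eq_Rintegral => x _; rewrite /g1 /g2 /=; case: (f x) => a b /=.
  by rewrite cosN sinN; ring.
- exact: integrable_mul_cos.
- exact: integrable_mul_sin.
Qed.

Lemma normc_fourier_powR_le (p : R) y : 0 <= p ->
  normc (fourier f y) `^ p <=
  4 `^ p * ((`|trig_transform cos g1 y| `^ p + `|trig_transform sin g2 y| `^ p) +
            (`|trig_transform cos g2 y| `^ p + `|trig_transform sin g1 y| `^ p)).
Proof.
move=> p0.
rewrite -[trig_transform cos g1 y]/(cos_transform g1 y).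
rewrite -[trig_transform sin g2 y]/(sin_transform g2 y).
rewrite -[trig_transform cos g2 y]/(cos_transform g2 y).
rewrite -[trig_transform sin g1 y]/(sin_transform g1 y).
apply: (@le_trans _ _ ((`|cos_transform g1 y| + `|sin_transform g2 y| +
   (`|cos_transform g2 y| + `|sin_transform g1 y|)) `^ p)).
  apply: ge0_ler_powR; rewrite ?nnegrE ?normc_ge0 ?addr_ge0//.
  apply: le_trans (normc_le_add _) _; rewrite Re_fourier Im_fourier.
  by apply: lerD; [exact: ler_normD|exact: ler_normB].
apply: le_trans (powR_add_le _ _ p0) _; rewrite ?addr_ge0//.
have -> : 4 `^ p = 2 `^ p * 2 `^ p :> R by rewrite -powRM// -natrM.
rewrite -mulrA ler_wpM2l ?powR_ge0// mulrDr.
by apply: lerD; apply: powR_add_le.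
Qed.

End fourier_components.

Lemma cube_mass_le_normc n (f : n.-tuple R -> R[i]) (g : n.-tuple R -> R) m
    (e : {fset n.-tuple int}) :
  (lebesgue_Rn R n).-integrable setT (EFin \o g) ->
  (forall x, `|g x| <= normc (f x)) ->
  ((\sum_(k <- e) cube_mass m g k)%:E <=
   \int[lebesgue_Rn R n]_(x in dcubes m e) (normc (f x))%:E)%E.
Proof.
move=> ig gf; rewrite sum_cube_mass//.
by apply: ge0_le_integral_nomeas => x _; rewrite lee_fin.
Qed.

(** The local estimate for the four real transforms that make up the Fourier transform. The
    logarithm may be used to the power 2 only, since n + 1 is at least 2. *)
Lemma scale_estimate n (p : R) : (1 <= n)%N -> 0 < p ->
  exists2 C : R, 0 < C & forall (f : n.-tuple R -> R[i]) (m : int) (M : R),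
  cintegrable f -> 0 < M ->
  (forall e : {fset n.-tuple int}, e != fset0 ->
    (\int[lebesgue_Rn R n]_(x in dcubes m e) (normc (f x))%:E <=
     (M * (#|` e|%:R `^ (Num.max p 2)^-1 / (1 + ln #|` e|%:R) ^+ n.+1))%:E)%E) ->
  forall c t, t <= (2 ^ m)^-1 ->
  (Lp_on p (eball c t) (fourier f) <=
   (C * ((2 ^ m)^-1) `^ (n%:R / p) * M)%:E)%E.
Proof.
move=> n1 p0; set P := Num.max p 2.
have P2 : 2 <= P by rewrite le_max lexx orbT.
have pP : 0 < p <= P by rewrite p0 le_max lexx.
pose C0 : R := 2 ^+ n + 4 * (4 * 128) `^ P * 144 ^+ n.
have C00 : 0 < C0.
  by rewrite ltr_wpDr ?exprn_gt0// !mulr_ge0 ?powR_ge0 ?exprn_ge0.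
pose K := 4 `^ p * (4 * C0).
have K0 : 0 < K by rewrite !mulr_gt0 ?powR_gt0.
exists (K `^ p^-1); first by rewrite powR_gt0.
move=> f m M fi M0 H c t tr; have [i1 i2] := fi.
set r := (2 ^ m)^-1 in tr *; have r0 : 0 < r by rewrite invr_gt0 exprz_gt0.
pose g1 := @complex.Re R \o f; pose g2 := @complex.Im R \o f.
have massM (g : n.-tuple R -> R) : (lebesgue_Rn R n).-integrable setT (EFin \o g) ->
    (forall x, `|g x| <= normc (f x)) -> forall e : {fset n.-tuple int}, e != fset0 ->
    \sum_(k <- e) cube_mass m g k <= M * (#|` e|%:R `^ P^-1 / (1 + ln #|` e|%:R) ^+ 2).
  move=> ig gf e e0; rewrite -lee_fin.
  apply: le_trans (cube_mass_le_normc _ _ ig gf) _.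
  apply: le_trans (H e e0) _; rewrite lee_fin ler_pM2l//.
  rewrite ler_wpM2l ?powR_ge0//.
  have L1 : 1 <= 1 + ln #|` e|%:R :> R by rewrite lerDl ln_ge0// ler1n cardfs_gt0.
  have L0 := lt_le_trans ltr01 L1.
  by rewrite lef_pV2 ?posrE ?exprn_gt0// ler_weXn2l// ltnS.
have T w g : (w = cos \/ w = sin) -> (lebesgue_Rn R n).-integrable setT (EFin \o g) ->
    (forall x, `|g x| <= normc (f x)) ->
    (\int[lebesgue_Rn R n]_(y in box c r) (`|trig_transform w g y| `^ p)%:E <=
     (C0 * r ^+ n * M `^ p)%:E)%E.
  by move=> hw ig gf; exact: (local_Lp hw ig P2 M0 (massM g ig gf) c pP).
have [mbox _] := lebesgue_box c (ltW r0).
have mT w g : (w = cos \/ w = sin) -> (lebesgue_Rn R n).-integrable setT (EFin \o g) ->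
    measurable_fun (box c r) (fun y => (`|trig_transform w g y| `^ p)%:E).
  move=> hw ig; apply/measurable_EFinP; apply: measurable_funTS.
  apply: (measurableT_comp (measurable_powR p)).
  by apply: measurableT_comp => //; exact: (measurable_trig_transform hw).
have f1 x : `|g1 x| <= normc (f x) by exact: normr_Re_le_normc.
have f2 x : `|g2 x| <= normc (f x) by exact: normr_Im_le_normc.
have hc : @cos R = cos \/ @cos R = sin by left.
have hs : @sin R = cos \/ @sin R = sin by right.
have T2 w g w' g' : (w = cos \/ w = sin) -> (w' = cos \/ w' = sin) ->
    (lebesgue_Rn R n).-integrable setT (EFin \o g) ->
    (lebesgue_Rn R n).-integrable setT (EFin \o g') ->
    (forall x, `|g x| <= normc (f x)) -> (forall x, `|g' x| <= normc (f x)) ->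
    (\int[lebesgue_Rn R n]_(y in box c r) ((`|trig_transform w g y| `^ p)%:E +
       (`|trig_transform w' g' y| `^ p)%:E) <=
     (C0 * r ^+ n * M `^ p + C0 * r ^+ n * M `^ p)%:E)%E.
  move=> hw hw' ig ig' gf gf'; rewrite (ge0_integralD _ mbox).
  - by rewrite EFinD; apply: leeD; apply: T.
  - by move=> y _; rewrite lee_fin powR_ge0.
  - exact: mT.
  - by move=> y _; rewrite lee_fin powR_ge0.
  - exact: mT.
have main : (\int[lebesgue_Rn R n]_(y in eball c t) ((normc (fourier f y))%:E `^ p) <=
    (K * r ^+ n * M `^ p)%:E)%E.
  apply: (@le_trans _ _ (\int[lebesgue_Rn R n]_(y in box c r) ((4 `^ p)%:E *
     ((((`|trig_transform cos g1 y| `^ p)%:E + (`|trig_transform sin g2 y| `^ p)%:E)) +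
      ((`|trig_transform cos g2 y| `^ p)%:E + (`|trig_transform sin g1 y| `^ p)%:E)))))%E.
    rewrite integral_mkcond [leRHS]integral_mkcond.
    apply: ge0_le_integral_nomeas => y _.
      by apply: erestrict_ge0 => z _; rewrite poweR_ge0.
    rewrite [leRHS]patchE; case: ifPn => [yb|yb].
      apply: le_trans (erestrict_le _ (poweR_ge0 _ _)) _.
      rewrite poweR_EFin -!EFinD -EFinM lee_fin.
      exact: (normc_fourier_powR_le fi y (ltW p0)).
    rewrite patchE memNset//; move: yb; rewrite notin_setE; apply: contra_not.
    exact: eball_sub_box.
  rewrite ge0_integralZl ?lee_fin ?powR_ge0//; last 2 first.
  - by do !apply: emeasurable_funD; apply: mT.
  - by move=> y _; rewrite -!EFinD lee_fin !addr_ge0 ?powR_ge0.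
  rewrite ge0_integralD//; last 4 first.
  - by move=> y _; rewrite -!EFinD lee_fin !addr_ge0 ?powR_ge0.
  - by apply: emeasurable_funD; apply: mT.
  - by move=> y _; rewrite -!EFinD lee_fin !addr_ge0 ?powR_ge0.
  - by apply: emeasurable_funD; apply: mT.
  have -> : K * r ^+ n * M `^ p = 4 `^ p * ((C0 * r ^+ n * M `^ p + C0 * r ^+ n * M `^ p) +
      (C0 * r ^+ n * M `^ p + C0 * r ^+ n * M `^ p)) by rewrite /K; ring.
  rewrite EFinM lee_wpmul2l ?lee_fin ?powR_ge0//.
  by rewrite EFinD; apply: leeD; apply: T2.
rewrite /Lp_on.
have -> : (K `^ p^-1 * r `^ (n%:R / p) * M)%:E = ((K * r ^+ n * M `^ p)%:E `^ p^-1)%E.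
  have rn0 : 0 <= r ^+ n by rewrite exprn_ge0// ltW.
  rewrite poweR_EFin (powRM _ (mulr_ge0 (ltW K0) rn0) (powR_ge0 _ _)).
  rewrite (powRM _ (ltW K0) rn0) -powR_mulrn ?(ltW r0)// -!powRrM.
  by rewrite mulfV ?gt_eqF// powRr1// ltW.
apply: ge0_le_poweR main; first by rewrite invr_ge0 ltW.
by apply: integral_ge0 => y _; rewrite poweR_ge0.
Qed.

(** This identity is why D_norm carries the exponent be: the two powers of the number of
    cubes combine to the power 1/P needed by the local estimate. *)
Lemma sigma_add_beta n (p lam : R) : (1 <= n)%N -> 0 < p ->
  D_exponent n p lam / n%:R + (p^-1 - lam / n%:R) = (Num.max p 2)^-1.
Proof.
move=> n1 p0; have n0 : n%:R != 0 :> R by rewrite pnatr_eq0 -lt0n.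
rewrite /D_exponent; have [p2|p2] := leP p 2.
  rewrite max_r; first by field; rewrite n0 gt_eqF.
  by rewrite subr_ge0 ler_wpM2l// lef_pV2 ?posrE.
rewrite max_l; first by field; rewrite n0 gt_eqF.
by rewrite subr_le0 ler_wpM2l// lef_pV2 ?posrE ?(ltW p2).
Qed.

Definition D_sup n (p lam : R) (f : n.-tuple R -> R[i]) (m : int) : \bar R :=
  ereal_sup
    [set ((D_weight p lam m e)%:E *
          \int[lebesgue_Rn R n]_(x in dcubes m e) (normc (f x))%:E)%E
       | e in [set e : {fset n.-tuple int} | e != fset0%fset]].

Lemma D_normE n p q lam (f : n.-tuple R -> R[i]) :
  D_norm p q lam f = lqZ q (D_sup p lam f).
Proof. by []. Qed.

Lemma one_add_ln_gt0 n (e : {fset n.-tuple int}) : e != fset0 ->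
  0 < 1 + ln #|` e|%:R :> R.
Proof. by move=> e0; rewrite ltr_wpDr// ln_ge0// ler1n cardfs_gt0. Qed.

Lemma D_weightE n (p lam : R) m (e : {fset n.-tuple int}) :
  D_weight p lam m e = (1 + ln #|` e|%:R) ^+ n.+1 / #|` e|%:R `^ (D_exponent n p lam / n%:R) /
    (#|` e|%:R `^ (p^-1 - lam / n%:R) * ((2 ^ m) ^+ n) `^ (p^-1 - lam / n%:R)).
Proof.
rewrite /D_weight [X in fine X]lebesgue_dcubes /= powRM//.
by rewrite exprn_ge0// exprz_ge0.
Qed.

Lemma D_weight_gt0 n (p lam : R) m (e : {fset n.-tuple int}) : e != fset0 ->
  0 < D_weight p lam m e.
Proof.
move=> e0; have N0 : 0 < #|` e|%:R :> R by rewrite ltr0n cardfs_gt0.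
rewrite D_weightE !divr_gt0 ?mulr_gt0 ?powR_gt0 ?exprn_gt0 ?exprz_gt0//.
exact: one_add_ln_gt0.
Qed.

Lemma D_sup_ge0 n (p lam : R) (f : n.-tuple R -> R[i]) m : (0 <= D_sup p lam f m)%E.
Proof.
pose k : n.-tuple int := [tuple 0 | i < n].
have k0 : [fset k]%fset != fset0 by rewrite -cardfs_gt0 cardfs1.
apply: le_trans (ereal_sup_ubound _); last by exists [fset k]%fset => //; reflexivity.
rewrite mule_ge0 ?lee_fin ?(ltW (D_weight_gt0 _ _ _ _))//.
by apply: integral_ge0 => x _; rewrite lee_fin normc_ge0.
Qed.

(** At radii between 2^l and 2^(l+1) the local estimate is used with cubes of side
    2^-(l+1), and the powers of the radius cancel because of the value of sg. *)
Theorem morrey_fourier_le n (p : R) (q : \bar R) (lam : R) :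
  (1 <= n)%N -> 0 < p -> (0 < q)%E -> 0 <= lam ->
  exists2 C : R, 0 < C & forall f : n.-tuple R -> R[i], cintegrable f ->
    (morrey p q lam (fourier f) <= C%:E * D_norm p q lam f)%E.
Proof.
move=> n1 p0 q0 lam0; have [C C0 HC] := scale_estimate n1 p0.
have n0 : n%:R != 0 :> R by rewrite pnatr_eq0 -lt0n.
pose sg := p^-1 - lam / n%:R; pose B := 2 `^ lam * C.
have B0 : 0 < B by rewrite mulr_gt0 ?powR_gt0.
exists B => // f fi; rewrite D_normE.
(* the scale of the cubes that are paired with radii in the l-th dyadic interval *)
pose e (l : int) := - (l + 1).
have ei : injective e by move=> l l' /oppr_inj /addIr.
apply: (@le_trans _ _ (lqZ q (fun l => B%:E * D_sup p lam f (e l))))%E; last first.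
  rewrite (lqZ_scale (a := fun l => D_sup p lam f (e l)) q0 B0); last first.
    by move=> l; exact: D_sup_ge0.
  apply: lee_wpmul2l; first by rewrite lee_fin ltW.
  exact: (@lqZ_comp_inj R q (D_sup p lam f) e q0 ei (fun m => D_sup_ge0 p lam f m)).
have Lp0 t c : (0 <= Lp_on p (eball c t) (fourier f))%E by exact: poweR_ge0.
have sup0 t : (0 <= ereal_sup [set Lp_on p (eball x t) (fourier f) | x in [set: n.-tuple R]])%E.
  pose z : n.-tuple R := [tuple 0 | i < n].
  by apply: le_trans (Lp0 t z) _; apply: ereal_sup_ubound; exists z.
apply: Lq_dt_t_le_lqZ => //.
- by move=> t; rewrite mule_ge0// lee_fin powR_ge0.
- by move=> l; rewrite mule_ge0 ?D_sup_ge0// lee_fin ltW.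
move=> l t /andP[lt tl]; set m := e l; set A := D_sup p lam f m.
have A0 : (0 <= A)%E by exact: D_sup_ge0.
pose r : R := 2 ^ (l + 1).
have r0 : 0 < r by rewrite exprz_gt0.
have rE : (2 ^ m)^-1 = r by rewrite /m /e invr_expz opprK.
have t0 : 0 < t by apply: lt_le_trans lt; rewrite exprz_gt0.
have [AE|Afin] := eqVneq A +oo%E.
  by rewrite AE gt0_muley ?leey// lte_fin.
have {Afin} AE : A = (fine A)%:E by rewrite fineK// ge0_fin_numE// ltey.
set al := fine A in AE; have al0 : 0 <= al by rewrite fine_ge0.
(* the local estimate needs a positive mass bound, hence the slack eps when A = 0 *)
rewrite AE -EFinM; apply/lee_addgt0Pr => eps eps0.
pose al' := al + eps / B.
have al'0 : 0 < al' by rewrite ltr_wpDl// divr_gt0.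
have -> : ((B * al)%:E + eps%:E = (B * al')%:E)%E.
  by rewrite -EFinD /al' mulrDr mulrCA mulfV ?gt_eqF// mulr1.
pose M := al' * ((2 ^ m) ^+ n) `^ sg.
have twom0 : 0 < ((2 : R) ^ m) ^+ n by rewrite exprn_gt0// exprz_gt0.
have M0 : 0 < M by rewrite mulr_gt0 ?powR_gt0.
have hyp : forall e : {fset n.-tuple int}, e != fset0 ->
    (\int[lebesgue_Rn R n]_(x in dcubes m e) (normc (f x))%:E <=
     (M * (#|` e|%:R `^ (Num.max p 2)^-1 / (1 + ln #|` e|%:R) ^+ n.+1))%:E)%E.
  move=> E E0; have N0 : 0 < #|` E|%:R :> R by rewrite ltr0n cardfs_gt0.
  have L0 := one_add_ln_gt0 E0.
  have W0 := D_weight_gt0 p lam m E0.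
  have : ((D_weight p lam m E)%:E *
      \int[lebesgue_Rn R n]_(x in dcubes m E) (normc (f x))%:E <= al'%:E)%E.
    apply: (@le_trans _ _ A); first by apply: ereal_sup_ubound; exists E.
    by rewrite AE lee_fin /al' lerDl divr_ge0 ?ltW.
  rewrite -lee_pdivlMl// => /le_trans; apply; rewrite -EFinM lee_fin.
  rewrite le_eqVlt; apply/orP; left; apply/eqP.
  rewrite -(sigma_add_beta lam n1 p0) D_weightE /M -/sg.
  rewrite [_ `^ (D_exponent n p lam / n%:R + sg)]powRD; last first.
    by rewrite (gt_eqF N0) implybT.
  have h1 : #|` E|%:R `^ (D_exponent n p lam / n%:R) != 0 by rewrite gt_eqF// powR_gt0.
  have h2 : #|` E|%:R `^ sg != 0 by rewrite gt_eqF// powR_gt0.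
  have h3 : ((2 ^ m) ^+ n) `^ sg != 0 by rewrite gt_eqF// powR_gt0.
  have h4 : (1 + ln (#|` E|%:R : R)) ^+ n.+1 != 0 by exact: (lt0r_neq0 (exprn_gt0 _ L0)).
  by field; rewrite h1 h2 h3 h4.
have sup_le : (ereal_sup [set Lp_on p (eball x t) (fourier f) | x in [set: n.-tuple R]] <=
    (C * r `^ (n%:R / p) * M)%:E)%E.
  apply: ge_ereal_sup => _ [c _ <-]; rewrite -rE; apply: HC => //.
  by rewrite rE ltW.
apply: le_trans (lee_wpmul2l _ sup_le) _; first by rewrite lee_fin powR_ge0.
rewrite -EFinM lee_fin.
have tle : t `^ (- lam) <= 2 `^ lam * r `^ (- lam).
  have -> : 2 `^ lam * r `^ (- lam) = (2 ^ l) `^ (- lam).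
    rewrite /r expfzDr ?pnatr_eq0// powRM ?exprz_ge0// mulrCA !powRN mulfV ?mulr1//.
  rewrite !powRN lef_pV2 ?posrE ?powR_gt0 ?exprz_gt0//.
  by apply: ge0_ler_powR; rewrite ?nnegrE ?exprz_ge0 ?(ltW t0).
apply: le_trans (ler_wpM2r _ tle) _.
  exact: mulr_ge0 (mulr_ge0 (ltW C0) (powR_ge0 _ _)) (ltW M0).
have ME : M = al' * r `^ (- (n%:R / p) + lam).
  rewrite /M; congr (_ * _); rewrite -(invrK (2 ^ m)) rE exprVn.
  rewrite -powR_inv1 ?exprn_ge0 ?(ltW r0)// -powR_mulrn ?(ltW r0)// -!powRrM.
  by congr (_ `^ _); rewrite /sg; field; rewrite n0 gt_eqF.
rewrite ME le_eqVlt; apply/orP; left; apply/eqP.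
have rr : r `^ (- lam) * r `^ (n%:R / p) * r `^ (- (n%:R / p) + lam) = 1.
  rewrite -!powRD ?(gt_eqF r0) ?implybT//.
  by rewrite (_ : _ + _ = 0) ?powRr0//; ring.
transitivity (2 `^ lam * C * al' * (r `^ (- lam) * r `^ (n%:R / p) * r `^ (- (n%:R / p) + lam))).
  ring.
by rewrite rr mulr1.
Qed.

End morrey_estimate.

(** * The norm D and the decreasing rearrangement *)

Section rearrangement_estimate.
Context {R : realType}.
Local Open Scope classical_set_scope.
Import ComplexField.Normc.

(** Almost every point of F leaves the sets where g exceeds r i at a first index i, and there
    g is at most r i; this index costs at most measure tau i. *)
Lemma integral_le_layers d (T : measurableType d) (mu : {measure set T -> \bar R})
    (F : set T) (g : T -> R) (r tau : nat -> R) :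
  measurable F -> measurable_fun setT g -> (forall x, 0 <= g x) ->
  (forall i, 0 <= r i) -> (mu F <= (tau 0%N)%:E)%E ->
  (forall i, (mu [set x | r i < g x]%R <= (tau i.+1)%:E)%E) ->
  tau @ \oo --> (0 : R) ->
  (\int[mu]_(x in F) (g x)%:E <= \sum_(0 <= i <oo) (r i * tau i)%:E)%E.
Proof.
move=> mF mg g0 r0 muF mur tau0.
pose G i := if i is j.+1 then F `&` [set x | r j < g x] else F.
have mset (c : R) : measurable [set x | c < g x].
  have -> : [set x | c < g x] = g @^-1` `]c, +oo[.
    by apply/seteqP; split=> x /=; rewrite in_itv/= andbT.
  by rewrite -[X in measurable X]setTI; exact: mg.
have mG i : measurable (G i) by case: i => [//|j]; exact: measurableI.
have muG i : (mu (G i) <= (tau i)%:E)%E.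
  case: i => [//|j]; apply: le_trans (mur j).
  by apply: le_measure; rewrite ?inE// => x [].
have GF i : G i `<=` F by case: i => [//|j] x [].
have mind i : measurable_fun F (fun x => (r i * \1_(G i) x)%:E).
  apply/measurable_EFinP; exact: measurable_funM.
have ind0 i x : (0 <= (r i * \1_(G i) x)%:E)%E.
  by rewrite lee_fin mulr_ge0.
apply: (@le_trans _ _ (\int[mu]_(x in F) \sum_(0 <= i <oo) (r i * \1_(G i) x)%:E)%E).
  apply: ae_ge0_le_integral => //.
  - by move=> x _; rewrite lee_fin.
  - by apply/measurable_EFinP; exact: measurable_funTS.
  - by move=> x _; apply: nneseries_ge0 => i _ _; exact: ind0.
  - by apply: ge0_emeasurable_sum => [i x _ _|i _]; [exact: ind0|exact: mind].
  exists (\bigcap_i G i); split.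
  - by apply: bigcapT_measurable => i; exact: mG.
  - apply/eqP; rewrite -measure_le0; apply/lee_addgt0Pr => e e0; rewrite add0e.
    have [N _ HN] := cvgr_lt _ tau0 _ e0.
    apply: (@le_trans _ _ (mu (G N))).
      apply: le_measure; rewrite ?inE//; first exact: bigcapT_measurable.
      by move=> x; apply.
    by apply: le_trans (muG N) _; rewrite lee_fin ltW// HN/=.
  move=> x /= xN; apply: contrapT => xG; apply: xN => Fx.
  have exG : exists i, `[< ~ G i x >].
    apply: contrapT => H; apply: xG => i _; apply: contrapT => Gi.
    by apply: H; exists i; apply/asboolP.
  have [[|j] /asboolP Gj jmin] := ex_minnP exG.
    by exfalso; exact: Gj.
  have Gjx : G j x.
    apply: contrapT => H; have := jmin j; rewrite ltnn => /(_ _) K.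
    by have : false by apply: K; apply/asboolP.
  apply: (@le_trans _ _ (r j)%:E).
    rewrite lee_fin leNgt; apply/negP => rg; apply: Gj; split=> //.
  have -> : ((r j)%:E = (r j * \1_(G j) x)%:E)%E.
    by rewrite indicE mem_set//= mulr1.
  apply: le_trans (nneseries_lim_ge j.+1 _); last by move=> i _ _; exact: ind0.
  by rewrite big_nat_recr//= leeDr// sume_ge0// => i _; exact: ind0.
rewrite integral_nneseries//.
apply: lee_nneseries => [i _ _|i _].
  by apply: integral_ge0 => x _; exact: ind0.
under eq_integral do rewrite EFinM.
rewrite ge0_integralZl_EFin//; last first.
  by apply/measurable_EFinP; exact: measurable_indic.
rewrite integral_indic// setIidl// EFinM lee_wpmul2l// lee_fin.
exact: r0.
Qed.

Lemma rearrangement_ge0 n (f : n.-tuple R -> R[i]) t : (0 <= rearrangement f t)%E.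
Proof.
by apply: le_ereal_inf_tmp => _ [s [s0 _] <-]; rewrite lee_fin.
Qed.

Lemma rearrangement_antitone n (f : n.-tuple R -> R[i]) t t' : t <= t' ->
  (rearrangement f t' <= rearrangement f t)%E.
Proof.
move=> tt'; apply: le_ereal_inf => _ [s [s0 st] <-]; exists s => //; split=> //.
by apply: le_trans st _; rewrite lee_fin.
Qed.

Lemma measurable_gt n (f : n.-tuple R -> R[i]) (c : R) : cmeasurable f ->
  measurable [set x | c < normc (f x)].
Proof.
move=> /measurable_normc mg.
have -> : [set x | c < normc (f x)] = (fun x => normc (f x)) @^-1` `]c, +oo[.
  by apply/seteqP; split=> x /=; rewrite in_itv/= andbT.
by rewrite -[X in measurable X]setTI; exact: mg.
Qed.

(** The infimum that defines the rearrangement is attained, by continuity of the measure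
    from below. *)
Lemma measure_gt_rearrangement_le n (f : n.-tuple R -> R[i]) (t r : R) :
  cmeasurable f -> (rearrangement f t <= r%:E)%E ->
  (lebesgue_Rn R n [set x | r < normc (f x)]%R <= t%:E)%E.
Proof.
move=> mf Rr; pose F k : set (n.-tuple R) := [set x | r + k.+1%:R^-1 < normc (f x)].
have mF k : measurable (F k) by exact: measurable_gt.
have FE : \bigcup_k F k = [set x | r < normc (f x)].
  apply/seteqP; split=> [x [k _] /=|x /= rx].
    by apply: lt_trans; rewrite ltrDl invr_gt0.
  by have [k Hk] := ltr_add_invr rx; exists k.
have FS : {homo F : k l / (k <= l)%N >-> (k <= l)%O}.
  move=> k l kl; apply/subsetPset => x; apply: le_lt_trans.
  by rewrite lerD2l lef_pV2 ?posrE// ler_nat ltnS.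
have cF := nondecreasing_cvg_mu (mu := lebesgue_Rn R n) mF
  (bigcupT_measurable _ mF) FS.
rewrite -FE -(cvg_lim _ cF)//; apply: lime_le; first by apply/cvg_ex; eexists; exact: cF.
apply: nearW => k /=.
have [_ [s [s0 st] <-] sr] : exists2 y, [set s%:E | s in [set s : R | 0 <= s /\
      (lebesgue_Rn R n [set x | (s < normc (f x))%R] <= t%:E)%E]] y &
    (y < (r + k.+1%:R^-1)%:E)%E.
  by apply: ereal_inf_lt; apply: le_lt_trans Rr _; rewrite lte_fin ltrDl invr_gt0.
apply: le_trans st; apply: le_measure; rewrite ?inE//; first exact: measurable_gt.
by move=> x /=; apply: lt_trans; rewrite -lte_fin.
Qed.

(** With sg = 1/s, the value at t = 2^l of the function whose L_q(dt/t) norm is the Lorentz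
    norm. *)
Definition dyadic_rearrangement n (sg : R) (f : n.-tuple R -> R[i]) (l : int) : \bar R :=
  ((2 `^ (l%:~R * (1 - sg)))%:E * rearrangement f (2 ^ l))%E.

Lemma dyadic_rearrangement_ge0 n sg (f : n.-tuple R -> R[i]) l :
  (0 <= dyadic_rearrangement sg f l)%E.
Proof. by rewrite mule_ge0 ?rearrangement_ge0// lee_fin powR_ge0. Qed.

(** [integral_le_layers] with levels R(2^(m+nu-i)) produces the series of
    2^((m+nu-i) sg) b_(m+nu-i). The bound on the damped b costs a factor 2^(kap (nu+i)), and
    the series in i still converges since kap < sg. *)
Lemma integral_dcubes_le_rearrangement n (sg kap : R) : 0 < kap -> kap < sg ->
  exists2 K : R, 0 < K & forall (f : n.-tuple R -> R[i]) (m : int) (a : R)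
    (nu : nat) (F : set (n.-tuple R)),
    cmeasurable f -> 0 <= a ->
    (forall j : int, ((((2 `^ (- kap)) ^+ `|j|%N)%:E *
      dyadic_rearrangement sg f (m + j)%R) <= a%:E)%E) ->
    measurable F -> (lebesgue_Rn R n F <= (2 ^ (m + nu%:Z + 1))%:E)%E ->
    (\int[lebesgue_Rn R n]_(x in F) (normc (f x))%:E <=
      (K * a * (2 ^+ nu) `^ kap * (2 ^+ nu) `^ sg * (2 ^ m) `^ sg)%:E)%E.
Proof.
move=> kap0 kapsg.
pose z : R := 2 `^ (kap - sg).
have z0 : 0 <= z by exact: powR_ge0.
have z1 : z < 1.
  by apply: powR2_lt1; lra.
have := nneseries_geometric_lty (introT andP (conj z0 z1)).
set S := (X in (X < _)%E) => Slty.
have S0 : (0 <= S)%E by apply: nneseries_ge0 => i _ _; rewrite lee_fin exprn_ge0.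
have SE : S = (fine S)%:E by rewrite fineK// ge0_fin_numE.
exists (2 * (fine S + 1)); first by rewrite mulr_gt0// ltr_wpDl// fine_ge0.
move=> f m a nu F mf a0 Ha mF muF.
pose x : R := m%:~R + nu%:R.
have tE (l : int) : 2 ^ l = 2 `^ l%:~R :> R by rewrite powR_intmul.
pose r i : R := a * 2 `^ (kap * (nu%:R + i%:R)) * 2 `^ (- (x - i%:R) * (1 - sg)).
pose tau i : R := 2 `^ (x + 1 - i%:R).
have r0 i : 0 <= r i by rewrite /r !mulr_ge0 ?powR_ge0.
have tau0 : tau @ \oo --> (0 : R).
  have -> : tau = geometric (2 `^ (x + 1)) 2^-1.
    apply/funext => i; rewrite /tau /= powR2D powRN powR_mulrn// exprVn.
    by [].
  by apply: cvg_geometric; rewrite ger0_norm ?invr_ge0// invf_lt1// ltr1n.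
have mur i : (lebesgue_Rn R n [set y | r i < normc (f y)]%R <= (tau i.+1)%:E)%E.
  have -> : tau i.+1 = 2 ^ (m + (nu%:Z - i%:Z)).
    rewrite tE /tau /x; congr (_ `^ _).
    by rewrite !rmorphD/= rmorphN/= -!pmulrn -(natr1 i); ring.
  apply: measure_gt_rearrangement_le => //.
  have := Ha (nu%:Z - i%:Z); set l := m + _; rewrite /dyadic_rearrangement muleA -EFinM.
  have c0 : 0 < (2 `^ (- kap)) ^+ `|nu%:Z - i%:Z|%N * 2 `^ (l%:~R * (1 - sg)).
    by rewrite mulr_gt0 ?exprn_gt0 ?powR_gt0.
  rewrite -lee_pdivlMl// => /le_trans; apply; rewrite -EFinM lee_fin.
  rewrite mulrC ler_pdivrMr// /r.
  have lE : l%:~R = x - i%:R :> R.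
    by rewrite /l /x !rmorphD/= rmorphN/= -!pmulrn; ring.
  rewrite lE -!mulrA ler_peMr// powR2X -!powR2D -[leLHS](powRr0 2).
  apply: ler_powR; first by rewrite ler1n.
  have jle : `|nu%:Z - i%:Z|%N%:R <= nu%:R + i%:R :> R.
    by rewrite -natrD ler_nat; lia.
  have := ler_wpM2l (ltW kap0) jle.
  by rewrite mulNr -subr_ge0 => H; nra.
have muF' : (lebesgue_Rn R n F <= (tau 0%N)%:E)%E.
  have -> : tau 0%N = 2 ^ (m + nu%:Z + 1); last exact: muF.
  rewrite tE /tau /x; congr (_ `^ _).
  by rewrite !rmorphD/= -!pmulrn; ring.
have mg := measurable_normc mf.
apply: le_trans (integral_le_layers mF mg (fun y => normc_ge0 (f y)) r0 muF' mur tau0) _.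
pose B := 2 * a * (2 ^+ nu) `^ kap * (2 ^+ nu) `^ sg * (2 ^ m) `^ sg.
have B0 : 0 <= B by rewrite /B !mulr_ge0 ?powR_ge0.
have -> : (\sum_(0 <= i <oo) (r i * tau i)%:E = B%:E * S)%E.
  rewrite /S -nneseriesZl; last by move=> i _; rewrite lee_fin exprn_ge0.
  apply: eq_eseriesr => i _; rewrite -EFinM; congr (_%:E).
  rewrite /r /tau /B /z powR2X -(powR_mulrn nu)// tE -!powRrM.
  have E1 : 2 `^ (x + 1 - i%:R) = 2 * 2 `^ (x - i%:R) :> R.
    by rewrite -[X in X * _](powRr1 (ler0n _ 2)) -powR2D; congr (_ `^ _); ring.
  rewrite E1.
  transitivity (2 * a * (2 `^ (kap * (nu%:R + i%:R)) * 2 `^ (- (x - i%:R) * (1 - sg)) *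
    2 `^ (x - i%:R))); first by ring.
  rewrite -!mulrA -!powR2D; congr (_ * (_ * _ `^ _)).
  by rewrite /x; ring.
rewrite SE -EFinM lee_fin.
have -> : 2 * (fine S + 1) * a * (2 ^+ nu) `^ kap * (2 ^+ nu) `^ sg * (2 ^ m) `^ sg =
  B * (fine S + 1) by rewrite /B; ring.
by rewrite ler_wpM2l// lerDl.
Qed.

(** The factors lost in the number N of cubes are N^kap from the damping and N^kap from
    the logarithms, which the weight N^(-be) pays for when 2 kap <= be. *)
Lemma D_sup_le_rearrangement n (p lam kap : R) :
  (1 <= n)%N -> 0 < p -> 0 < kap -> kap < p^-1 - lam / n%:R ->
  kap * 2 <= D_exponent n p lam / n%:R ->
  exists2 C : R, 0 < C & forall (f : n.-tuple R -> R[i]) (m : int), cmeasurable f ->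
    (D_sup p lam f m <= C%:E * ereal_sup (range (fun j : int =>
      ((2 `^ (- kap)) ^+ `|j|%N)%:E *
      dyadic_rearrangement (p^-1 - lam / n%:R) f (m * n%:Z + j)%R)))%E.
Proof.
move=> n1 p0 kap0; set sg := _ - _; set be := _ / _ => kapsg kapbe.
have [K K0 HK] := integral_dcubes_le_rearrangement n kap0 kapsg.
have [C C0 HC] := one_add_ln_exp_le n.+1 kap0.
exists (C * K); first exact: mulr_gt0.
move=> f m mf; set A := ereal_sup _.
have A_ub j : (((2 `^ (- kap)) ^+ `|j|%N)%:E *
    dyadic_rearrangement sg f (m * n%:Z + j)%R <= A)%E.
  by apply: ereal_sup_ubound; exists j.
have A0 : (0 <= A)%E.
  apply: le_trans (A_ub 0); apply: mule_ge0; last exact: dyadic_rearrangement_ge0.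
  by rewrite lee_fin exprn_ge0// powR_ge0.
have [AE|Afin] := eqVneq A +oo%E.
  by rewrite AE gt0_muley ?leey// lte_fin mulr_gt0.
have {Afin} AE : A = (fine A)%:E by rewrite fineK// ge0_fin_numE// ltey.
set a := fine A in AE; have a0 : 0 <= a by rewrite fine_ge0.
rewrite AE in A_ub *.
apply: ge_ereal_sup => _ [e e0 <-].
have Nn : (0 < #|` e|)%N by rewrite cardfs_gt0.
set N : R := #|` e|%:R; have N1 : 1 <= N by rewrite ler1n.
have N0 : 0 < N by exact: lt_le_trans N1.
pose nu := trunc_log 2 #|` e|.
have nuN : 2 ^+ nu <= N by rewrite -natrX ler_nat trunc_logP.
have Nnu : N <= 2 ^+ nu.+1 by rewrite -natrX ler_nat ltnW// trunc_log_ltn.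
have mnE : (2 : R) ^ (m * n%:Z) = (2 ^ m) ^+ n by rewrite -exprz_exp.
have two0 : (2 : R) != 0 by rewrite pnatr_eq0.
have muF : (lebesgue_Rn R n (dcubes m e) <= (2 ^ (m * n%:Z + nu%:Z + 1))%:E)%E.
  rewrite [leLHS]lebesgue_dcubes lee_fin -addrA expfzDr// mnE mulrC.
  rewrite ler_wpM2l ?exprn_ge0 ?exprz_ge0//.
  by apply: le_trans Nnu _; rewrite -PoszD addn1.
have := HK f (m * n%:Z) a nu (dcubes m e) mf a0 A_ub (@measurable_dcubes R n m e) muF.
have W0 := D_weight_gt0 p lam m e0.
move=> /(lee_wpmul2l (x := (D_weight p lam m e)%:E)) H.
apply: le_trans (H _) _; first by rewrite lee_fin ltW.
rewrite -!EFinM lee_fin D_weightE mnE -/sg -/be -/N.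
set W := ((2 ^ m) ^+ n) `^ sg.
have Wgt0 : 0 < W by rewrite powR_gt0// exprn_gt0// exprz_gt0.
have h1 : (2 ^+ nu) `^ kap <= N `^ kap.
  by apply: ge0_ler_powR; rewrite ?nnegrE ?exprn_ge0 ?(ltW N0) ?(ltW kap0).
have h2 : (2 ^+ nu) `^ sg <= N `^ sg.
  by apply: ge0_ler_powR; rewrite ?nnegrE ?exprn_ge0 ?(ltW N0) ?(ltW (lt_trans kap0 kapsg)).
have h3 := HC N N1.
have h4 : N `^ kap * N `^ kap <= N `^ be.
  rewrite -powRD ?(gt_eqF N0) ?implybT//; apply: ler_powR => //.
  by move: kapbe; lra.
have pN x : 0 < N `^ x by exact: powR_gt0.
have q0 : 0 <= (2 ^+ nu) `^ kap by exact: powR_ge0.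
have q1 : 0 <= (2 ^+ nu) `^ sg by exact: powR_ge0.
move: (pN kap) (pN sg) (pN be) h1 h2 h3 h4 q0 q1.
have L0 : 0 <= (1 + ln N) ^+ n.+1 by rewrite exprn_ge0// addr_ge0// ln_ge0.
move: L0; move: (N `^ kap) (N `^ sg) (N `^ be) ((2 ^+ nu) `^ kap) ((2 ^+ nu) `^ sg)
  ((1 + ln N) ^+ n.+1) => u v w u' v' L L0 u0 v0 w0 uu vv Lu uw u'0 v'0.
have -> : L / w / (v * W) * (K * a * u' * v' * W) = (L * u' * (v' / v) / w) * (K * a).
  by field; rewrite !gt_eqF.
have -> : C * K * a = C * (K * a) by ring.
rewrite ler_wpM2r//; first by rewrite mulr_ge0// ltW.
rewrite ler_pdivrMr//; apply: (@le_trans _ _ (C * (u * u))).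
  apply: (@le_trans _ _ (L * u')).
    by rewrite ler_piMr ?mulr_ge0// ler_pdivrMr// mul1r.
  by rewrite mulrA ler_pM.
by rewrite ler_wpM2l// ltW.
Qed.

(** Only the dyadic values at multiples of n occur, so the l_q norm over scales is dominated by
    the one over all integers. *)
Theorem D_norm_le_lorentz n (p : R) (q : \bar R) (lam s' : R) :
  (1 <= n)%N -> 0 < p -> (0 < q)%E -> 0 < p^-1 - lam / n%:R ->
  0 < D_exponent n p lam -> s'^-1 = 1 - (p^-1 - lam / n%:R) ->  0 <= s'^-1 ->
  exists2 C : R, 0 < C & forall f : n.-tuple R -> R[i], cintegrable f ->
    (D_norm p q lam f <= C%:E * lorentz s' q f)%E.
Proof.
move=> n1 p0 q0; set sg := _ - _ => sg0 be0 s'E s'0.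
have nR0 : 0 < n%:R :> R by rewrite ltr0n.
pose be := D_exponent n p lam / n%:R; have be0' : 0 < be by exact: divr_gt0.
pose kap := Num.min sg be / 2.
have mn0 : 0 < Num.min sg be by rewrite lt_min sg0 be0'.
have kap0 : 0 < kap by rewrite divr_gt0.
have kapsg : kap < sg.
  by apply: (@lt_le_trans _ _ (Num.min sg be)); rewrite /kap ?ge_min ?lexx//; lra.
have kapbe : kap * 2 <= be by rewrite /kap divfK ?pnatr_eq0// ge_min lexx orbT.
have [C1 C10 H1] := D_sup_le_rearrangement n1 p0 kap0 kapsg kapbe.
have x01 : 0 < (2 : R) `^ (- kap) < 1.
  by rewrite powR_gt0//=; apply: powR2_lt1; lra.
have [C2 C20 H2] := lqZ_sup_translates q0 x01.
have [C3 C30 H3] := lqZ_le_Lq_dt_t (R := R) q0.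
pose c : R := 2 `^ (1 - sg); have c0 : 0 < c by exact: powR_gt0.
exists (C1 * (C2 * (c * C3))); first by rewrite !mulr_gt0.
move=> f /cintegrable_cmeasurable mf; rewrite D_normE.
pose b := dyadic_rearrangement sg f.
have b0 l : (0 <= b l)%E by exact: dyadic_rearrangement_ge0.
pose A l := ereal_sup (range (fun j : int => (((2 `^ (- kap)) ^+ `|j|%N)%:E * b (l + j)%R)%E)).
have A0 l : (0 <= A l)%E.
  apply: (@le_trans _ _ (((2 `^ (- kap)) ^+ `|0|%N)%:E * b (l + 0)%R)%E).
    by rewrite mule_ge0// lee_fin exprn_ge0// powR_ge0.
  by apply: ereal_sup_ubound; exists 0.
pose e (m : int) := m * n%:Z.
have ei : injective e.
  by move=> m m' /mulIf; apply; move: n1; case: (n).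
apply: (@le_trans _ _ (lqZ q (fun m => C1%:E * A (e m))%E)).
  by apply: le_lqZ => // m; [exact: D_sup_ge0|exact: H1].
rewrite (lqZ_scale (a := fun m => A (e m)) q0 C10); last by move=> m; exact: A0.
rewrite EFinM -muleA; apply: lee_wpmul2l; first by rewrite lee_fin ltW.
apply: le_trans (@lqZ_comp_inj R q A e q0 ei A0) _.
apply: le_trans (H2 b b0) _.
rewrite EFinM -muleA; apply: lee_wpmul2l; first by rewrite lee_fin ltW.
(* on the m-th dyadic interval R is bounded below by its value at the right endpoint *)
pose a m := (c^-1%:E * b (m + 1)%R)%E.
have a0 m : (0 <= a m)%E by rewrite mule_ge0// lee_fin invr_ge0 ltW.
pose d (m : int) := m - 1.
have di : injective d by move=> m m' /addIr.
have bE : b = fun m => (c%:E * a (d m))%E.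
  apply/funext => m; rewrite /a /d subrK muleA -EFinM mulfV ?mul1e//.
  by rewrite gt_eqF.
rewrite bE (lqZ_scale (a := fun m => a (d m)) q0 c0); last by move=> m; exact: a0.
rewrite EFinM -muleA; apply: lee_wpmul2l; first by rewrite lee_fin ltW.
apply: le_trans (@lqZ_comp_inj R q a d q0 di a0) _.
apply: H3 => //.
  by move=> t; rewrite mule_ge0 ?rearrangement_ge0// lee_fin powR_ge0.
move=> m t /andP[mt tm].
have t0 : 0 < t by apply: lt_le_trans mt; rewrite exprz_gt0.
rewrite /a /b /dyadic_rearrangement muleA -EFinM.
apply: lee_pmul; rewrite ?rearrangement_ge0//.
- by rewrite lee_fin mulr_ge0 ?powR_ge0// invr_ge0 ltW.
- rewrite lee_fin rmorphD/= mulrDl mul1r powR2D mulrCA mulVf ?gt_eqF// mulr1.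
  rewrite s'E -/sg powRrM powR_intmul//; apply: ge0_ler_powR => //.
  + by rewrite -s'E.
  + by rewrite nnegrE exprz_ge0.
  + by rewrite nnegrE ltW.
by apply: rearrangement_antitone; exact: ltW.
Qed.

End rearrangement_estimate.

(** * A function supported on sparse unit cubes *)

Section sparse_example.
Context {R : realType} (n : nat) (gam : R).
Hypotheses (gam_gt0 : 0 < gam) (gam_lt1 : gam < 1).
Local Open Scope classical_set_scope.
Import ComplexField.Normc.
Local Notation Rn := (n.+1.-tuple R).
Local Notation mu := (lebesgue_Rn R n.+1).

(** Exponential positions have the merit that the logarithm of the first coordinate recovers
    the index k up to 1. *)
Definition sparse_cube (k : nat) : set Rn :=
  [set x | expR k%:R <= tnth x ord0 < expR k%:R + 1 /\
    forall i, i != ord0 -> 0 <= tnth x i < 1].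

Lemma lebesgue_sparse_cube k : measurable (sparse_cube k) /\ mu (sparse_cube k) = 1%E.
Proof.
pose a : Rn := [tuple if i == ord0 then expR k%:R else 0 | i < n.+1].
pose b : Rn := [tuple tnth a i + 1 | i < n.+1].
have [|] := @lebesgue_Rn_box R n.+1 a b.
  by move=> i; rewrite [leRHS]tnth_mktuple lerDl.
set B := [set x | _]; have -> : B = sparse_cube k.
  apply/seteqP; split=> [x Bx|x [x0 xi] i].
    split=> [|i i0]; first by have := Bx ord0; rewrite !tnth_mktuple.
    by have := Bx i; rewrite !tnth_mktuple (negbTE i0) add0r.
  by rewrite !tnth_mktuple; case: eqVneq => [->//|i0]; rewrite add0r; exact: xi.
move=> mB ->; split => //; rewrite big1// => i _.
by rewrite !tnth_mktuple addrAC subrr add0r.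
Qed.

Lemma measurable_sparse_cube k : measurable (sparse_cube k).
Proof. by have [] := lebesgue_sparse_cube k. Qed.

Lemma expR_double (x y : R) : x + 1 <= y -> 2 * expR x <= expR y.
Proof.
move=> xy; apply: (@le_trans _ _ (expR (x + 1))); last by rewrite ler_expR.
rewrite expRD mulrC ler_wpM2l ?expR_ge0//.
by have := expR_ge1Dx (1 : R); lra.
Qed.

Lemma expR_nat_ge1 k : 1 <= expR k%:R :> R.
Proof. by rewrite -expR0 ler_expR. Qed.

Lemma trivIset_sparse_cube : trivIset setT sparse_cube.
Proof.
have H j k x : (j < k)%N -> sparse_cube j x -> sparse_cube k x -> False.
  move=> jk [/andP[_ xj] _] [/andP[kx _] _].
  have h : 2 * expR j%:R <= expR k%:R :> R by apply: expR_double; rewrite natr1 ler_nat.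
  by have := expR_nat_ge1 j; lra.
move=> j k _ _ [x [xj xk]]; have [jk|kj|//] := ltngtP j k.
- by case: (H j k x jk xj xk).
- by case: (H k j x kj xk xj).
Qed.

Lemma lebesgue_sparse_cubes K : mu (\big[setU/set0]_(k < K) sparse_cube k) = K%:R%:E.
Proof.
rewrite measure_bigsetU//; last 2 first.
- by move=> k; exact: measurable_sparse_cube.
- exact: trivIset_sparse_cube.
rewrite (eq_bigr (fun=> 1%:E)) ?sumEFin ?sumr_const ?card_ord//.
by move=> k _; exact: (lebesgue_sparse_cube k).2.
Qed.

Definition sparse_set : set Rn := \bigcup_k sparse_cube k.

Lemma measurable_sparse_set : measurable sparse_set.
Proof. by apply: bigcupT_measurable => k; exact: measurable_sparse_cube. Qed.

(** Comparable to (k+1)^-gam on the k-th cube; written with a logarithm, it is evidently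
    measurable. *)
Definition sparse_profile (x : Rn) : R :=
  \1_sparse_set x * (1 + ln (tnth x ord0)) `^ (- gam).

Definition sparse_fun (x : Rn) : R[i] := (sparse_profile x +i* 0)%C.

Lemma sparse_profile_ge0 x : 0 <= sparse_profile x.
Proof. by rewrite mulr_ge0 ?powR_ge0. Qed.

Lemma normc_sparse_fun x : normc (sparse_fun x) = sparse_profile x.
Proof. by rewrite /= expr0n/= addr0 sqrtr_sqr ger0_norm// sparse_profile_ge0. Qed.

Lemma measurable_sparse_profile : measurable_fun setT sparse_profile.
Proof.
apply: measurable_funM; first exact: measurable_indic measurable_sparse_set.
apply: (measurableT_comp (measurable_powR (- gam))).
apply: measurable_funD => //.
by apply: (measurableT_comp (@measurable_ln R)); exact: measurable_tnth.
Qed.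

Lemma cmeasurable_sparse_fun : cmeasurable sparse_fun.
Proof.
split; first exact: measurable_sparse_profile.
exact: measurable_cst.
Qed.

Lemma sparse_ln_itv k x : sparse_cube k x ->
  k%:R <= ln (tnth x ord0) < k.+1%:R.
Proof.
move=> [/andP[kx xk] _]; have x0 : 0 < tnth x ord0 by exact: lt_le_trans (expR_gt0 _) kx.
rewrite -[leLHS](expRK k%:R) -[ltRHS](expRK k.+1%:R) ler_ln ?ltr_ln ?posrE ?expR_gt0//.
rewrite kx/=; apply: lt_le_trans xk _.
have h : 2 * expR k%:R <= expR k.+1%:R :> R by apply: expR_double; rewrite natr1.
by have := expR_nat_ge1 k; lra.
Qed.

Lemma powRN_le (x y : R) : 0 < x -> x <= y -> y `^ (- gam) <= x `^ (- gam).
Proof.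
move=> x0 xy; have y0 : 0 < y by exact: lt_le_trans xy.
rewrite !powRN lef_pV2 ?posrE ?powR_gt0//.
by apply: ge0_ler_powR; rewrite ?nnegrE ?(ltW x0) ?(ltW y0) ?(ltW gam_gt0).
Qed.

Lemma sparse_profile_ge k x : sparse_cube k x ->
  (k%:R + 2) `^ (- gam) <= sparse_profile x.
Proof.
move=> kx; have /andP[l1 l2] := sparse_ln_itv kx.
have k0 : 0 <= k%:R :> R by [].
rewrite /sparse_profile indicE mem_set ?mul1r; last by exists k.
by rewrite -natr1 in l2; apply: powRN_le; lra.
Qed.

(** On the k-th cube the profile is at most (k+1)^-gam, so only the cubes with k + 1 < u
    contribute. *)
Lemma sparse_tail_le (u : R) : 0 < u ->
  (mu [set x | (u `^ (- gam) < sparse_profile x)%R] <= u%:E)%E.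
Proof.
move=> u0; have /andP[Ku uK] := truncn_itv (ltW u0).
set K := Num.Def.trunc u in Ku uK.
apply: (@le_trans _ _ (mu (\big[setU/set0]_(k < K) sparse_cube k))); last first.
  by rewrite [leLHS]lebesgue_sparse_cubes lee_fin.
apply: le_measure; rewrite ?inE.
- have -> : [set x | u `^ (- gam) < sparse_profile x] =
      sparse_profile @^-1` `]u `^ (- gam), +oo[.
    by apply/seteqP; split=> x /=; rewrite in_itv/= andbT.
  by rewrite -[X in measurable X]setTI; exact: measurable_sparse_profile.
- by apply: bigsetU_measurable => k _; exact: measurable_sparse_cube.
move=> x /= ux; rewrite -bigcup_mkord.
have [[k _ kx]|xS] := pselect (sparse_set x); last first.
  by move: ux; rewrite /sparse_profile indicE memNset// mul0r ltNge powR_ge0.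
exists k => //=; have /andP[l1 l2] := sparse_ln_itv kx.
have k0 : 0 <= k%:R :> R by [].
have ku : k.+1%:R < u.
  rewrite ltNge; apply/negP => uk; move: ux; apply/negP; rewrite -leNgt.
  rewrite /sparse_profile indicE mem_set ?mul1r; last by exists k.
  by apply: powRN_le => //; rewrite -natr1 in uk; lra.
by have := lt_trans ku uK; rewrite ltr_nat ltnS.
Qed.

(** The levels (t/2^i)^-gam and [sparse_tail_le] turn [integral_le_layers] into a geometric
    series, convergent since gam < 1. *)
Lemma integral_sparse_le : exists2 C : R, 0 < C & forall (F : set Rn) (t : R),
  measurable F -> 0 < t -> (mu (F `&` sparse_set) <= t%:E)%E ->
  (\int[mu]_(x in F) (normc (sparse_fun x))%:E <= (C * t `^ (1 - gam))%:E)%E.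
Proof.
pose z : R := 2 `^ (gam - 1).
have z0 : 0 <= z by exact: powR_ge0.
have z1 : z < 1 by apply: powR2_lt1; rewrite subr_lt0.
have := nneseries_geometric_lty (introT andP (conj z0 z1)).
set S := (X in (X < _)%E) => Slty.
have S0 : (0 <= S)%E by apply: nneseries_ge0 => i _ _; rewrite lee_fin exprn_ge0.
have SE : S = (fine S)%:E by rewrite fineK// ge0_fin_numE.
exists (2 * (fine S + 1)); first by rewrite mulr_gt0// ltr_wpDl// fine_ge0.
move=> F t mF t0 muF.
have mFS : measurable (F `&` sparse_set) by apply: measurableI => //; exact: measurable_sparse_set.
have -> : (\int[mu]_(x in F) (normc (sparse_fun x))%:E =
    \int[mu]_(x in F `&` sparse_set) (sparse_profile x)%:E)%E.
  rewrite integral_mkcondr; apply: eq_integral => x _.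
  rewrite normc_sparse_fun patchE; case: ifPn => // xS.
  by rewrite /sparse_profile indicE (negbTE xS) mul0r.
pose r i : R := (t * 2^-1 ^+ i) `^ (- gam).
pose tau i : R := 2 * t * 2^-1 ^+ i.
have ti0 i : 0 < t * 2^-1 ^+ i by rewrite mulr_gt0// exprn_gt0// invr_gt0.
have r0 i : 0 <= r i by exact: powR_ge0.
have tau0 : tau @ \oo --> (0 : R).
  by apply: (@cvg_geometric R (2 * t)); rewrite ger0_norm ?invr_ge0// invf_lt1// ltr1n.
have mur i : (mu [set x | (r i < sparse_profile x)%R] <= (tau i.+1)%:E)%E.
  have -> : tau i.+1 = t * 2^-1 ^+ i by rewrite /tau exprS; field.
  exact: sparse_tail_le.
have muF' : (mu (F `&` sparse_set) <= (tau 0%N)%:E)%E.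
  by apply: le_trans muF _; rewrite lee_fin /tau expr0 mulr1; lra.
apply: le_trans (integral_le_layers mFS measurable_sparse_profile sparse_profile_ge0
  r0 muF' mur tau0) _.
pose B := 2 * t `^ (1 - gam).
have -> : (\sum_(0 <= i <oo) (r i * tau i)%:E = B%:E * S)%E.
  rewrite /S -nneseriesZl; last by move=> i _; rewrite lee_fin exprn_ge0.
  apply: eq_eseriesr => i _; rewrite -EFinM; congr (_%:E).
  rewrite /r /tau /B -mulrA mulrCA -mulrA; congr (_ * _).
  have -> : z ^+ i = (2^-1 ^+ i) `^ (1 - gam).
    rewrite -powR_mulrn ?invr_ge0// -powR_inv1// -!powRrM /z powR2X -powRrM.
    by congr (_ `^ _); ring.
  rewrite -powRM ?(ltW t0) ?exprn_ge0 ?invr_ge0//.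
  rewrite -[X in _ * X](powRr1 (ltW (ti0 i))) -powRD ?(gt_eqF (ti0 i)) ?implybT//.
  by congr (_ `^ _); ring.
rewrite SE -EFinM lee_fin /B.
have tp : 0 <= t `^ (1 - gam) by exact: powR_ge0.
by rewrite -!mulrA ler_wpM2l// mulrC ler_wpM2r// lerDl.
Qed.

(** A bound for the measure of the part of the support inside one dyadic cube of scale m: the
    full volume for small cubes, but only logarithmic growth in the side for large ones. *)
Definition cube_charge (m : int) : R :=
  if m is Posz k then k%:R + 2 else (2 ^ m) ^+ n.+1.

Lemma cube_charge_gt0 m : 0 < cube_charge m.
Proof. by case: m => k /=; rewrite ?exprn_gt0 ?exprz_gt0// ltr_wpDl. Qed.

(** For m >= 0, the unit cubes of index beyond m are farther apart than 2^m, so at most one of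
    them meets a given dyadic cube of that side; the other m + 1 are counted crudely. *)
Lemma sparse_dcube_le m k : (mu (dcube m k `&` sparse_set) <= (cube_charge m)%:E)%E.
Proof.
have mQ : measurable (dcube m k : set Rn) by exact: measurable_dcube.
have mQS : measurable (dcube m k `&` sparse_set).
  by apply: measurableI => //; exact: measurable_sparse_set.
case: m mQ mQS => m mQ mQS; last first.
  apply: le_trans (_ : mu (dcube (Negz m) k) <= _)%E.
    by apply: le_measure; rewrite ?inE// => x [].
  by rewrite [leLHS](lebesgue_dcube (Negz m) k).2.
have [j0 Hj0] : exists j0, dcube (Posz m) k `&` sparse_set `<=`
    \big[setU/set0]_(j < m.+1) sparse_cube j `|` sparse_cube j0.
  have [[j0 [mj0 [y [yQ yj0]]]]|H] := pselect (exists j, (m < j)%N /\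
      exists x, dcube (Posz m) k x /\ sparse_cube j x); last first.
    exists 0%N => x [xQ [j _ jx]]; left; rewrite -bigcup_mkord; exists j => //=.
    by rewrite ltnS leqNgt; apply/negP => mj; apply: H; exists j; split=> //; exists x.
  exists j0 => x [xQ [j _ jx]].
  have [jm|mj] := leqP j m; first by left; rewrite -bigcup_mkord; exists j.
  right; suff -> : j0 = j by [].
  have expm i : (m < i)%N -> 2 ^+ m + 1 <= expR i%:R :> R.
    elim: m {mQ mQS xQ yQ mj mj0} i => [|l IH] [|i]//.
      move=> _; apply: le_trans (expR_ge1Dx _) => //.
      by rewrite expr0 lerD2l ler1n.
    rewrite ltnS => /IH h.
    have h' : 2 * expR i%:R <= expR i.+1%:R :> R by apply: expR_double; rewrite natr1.
    by rewrite exprS; lra.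
  have H i l z w : (m < i)%N -> (i < l)%N -> dcube (Posz m) k z -> dcube (Posz m) k w ->
      sparse_cube i z -> sparse_cube l w -> False.
    move=> mi il /(_ ord0) + /(_ ord0) + [/andP[_ zi] _] [/andP[lw _] _].
    have h' : 2 * expR i%:R <= expR l%:R :> R by apply: expR_double; rewrite natr1 ler_nat.
    have := expm i mi; rewrite -!exprnP.
    set T := _ * _; move=> hi /andP[z1 _] /andP[_ w2]; move: z1 w2 zi lw h' hi.
    by move: (2 ^+ m) T (expR i%:R) (expR l%:R) (tnth z ord0) (tnth w ord0) => *; lra.
  have [lt|lt|//] := ltngtP j0 j.
  - by case: (H j0 j y x).
  - by case: (H j j0 x y).
have mU : measurable (\big[setU/set0]_(j < m.+1) sparse_cube j).
  by apply: bigsetU_measurable => j _; exact: measurable_sparse_cube.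
apply: le_trans (_ : mu (\big[setU/set0]_(j < m.+1) sparse_cube j `|` sparse_cube j0) <= _)%E.
  by apply: le_measure; rewrite ?inE//; apply: measurableU => //; exact: measurable_sparse_cube.
apply: le_trans (measureU2 _ mU (measurable_sparse_cube j0)) _.
rewrite [X in (X + _)%E]lebesgue_sparse_cubes [X in (_ + X)%E](lebesgue_sparse_cube j0).2.
by rewrite -EFinD lee_fin /= -natr1; lra.
Qed.

Lemma sparse_dcubes_le m (e : {fset n.+1.-tuple int}) :
  (mu (dcubes m e `&` sparse_set) <= (#|` e|%:R * cube_charge m)%:E)%E.
Proof.
have mD := @measurable_dcubes R n.+1 m e.
have mS := measurable_sparse_set.
rewrite setIC -(integral_indic mu mD mS).
rewrite ge0_integral_dcubes; last 2 first.
- by apply/measurable_EFinP; exact: measurable_indic.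
- by move=> x; rewrite lee_fin.
apply: (@le_trans _ _ (\sum_(k <- e) (cube_charge m)%:E)%E).
  apply: lee_sum => k _; rewrite (integral_indic mu (measurable_dcube m k) mS) setIC.
  exact: sparse_dcube_le.
by rewrite sumEFin lee_fin big_const_seq count_predT iter_addr_0 mulr_natl.
Qed.

(** The number of cubes drops out since 1 - gam < 1/P leaves a negative power of it to absorb the
    logarithms. What remains is the power 1 - gam of the charge over 2^(mn sg): for m < 0
    it is 2^(mn (1 - gam - sg)), which decays as m decreases, and for m >= 0 it is at most
    (m + 2) 2^(-mn sg). *)
Lemma D_norm_sparse_lty (p : R) (q : \bar R) (lam : R) : (0 < q)%E ->
  let sg := p^-1 - lam / n.+1%:R in
  0 < sg -> sg < 1 - gam -> 1 - gam < D_exponent n.+1 p lam / n.+1%:R + sg ->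
  (D_norm p q lam sparse_fun < +oo)%E.
Proof.
move=> q0 sg sg0 sgg gbe; rewrite D_normE.
set be := _ / _ in gbe; pose eta := be + sg - (1 - gam).
have eta0 : 0 < eta by rewrite subr_gt0.
have [C1 C10 H1] := one_add_ln_exp_le n.+2 eta0.
have [C2 C20 H2] := integral_sparse_le.
pose W m : R := ((2 ^ m) ^+ n.+1) `^ sg.
have W0 m : 0 < W m by rewrite powR_gt0// exprn_gt0// exprz_gt0.
have key m : (D_sup p lam sparse_fun m <=
    (C1 * C2 * (cube_charge m `^ (1 - gam) / W m))%:E)%E.
  apply: ge_ereal_sup => _ [e e0 <-].
  have N1 : 1 <= #|` e|%:R :> R by rewrite ler1n cardfs_gt0.
  have cm0 := cube_charge_gt0 m.
  have N0 : 0 < #|` e|%:R :> R by exact: lt_le_trans N1.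
  have := H2 (dcubes m e) _ (@measurable_dcubes R n.+1 m e) (mulr_gt0 N0 cm0)
    (sparse_dcubes_le m e).
  have w0 := D_weight_gt0 p lam m e0.
  move=> /(lee_wpmul2l (x := (D_weight p lam m e)%:E)) H.
  apply: le_trans (H _) _; first by rewrite lee_fin ltW.
  rewrite -EFinM lee_fin D_weightE -/sg -/be -/(W m).
  rewrite powRM ?(ltW N0) ?(ltW cm0)//.
  have h1 := H1 _ N1.
  have hN : #|` e|%:R `^ eta * #|` e|%:R `^ (1 - gam) = #|` e|%:R `^ be * #|` e|%:R `^ sg :> R.
    by rewrite -!powRD ?(gt_eqF N0) ?implybT// /eta subrK.
  have pN x : 0 < (#|` e|%:R : R) `^ x by exact: powR_gt0.
  move: (pN eta) (pN (1 - gam)) (pN be) (pN sg) (W0 m) h1 hN.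
  move: (#|` e|%:R `^ eta) (#|` e|%:R `^ (1 - gam)) (#|` e|%:R `^ be) (#|` e|%:R `^ sg)
    (W m) ((1 + ln #|` e|%:R) ^+ n.+2) (powR_ge0 (cube_charge m) (1 - gam)).
  move: (cube_charge m `^ (1 - gam)) => c x1 x2 x3 x4 w L c0 x10 x20 x30 x40 ww h1 hN.
  have -> : L / x3 / (x4 * w) * (C2 * (x2 * c)) = L * (C2 * x2 * c / (x3 * x4 * w)).
    by field; rewrite !gt_eqF.
  have -> : C1 * C2 * (c / w) = C1 * x1 * (C2 * x2 * c / (x3 * x4 * w)).
    rewrite -hN; field; by rewrite !gt_eqF.
  rewrite ler_wpM2r// divr_ge0 ?mulr_ge0 ?(ltW C20) ?(ltW x20) ?(ltW x30) ?(ltW x40) ?(ltW ww)//.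
pose y : R := 2^-1 ^+ n.+1.
have y0 : 0 < y by rewrite exprn_gt0// invr_gt0.
have y1 : y < 1 by rewrite exprn_ilt1// ?invr_ge0// invf_lt1// ltr1n.
have yp x : 0 < x -> 0 < y `^ x < 1.
  by move=> x0; rewrite powR_gt0//=; apply: powR_lt1 => //; exact: ltW.
pose dl := 1 - gam - sg; have dl0 : 0 < dl by rewrite subr_gt0.
have /andP[p1 p1'] := yp _ dl0.
have sg20 : 0 < sg / 2 by rewrite divr_gt0.
have /andP[p2 p2'] := yp _ sg20.
have [C3 C30 H3] := linear_geometric_bounded (introT andP (conj p2 p2')).
pose x := Num.max (y `^ dl) (y `^ (sg / 2)).
have x01 : 0 < x < 1 by rewrite /x lt_max p1/= gt_max p1' p2'.
have twoE k : (2 ^ Negz k) ^+ n.+1 = y ^+ k.+1 :> R.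
  by rewrite /y exprAC; congr (_ ^+ _); rewrite exprVn.
have twoE' k : (2 ^ Posz k) ^+ n.+1 = (y ^+ k)^-1 :> R.
  by rewrite /y exprAC -[RHS]exprVn; congr (_ ^+ _); rewrite exprVn invrK.
have powRX u v k : 0 <= u -> (u ^+ k) `^ v = (u `^ v) ^+ k :> R.
  exact: powRXn.
have bound m : cube_charge m `^ (1 - gam) / W m <= (1 + C3) * x ^+ `|m|%N.
  have xm : 0 <= x ^+ `|m|%N by rewrite exprn_ge0//; case/andP: x01 => /ltW.
  case: m xm => k xm.
    rewrite /= /W twoE' -exprVn powRX ?invr_ge0 ?(ltW y0)// -exprVn -powRN.
    have -> : y^-1 `^ (- sg) = y `^ (sg / 2) * y `^ (sg / 2).
      rewrite -powRD ?(gt_eqF y0) ?implybT// -splitr -powR_inv1 ?(ltW y0)// -powRrM.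
      by congr (_ `^ _); ring.
    rewrite exprMn mulrA.
    apply: ler_pM; rewrite ?exprn_ge0 ?powR_ge0// ?mulr_ge0 ?exprn_ge0 ?powR_ge0//.
      apply: le_trans (le_trans (H3 k) _); last by rewrite lerDr.
      rewrite ler_wpM2r ?exprn_ge0 ?powR_ge0//.
      have k1 : 1 <= k%:R + 2 :> R by have : 0 <= k%:R :> R by []; lra.
      rewrite -[leRHS]powRr1; last by rewrite (le_trans ler01).
      by apply: ler_powR => //; rewrite gerBl ltW.
    by apply: lerXn2r; rewrite ?nnegrE ?powR_ge0// /x ?le_max ?powR_ge0// lexx orbT.
  rewrite /cube_charge /W twoE.
  have yk0 : 0 < y ^+ k.+1 by rewrite exprn_gt0.
  rewrite -powRN -powRD ?(gt_eqF yk0) ?implybT// -/dl powRX ?(ltW y0)//.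
  apply: (@le_trans _ _ (x ^+ k.+1)).
    by apply: lerXn2r; rewrite ?nnegrE ?powR_ge0// /x ?le_max ?powR_ge0// lexx.
  by rewrite ler_peMl// lerDl ltW.
apply: (@lqZ_geometric_lty R q x (C1 * C2 * (1 + C3)) _ q0 x01).
  by rewrite !mulr_gt0// addr_gt0.
move=> m; rewrite D_sup_ge0/=; apply: le_trans (key m) _; rewrite lee_fin.
by rewrite -[leRHS]mulrA ler_wpM2l ?mulr_ge0 ?(ltW C10) ?(ltW C20).
Qed.

(** The first cubes, in number larger than t, have total measure larger than t, and the
    profile is at least (t+2)^-gam on them. *)
Lemma rearrangement_sparse_ge (t : R) : 0 <= t ->
  (((t + 2) `^ (- gam))%:E <= rearrangement sparse_fun t)%E.
Proof.
move=> t0; apply: le_ereal_inf_tmp => _ [s [s0 st] <-].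
rewrite lee_fin leNgt; apply/negP => sl; move: st; apply/negP; rewrite -ltNge.
have /andP[Kt tK] := truncn_itv t0; set K := Num.Def.trunc t in Kt tK.
apply: (@lt_le_trans _ _ (mu (\big[setU/set0]_(k < K.+1) sparse_cube k))).
  by rewrite [ltRHS]lebesgue_sparse_cubes lte_fin.
apply: le_measure; rewrite ?inE.
- by apply: bigsetU_measurable => k _; exact: measurable_sparse_cube.
- exact: measurable_gt cmeasurable_sparse_fun.
move=> x; rewrite -bigcup_mkord => -[k kK kx].
rewrite /mkset normc_sparse_fun; apply: lt_le_trans sl _.
apply: le_trans (sparse_profile_ge kx); apply: powRN_le; first by rewrite ltr_wpDl.
by rewrite lerD2r; apply: le_trans Kt; rewrite ler_nat -ltnS.
Qed.

(** The Lorentz integrand is at least a constant times t^(1/s' - gam) for t >= 1, so its dyadic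
    values are unbounded, whatever q is. *)
Lemma lorentz_sparse_infty (s' : R) (q : \bar R) : (0 < q)%E -> gam < s'^-1 ->
  lorentz s' q sparse_fun = +oo%E.
Proof.
move=> q0 gs; pose eps := s'^-1 - gam; have eps0 : 0 < eps by rewrite subr_gt0.
have [C C0 HC] := lqZ_le_Lq_dt_t (R := R) q0.
pose F t := ((t `^ s'^-1)%:E * rearrangement sparse_fun t)%E.
have F0 t : (0 <= F t)%E by rewrite mule_ge0 ?rearrangement_ge0// lee_fin powR_ge0.
(* the geometric growth 2^(k eps) is only needed through the linear bound 1 + k d *)
pose d : R := 2 `^ eps - 1.
have d0 : 0 < d.
  rewrite subr_gt0 -[2 `^ eps]invrK -powRN invf_gt1 ?powR_gt0//.
  by apply: powR2_lt1; rewrite oppr_lt0.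
pose a m : \bar R := if m is Posz k then (3 `^ (- gam) * (1 + k%:R * d))%:E else 0%E.
have a0 m : (0 <= a m)%E.
  case: m => // k; rewrite lee_fin mulr_ge0 ?powR_ge0// addr_ge0// mulr_ge0// ltW//.
have aF m t : 2 ^ m <= t < 2 ^ (m + 1) -> (a m <= F t)%E.
  case: m => [k|//] /andP[kt _].
  have k1 : 1 <= 2 ^+ k :> R by rewrite exprn_ege1// ler1n.
  have t1 : 1 <= t by exact: le_trans kt.
  have t0 : 0 < t by exact: lt_le_trans t1.
  apply: le_trans (_ : ((t `^ s'^-1)%:E * ((t + 2) `^ (- gam))%:E <= _)%E); last first.
    by apply: lee_wpmul2l; [rewrite lee_fin powR_ge0|apply: rearrangement_sparse_ge; exact: ltW].
  rewrite -EFinM lee_fin.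
  apply: (@le_trans _ _ (t `^ s'^-1 * (3 * t) `^ (- gam))); last first.
    by rewrite ler_wpM2l ?powR_ge0//; apply: powRN_le; lra.
  rewrite powRM ?(ltW t0)// mulrCA ler_wpM2l ?powR_ge0//.
  rewrite -powRD ?(gt_eqF t0) ?implybT// -/eps.
  apply: le_trans (bernoulli_le k (ltW d0)) _; rewrite /d addrC subrK.
  rewrite -[in leLHS](powR_mulrn k) ?powR_ge0// -powRrM mulrC powRrM powR_mulrn//.
  by apply: ge0_ler_powR; rewrite ?nnegrE ?(ltW eps0) ?(ltW t0) ?exprn_ge0.
have Hle := HC F a F0 a0 aF.
apply/eqP; rewrite eq_le leey/= leNgt; apply/negP => Llt.
have L0 : (0 <= lorentz s' q sparse_fun)%E.
  have := le_trans (lqZ_ge 0 q0 a0) Hle; rewrite -/(lorentz s' q sparse_fun).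
  move=> h; have : (0 <= C%:E * lorentz s' q sparse_fun)%E by apply: le_trans h; exact: a0.
  by rewrite pmule_rge0// lte_fin.
have LE : lorentz s' q sparse_fun = (fine (lorentz s' q sparse_fun))%:E.
  by rewrite fineK// ge0_fin_numE.
set L := fine _ in LE.
pose k := (Num.Def.trunc (C * L / (3 `^ (- gam) * d))).+1.
have g3 : 0 < 3 `^ (- gam) :> R by exact: powR_gt0.
have : (a (Posz k) <= (C * L)%:E)%E.
  by apply: le_trans (lqZ_ge _ q0 a0) _; rewrite EFinM -LE.
rewrite lee_fin; apply/negP; rewrite -ltNge.
have X0 : 0 <= C * L / (3 `^ (- gam) * d).
  by rewrite divr_ge0 ?mulr_ge0 ?fine_ge0 ?(ltW C0) ?(ltW g3) ?(ltW d0).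
have /andP[_] := truncn_itv X0; rewrite -/k ltr_pdivrMr ?mulr_gt0// => h.
apply: lt_trans h _.
have -> : 3 `^ (- gam) * (1 + k%:R * d) = 3 `^ (- gam) + k%:R * (3 `^ (- gam) * d) by ring.
by rewrite ltrDr.
Qed.

End sparse_example.

(** * The corollary *)

Theorem corollary4p4 (R : realType) (n : nat) (p : R) (q : \bar R)
    (lam s s' : R) (n_ge1 : (1 <= n)%N) (p_gt0 : 0 < p) (q_gt0 : (0 < q)%E)
    (lam_gt : Num.max 0 (n%:R / p - n%:R / 2) < lam) (lam_lt : lam < n%:R / p)
    (sE : s^-1 = p^-1 - lam / n%:R) (s'E : s' = s / (s - 1)) :
  [/\ 0 < s^-1 < 2^-1,
      exists2 C : R, 0 < C & forall f : n.-tuple R -> R[i], cintegrable f ->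
        (morrey p q lam (fourier f) <= C%:E * lorentz s' q f)%E &
      [/\ exists2 C : R, 0 < C & forall f : n.-tuple R -> R[i], cintegrable f ->
            (morrey p q lam (fourier f) <= C%:E * D_norm p q lam f)%E,
          exists2 C : R, 0 < C & forall f : n.-tuple R -> R[i], cintegrable f ->
            (D_norm p q lam f <= C%:E * lorentz s' q f)%E &
          exists f : n.-tuple R -> R[i],
            [/\ cmeasurable f, (D_norm p q lam f < +oo)%E &
                lorentz s' q f = +oo%E]]].
Proof.
have nR0 : 0 < n%:R :> R by rewrite ltr0n.
have lam0 : 0 < lam by apply: le_lt_trans lam_gt; rewrite le_max lexx.
have sg0 : 0 < p^-1 - lam / n%:R.
  by rewrite subr_gt0 ltr_pdivrMr// mulrC.
have be0 : 0 < D_exponent n p lam by rewrite subr_gt0.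
have sg_be := sigma_add_beta lam n_ge1 p_gt0.
have be0' : 0 < D_exponent n p lam / n%:R by exact: divr_gt0.
have P2 : (Num.max p 2)^-1 <= 2^-1 :> R.
  by rewrite lef_pV2 ?posrE ?lt_max ?ltr0n ?orbT// le_max lexx orbT.
have s0 : s != 0 by apply: contraTneq sg0 => s0; rewrite -sE s0 invr0 ltxx.
have s'V : s'^-1 = 1 - (p^-1 - lam / n%:R).
  by rewrite -sE s'E invf_div mulrBl mulfV// mul1r.
have s'0 : 0 <= s'^-1 by rewrite s'V; lra.
have D_to_lorentz := D_norm_le_lorentz n_ge1 p_gt0 q_gt0 sg0 be0 s'V s'0.
have fourier_to_D := morrey_fourier_le n_ge1 p_gt0 q_gt0 (ltW lam0).
split.
- by rewrite sE sg0/=; lra.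
- have [C C0 HC] := fourier_to_D; have [C' C'0 HC'] := D_to_lorentz.
  exists (C * C'); first exact: mulr_gt0.
  move=> f fi; apply: le_trans (HC f fi) _; rewrite EFinM -muleA.
  by apply: lee_wpmul2l (HC' f fi); rewrite lee_fin ltW.
split => //.
case: n n_ge1 nR0 {lam_gt lam_lt D_to_lorentz fourier_to_D} sE sg0 be0 sg_be be0' s'V
  => // n _ _ sE sg0 be0 sg_be be0' s'V.
set sg := p^-1 - _ in sg0 sg_be s'V.
set be := D_exponent _ _ _ / _ in sg_be be0'.
(* the midpoint of the conditions sg < 1 - gam < sg + be *)
pose gam := 1 - sg - be / 2.
have gam0 : 0 < gam by rewrite /gam; lra.
have gam1 : gam < 1 by rewrite /gam; lra.
exists (sparse_fun gam); split.
- exact: cmeasurable_sparse_fun.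
- by apply: (@D_norm_sparse_lty R n gam gam0 gam1) => //; rewrite -/sg -?/be /gam; lra.
- by apply: lorentz_sparse_infty => //; rewrite s'V /gam; lra.
Qed.
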